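(* Let $X$ be a complex separable Hilbert space, let $\xi>0$, $\delta>0$, $p\in(0,2)$, and let $\boldsymbol b=(b_j)_{j\in\mathbb N}\in(0,\infty)^\infty\cap\ell^p(\mathbb N)$. Let $u$ be $(\boldsymbol b,\xi,2,\delta,X)$-holomorphic. Let $M\in\mathbb N$ with $M\ge 2/p$, and let $\boldsymbol\varrho=(\varrho_j)_{j\in\mathbb N}\in(0,\infty)^\infty$ be given by $$\varrho_j^2 b_j^2=\Big(\frac{b_j}{\|\boldsymbol b\|_{\ell^p}}\Big)^p\frac{\xi^2}{8e\,M!}\qquad\forall j\in\mathbb N .$$ Then the Wiener–Hermite coefficients $(u_{\boldsymbol\nu})_{\boldsymbol\nu\in\mathcal F}$ of $u$ satisfy $$\sum_{\boldsymbol\nu\in\mathcal F}\beta_{\boldsymbol\nu}(M,\boldsymbol\varrho)\|u_{\boldsymbol\nu}\|_X^2\le 2\delta^2,\qquad \big(\beta_{\boldsymbol\nu}(M,\boldsymbol\varrho)^{-1}\big)_{\boldsymbol\nu\in\mathcal F}\in\ell^{p/(2-p)}(\mathcal F).$$ Furthermore, $(\|u_{\boldsymbol\nu}\|_X)_{\boldsymbol\nu\in\mathcal F}\in\ell^p(\mathcal F)$.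
   Context: Notation. $\mathcal F$ is the set of sequences $\boldsymbol\nu=(\nu_j)_{j\ge1}\in\mathbb N_0^\infty$ with finitely many nonzero entries. $\gamma_N=\bigotimes_{j=1}^N\mathcal N(0,1)$ on $\mathbb R^N$ and $\gamma=\bigotimes_{j\in\mathbb N}\mathcal N(0,1)$ on $\mathbb R^\infty=\prod_{j\in\mathbb N}\mathbb R$ are product standard Gaussian measures; $L^2_\gamma(\mathbb R^\infty,X)$ is the Bochner space with norm $\|v\|^2=\int_{\mathbb R^\infty}\|v(\boldsymbol y)\|_X^2\,\gamma(d\boldsymbol y)$. $\|\boldsymbol b\|_{\ell^p}=(\sum_j b_j^p)^{1/p}$ (a quasi-norm if $p<1$). Hermite expansion. $(H_n)_{n\in\mathbb N_0}$ are the univariate Hermite polynomials normalized to be orthonormal in $L^2_{\gamma_1}(\mathbb R)$, and $H_{\boldsymbol\nu}(\boldsymbol y)=\prod_{j}H_{\nu_j}(y_j)$ for $\boldsymbol\nu\in\mathcal F$. For $u\in L^2_\gamma(\mathbb R^\infty,X)$, $u_{\boldsymbol\nu}=\int_{\mathbb R^\infty}u(\boldsymbol y)H_{\boldsymbol\nu}(\boldsymbol y)\,\gamma(d\boldsymbol y)\in X$. Weights. For $M\in\mathbb N$ and $\boldsymbol\varrho\in(0,\infty)^\infty$: $\beta_{\boldsymbol\nu}(M,\boldsymbol\varrho)=\prod_{j\in\mathbb N}\Big(\sum_{\ell=0}^M\binom{\nu_j}{\ell}\varrho_j^{2\ell}\Big)$, $\boldsymbol\nu\in\mathcal F$ (with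 $\binom{n}{\ell}=0$ if $\ell>n$). Admissibility. For $\boldsymbol b\in(0,\infty)^\infty$, $\xi>0$, a vector $\boldsymbol\varrho\in(0,\infty)^N$ is $(\boldsymbol b,\xi,2)$-admissible if $\sum_{j=1}^N b_j^2\varrho_j^2\le\xi^2$. Holomorphy. For $\boldsymbol\varrho\in(0,\infty)^N$ let $\mathcal S^{\mathbb C}_{\boldsymbol\varrho}=\{\boldsymbol z\in\mathbb C^N:|\Im z_j|<\varrho_j\ \forall j\}$ and $\mathcal B(\boldsymbol\varrho)=\{\boldsymbol z\in\mathbb C^N:|z_j|<\varrho_j\ \forall j\}$. A function $u\in L^2_\gamma(\mathbb R^\infty,X)$ is called $(\boldsymbol b,\xi,2,\delta,X)$-holomorphic if: (1) for every $N\in\mathbb N$ there is $u_N:\mathbb R^N\to X$ which, for every $(\boldsymbol b,\xi,2)$-admissible $\boldsymbol\varrho\in(0,\infty)^N$, admits a holomorphic extension (again denoted $u_N$) $\mathcal S^{\mathbb C}_{\boldsymbol\varrho}\to X$; and for all $N<M$, $u_N(y_1,\dots,y_N)=u_M(y_1,\dots,y_N,0,\dots,0)$ for all $(y_j)_{j=1}^N\in\mathbb R^N$; (2) for every $N\in\mathbb N$ there is $\varphi_N:\mathbb R^N\to\mathbb R_+$ with $\|\varphi_N\|_{L^2_{\gamma_N}(\mathbb R^N)}\le\delta$ and $\sup_{\boldsymbol\varrho\in(0,\infty)^N\ (\boldsymbol b,\xi,2)\text{-admissible}}\ \sup_{\boldsymbol z\in\mathcal B(\boldsymbol\varrho)}\|u_N(\boldsymbol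 y+\boldsymbol z)\|_X\le\varphi_N(\boldsymbol y)$ for all $\boldsymbol y\in\mathbb R^N$; (3) with $\tilde u_N(\boldsymbol y)=u_N(y_1,\dots,y_N)$ for $\boldsymbol y\in\mathbb R^\infty$, $\lim_{N\to\infty}\|u-\tilde u_N\|_{L^2_\gamma(\mathbb R^\infty,X)}=0$. *)

(* Defs.v *)
From HB Require Import structures.
From mathcomp Require Import all_boot all_order all_algebra.
From mathcomp Require Import finmap.
From mathcomp Require Import complex.
From mathcomp Require Import all_classical all_reals all_analysis.
From mathcomp Require Import sesquilinear.

Set Implicit Arguments.
Unset Strict Implicit.
Unset Printing Implicit Defensive.

Import Order.TTheory GRing.Theory Num.Theory.
Import numFieldNormedType.Exports.

Local Open Scope classical_set_scope.
Local Open Scope ring_scope.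
Local Open Scope complex_scope.

(* The norm of a normed [R[i]]-module is valued in [R[i]], but it is always a
   nonnegative real there, so that taking the real part loses nothing. *)
Definition rnorm (R : realType) (X : normedModType R[i]) (x : X) : R :=
  complex.Re `|x|.

Definition is_hilbert (R : realType) (X : completeNormedModType R[i]) : Prop :=
  exists dot : {dot X for @Num.conj R[i]}, forall x : X, dot x x = `|x| ^+ 2.

Definition separable (T : topologicalType) : Prop :=
  exists D : set T, countable D /\ dense D.

Section Bochner.
Context {d : measure_display} {T : measurableType d} {R : realType}.
Context {X : completeNormedModType R[i]} (mu : probability T R).

Definition simple_function (s : T -> X) : Prop :=
  finite_set (range s) /\ forall x, measurable (s @^-1` [set x]).

Definition simple_integral (s : T -> X) : X :=
  \sum_(x \in range s) (fine (mu (s @^-1` [set x])))%:C *: x.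

Definition strongly_measurable (f : T -> X) : Prop :=
  exists s : nat -> T -> X, (forall n, simple_function (s n)) /\
    forall t, s n t @[n --> \oo] --> f t.

Definition is_bochner_integral (f : T -> X) (x : X) : Prop :=
  strongly_measurable f /\
  exists s : nat -> T -> X,
    [/\ forall n, simple_function (s n),
        (\int[mu]_t (rnorm (f t - s n t))%:E)%E @[n --> \oo] --> 0%E &
        simple_integral (s n) @[n --> \oo] --> x].

(* the junk value 0 is used when f is not Bochner integrable *)
Definition bochner_integral (f : T -> X) : X :=
  xget 0 [set x | is_bochner_integral f x].

Definition bochner_L2norm (f : T -> X) : \bar R :=
  'N[mu]_(2%:E) [EFin \o (@rnorm R X \o f)].

(* Elements of the Bochner space are represented by strongly measurable
   functions, instead of classes of such functions. *)
Definition in_bochner_L2 (f : T -> X) : Prop :=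
  strongly_measurable f /\ (bochner_L2norm f < +oo)%E.

End Bochner.

Section Gaussian.
Context {R : realType}.

Definition cylinders : set (set (nat -> R)) :=
  [set C | exists j (A : set R), measurable A /\ C = [set y | A (y j)]].

(* When the coordinates generate the sigma-algebra of T, this characterizes
   the product of standard Gaussian measures. *)
Definition std_gaussian_product {d} {T : measurableType d} {I : choiceType}
    (coord : I -> T -> R) (mu : probability T R) : Prop :=
  forall (J : {fset I}) (A : I -> set R), (forall j, measurable (A j)) ->
    mu [set y | forall j, j \in J -> A j (coord j y)] =
    (\prod_(j <- J) normal_prob 0 1 (A j))%E.

End Gaussian.

(* R^oo with its product sigma-algebra; coordinates are indexed from 0. *)
Notation Rinfty R := (g_sigma_algebraType (@cylinders R)).

Definition std_gaussian_infty (R : realType)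
    (gamma : probability (Rinfty R) R) : Prop :=
  std_gaussian_product (fun (j : nat) (y : Rinfty R) => y j) gamma.

Definition std_gaussian_fin (R : realType) (N : nat)
    (gammaN : probability (N.-tuple R) R) : Prop :=
  std_gaussian_product (fun (j : 'I_N) (y : N.-tuple R) => tnth y j) gammaN.

Definition lp_norm (R : realType) (I : choiceType) (p : R) (a : I -> R)
    : \bar R :=
  ((\esum_(i in [set: I]) (`|a i| `^ p)%:E) `^ p^-1)%E.

Definition in_lp (R : realType) (I : choiceType) (p : R) (a : I -> R) : Prop :=
  (lp_norm p a < +oo)%E.

Definition multiindex := {fsfun nat -> nat with 0%N}.

Section Hermite.
Context {R : realType}.

(* Probabilists' Hermite polynomials He_n, whose L^2 norm with respect to the
   standard Gaussian measure is sqrt(n!). *)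
Fixpoint hermite_prob (n : nat) : {poly R} :=
  if n is m.+1 then 'X * hermite_prob m - (hermite_prob m)^`() else 1.

Definition hermite (n : nat) : {poly R} :=
  (Num.sqrt n`!%:R)^-1 *: hermite_prob n.

(* In the two products below, the factors with nu j = 0 are equal to 1, hence
   the restriction to the support. *)
Definition hermite_multi (nu : multiindex) (y : nat -> R) : R :=
  \prod_(j <- finsupp nu) (hermite (nu j)).[y j].

Definition beta (M : nat) (rho : nat -> R) (nu : multiindex) : R :=
  \prod_(j <- finsupp nu) \sum_(l < M.+1) 'C(nu j, l)%:R * rho j ^+ (2 * l).

End Hermite.

Section Holomorphy.
Context {R : realType} {X : completeNormedModType R[i]}.

Definition hermite_coef (gamma : probability (Rinfty R) R) (u : Rinfty R -> X)
    (nu : multiindex) : X :=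
  bochner_integral gamma (fun y => (hermite_multi nu y)%:C *: u y).

Definition admissible (b : nat -> R) (xi : R) (N : nat) (rho : 'I_N -> R) :=
  (forall j, 0 < rho j) /\ \sum_(j < N) b j ^+ 2 * rho j ^+ 2 <= xi ^+ 2.

Definition strip (N : nat) (rho : 'I_N -> R) : set 'rV[R[i]^o]_N :=
  [set z | forall j, `|complex.Im (z 0 j)| < rho j].

Definition polydisc (N : nat) (rho : 'I_N -> R) : set 'rV[R[i]^o]_N :=
  [set z | forall j, rnorm (z 0 j) < rho j].

Definition embC (N : nat) (y : N.-tuple R) : 'rV[R[i]^o]_N :=
  \row_j (tnth y j)%:C.

(* Complex Frechet differentiability at every point of an open set. *)
Definition holomorphic_on (N : nat) (D : set 'rV[R[i]^o]_N)
    (f : 'rV[R[i]^o]_N -> X) : Prop :=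
  forall z, D z -> differentiable f z.

Definition truncate (N : nat) (y : nat -> R) : N.-tuple R :=
  [tuple y j | j < N].

(* [uC N rho] is the extension of [uN N] to the strip of parameter rho; its
   values outside of this strip are irrelevant. The conditions bear on the
   dimensions N >= 1. *)
Definition holomorphic (gammaN : forall N, probability (N.-tuple R) R)
    (gamma : probability (Rinfty R) R) (b : nat -> R) (xi delta : R)
    (u : Rinfty R -> X) : Prop :=
  in_bochner_L2 gamma u /\
  exists (uN : forall N, N.-tuple R -> X)
         (uC : forall N, ('I_N -> R) -> 'rV[R[i]^o]_N -> X),
    [/\ forall N (rho : 'I_N -> R), (0 < N)%N -> admissible b xi rho ->
          holomorphic_on (strip rho) (uC N rho) /\
          forall y, uC N rho (embC y) = uN N y,
        forall N M, (0 < N < M)%N -> forall y : N.-tuple R,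
          uN N y = uN M (truncate M (nth 0 y)),
        forall N, (0 < N)%N -> exists phi : N.-tuple R -> R,
          [/\ measurable_fun setT phi, forall y, 0 <= phi y,
              ('N[gammaN N]_(2%:E) [EFin \o phi] <= delta%:E)%E &
              forall y (rho : 'I_N -> R) z, admissible b xi rho ->
                polydisc rho z -> rnorm (uC N rho (embC y + z)) <= phi y] &
        bochner_L2norm gamma (fun y => u y - uN N (truncate N y))
          @[N --> \oo] --> 0%E].

End Holomorphy.

(* Main.v *)
(* Pair a function f, holomorphic on a polystrip and dominated by phi on its
   polydiscs, with vectors c against Hermite polynomials. Since a derivative in
   a coordinate moves by parts onto the Gaussian weight and raises the Hermite
   index, the coefficient of f(. + s w e_j) of index m is the sum over k of
   sqrt((m + k)! / m!) / k! (s w)^k u_(m + k e_j). Averaging s w over roots of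
   unity of radius kappa_j, one coordinate after the other, starting from the
   Bessel inequality for f, bounds the sum over nu of
   prod_j (sum_k 'C(nu_j, k) kappa_j^(2k) / k!) |u_nu|^2 by the integral of
   phi^2. With kappa_j^2 = 4 e M! rho_j^2 these weights dominate beta, and the
   bound passes to the limit of infinitely many coordinates.
   For the summability, 1 / beta is a product over j of factors which are 1 for
   nu_j = 0 and O(1 / (rho_j^2 nu_j^M)) otherwise, so that the sum of its q-th
   powers is at most prod_j (1 + C b_j^p), for q = p / (2 - p). The l^p bound
   interpolates between the two. *)
From HB Require Import structures.
From mathcomp Require Import all_boot all_order all_algebra.
From mathcomp Require Import finmap.
From mathcomp Require Import complex.
From mathcomp Require Import all_classical all_reals all_analysis.
From mathcomp Require Import sesquilinear measurable_realfun.
From mathcomp Require Import separable cyclic cyclotomic.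
From mathcomp Require Import ring lra.
Require Import Defs.

Set Implicit Arguments.
Unset Strict Implicit.
Unset Printing Implicit Defensive.

Import Order.TTheory GRing.Theory Num.Theory.
Import numFieldNormedType.Exports.

Local Open Scope classical_set_scope.
Local Open Scope ring_scope.
Local Open Scope complex_scope.

(** * Closed forms and Goursat's lemma *)

(** Holomorphy is only pointwise Frechet differentiability, so derivatives of [f] can be neither
    integrated nor estimated directly. The Hermite integral is differentiated instead: for [w] of
    modulus 1, the real form whose coefficients are the real parts of [<f(x + s w), conj(w)^k c>]
    for [k] and [k + 1] is closed, Goursat's argument trades increments in [s] for derivatives in
    [x], and these fall on the Gaussian weight. The Taylor remainder in [s] is then controlled
    through the majorant [phi], times a factor that tends to 0 for every radius thanks to [1 / k!];
    hence any radius inside the polydisc is allowed. The bounds are kept in dual form, with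
    arbitrary test vectors [c]. Every integrand is then a real function, the quadratic terms obey
    Parseval over roots of unity, and the pairings are linear in [u], so that L2 convergence
    suffices for the limit; the Bochner integral enters only at the end, by pairing. Indices are
    confined to finite boxes, which keeps every sum finite until the final suprema. *)

Section Goursat.
Context {R : realType}.
Local Notation mu := (@lebesgue_measure R).
Local Notation int a b f := (\int[mu]_(x in `[a, b]) f x).

Lemma Rintegral_split (f : R -> R) (a b c : R) : a <= c -> c <= b ->
  {within `[a, b], continuous f} -> int a b f = int a c f + int c b f.
Proof.
move=> ac cb cf.
have fi : mu.-integrable `[a, b] (EFin \o f).
  by apply: continuous_compact_integrable => //; exact: segment_compact.
have := @Rintegral_itvB _ f (BLeft a) (BRight b) c fi.
rewrite !bnd_simp => /(_ ac cb) H.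
rewrite -(@Rintegral_itv_obnd_cbnd _ c (BRight b)) -?H; last first.
  apply: integrableS fi => //; apply: subset_itvr.
  by rewrite bnd_simp.
by rewrite addrC subrK.
Qed.

Lemma Rintegral_near_cst (f : R -> R) (a b c M : R) : a <= b ->
  {within `[a, b], continuous f} ->
  (forall x, a <= x <= b -> `|f x - c| <= M) ->
  `|int a b f - c * (b - a)| <= M * (b - a).
Proof.
move=> ab cf fM.
have fi : mu.-integrable `[a, b] (EFin \o f).
  by apply: continuous_compact_integrable => //; exact: segment_compact.
have cst_i k : mu.-integrable `[a, b] (EFin \o (fun=> k)).
  apply: continuous_compact_integrable => //; first exact: segment_compact.
  by move=> x; exact: cvg_cst.
have muE k : int a b (fun=> k) = k * (b - a).
  rewrite Rintegral_cst//; congr (_ * _).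
  have := @lebesgue_measure_itv R `[a, b]; rewrite /= lte_fin => ->.
  move: ab; rewrite le_eqVlt => /predU1P[->|ab]; first by rewrite ltxx subrr.
  by rewrite ab.
rewrite ler_norml; apply/andP; split.
  rewrite lerBrDr -mulNr -mulrDl -muE.
  apply: le_Rintegral => // x /=; rewrite in_itv/= => /fM.
  by rewrite ler_norml => /andP[? _]; rewrite -lerBrDr.
rewrite lerBlDr -mulrDl -muE.
apply: le_Rintegral => // x /=; rewrite in_itv/= => /fM.
by rewrite ler_norml => /andP[_ ?]; rewrite -lerBlDr.
Qed.

(* [P dx + Q ds] is differentiable and closed at [(x, s)]. *)
Definition closed_form_at (P Q : R -> R -> R) (x s : R) :=
  exists a b c : R, forall e, 0 < e -> exists2 d, 0 < d &
    forall x' s', `|x' - x| < d -> `|s' - s| < d ->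
      `|P x' s' - P x s - (a * (x' - x) + b * (s' - s))|
        <= e * (`|x' - x| + `|s' - s|) /\
      `|Q x' s' - Q x s - (b * (x' - x) + c * (s' - s))|
        <= e * (`|x' - x| + `|s' - s|).

(** Counterclockwise circulation of [P dx + Q ds] along the rectangle with lower left corner
    [(x, s)] and sides [h], [k]; opposite edges share one integral. *)
Definition boundary (P Q : R -> R -> R) (x s h k : R) : R :=
  int x (x + h) (fun t => P t s - P t (s + k)) +
  int s (s + k) (fun t => Q (x + h) t - Q x t).

(** The expansion with [e = 1] gives a local Lipschitz bound at the point in each variable
    separately. This suffices, as integrals are only taken in one variable with the other one
    fixed. *)
Lemma cvg_of_closed_form P Q x s : closed_form_at P Q x s ->
  [/\ {for x, continuous (P ^~ s)}, {for s, continuous (P x)},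
      {for x, continuous (Q ^~ s)} & {for s, continuous (Q x)}].
Proof.
move=> [a [b [c H]]].
have [d d0 /= {}H] := H 1 ltr01.
have aux (f : R -> R) t k :
    (forall t', `|t' - t| < d -> `|f t' - f t - k * (t' - t)| <= `|t' - t|) ->
    {for t, continuous f}.
  move=> Hf; apply/cvgrPdist_lt => /= e e0; near=> t'.
  have k1 : 0 < `|k| + 1 by rewrite ltr_wpDl.
  have td : `|t' - t| < d.
    by rewrite distrC; near: t'; exact: cvgr_dist_lt.
  have te : (`|k| + 1) * `|t' - t| < e.
    rewrite mulrC -ltr_pdivlMr// distrC; near: t'.
    by apply: cvgr_dist_lt => //; rewrite divr_gt0.
  rewrite distrC; apply: le_lt_trans te.
  rewrite -[X in `|X|](subrK (k * (t' - t))).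
  rewrite (le_trans (ler_normD _ _))// mulrDl mul1r addrC normrM lerD2l.
  exact: Hf.
split.
- apply: (aux _ _ a) => t' /(H _ s) []; rewrite ?subrr ?normr0// => + _.
  by rewrite mulr0 !addr0 mul1r.
- apply: (aux _ _ b) => t' /(H x t') []; rewrite ?subrr ?normr0// => + _.
  by rewrite mulr0 !add0r mul1r.
- apply: (aux _ _ b) => t' /(H _ s) []; rewrite ?subrr ?normr0// => _.
  by rewrite mulr0 !addr0 mul1r.
- apply: (aux _ _ c) => t' /(H x t') []; rewrite ?subrr ?normr0// => _.
  by rewrite mulr0 !add0r mul1r.
Unshelve. all: by end_near. Qed.

Section rectangle.
Variables (P Q : R -> R -> R) (rho : R).
Hypothesis PQ : forall x s, `|s| < rho -> closed_form_at P Q x s.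

Lemma closed_form_contP s : `|s| < rho -> continuous (P ^~ s).
Proof. by move=> sr x; have [] := cvg_of_closed_form (PQ x sr). Qed.

Lemma closed_form_contQ x s : `|s| < rho -> {for s, continuous (Q x)}.
Proof. by move=> sr; have [] := cvg_of_closed_form (PQ x sr). Qed.

Let in_rho s k t : `|s| < rho -> `|s + k| < rho -> s <= t <= s + k -> `|t| < rho.
Proof.
move=> /ltr_normlP[s1 s2] /ltr_normlP[s3 s4] /andP[t1 t2].
by apply/ltr_normlP; split; lra.
Qed.

Let contP x h s k : `|s| < rho -> `|s + k| < rho ->
  {within `[x, x + h], continuous (fun t => P t s - P t (s + k))}.
Proof.
move=> s0 s1; apply: continuous_subspaceT => t.
by apply: cvgB; exact: closed_form_contP.
Qed.

Let contQ x h s k : `|s| < rho -> `|s + k| < rho ->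
  {within `[s, s + k], continuous (fun t => Q (x + h) t - Q x t)}.
Proof.
move=> s0 s1; apply: continuous_in_subspaceT => t /set_mem/=.
rewrite in_itv/= => /(in_rho s0 s1) tr.
by apply: cvgB; exact: closed_form_contQ.
Qed.

(** The inner edges are traversed twice, in opposite directions, and cancel. *)
Lemma boundary_split x s h k : 0 <= h -> 0 <= k -> `|s| < rho ->
  `|s + (k + k)| < rho ->
  boundary P Q x s (h + h) (k + k) =
    boundary P Q x s h k + boundary P Q (x + h) s h k +
    boundary P Q x (s + k) h k + boundary P Q (x + h) (s + k) h k.
Proof.
move=> h0 k0 s0 s2.
have s1 : `|s + k| < rho by apply: (in_rho s0 s2); apply/andP; split; lra.
rewrite /boundary !addrA.
have PE t u : (t = s \/ t = s + k) -> (u = s + k \/ u = s + k + k) ->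
  int x (x + h + h) (fun x => P x t - P x u) =
  int x (x + h) (fun x => P x t - P x u) +
  int (x + h) (x + h + h) (fun x => P x t - P x u).
  move=> tE uE; apply: Rintegral_split; [lra|lra|].
  apply: continuous_subspaceT => z.
  by apply: cvgB; apply: closed_form_contP;
   case: tE => tE; case: uE => uE; rewrite ?tE ?uE -?addrA.
have QE y z : int s (s + k + k) (fun t => Q y t - Q z t) =
   int s (s + k) (fun t => Q y t - Q z t) +
   int (s + k) (s + k + k) (fun t => Q y t - Q z t).
  apply: Rintegral_split; [lra|lra|].
  apply: continuous_in_subspaceT => t /set_mem/=.
  rewrite in_itv/= -addrA => /(in_rho s0 s2) tr.
  by apply: cvgB; exact: closed_form_contQ.
have PD y : int y (y + h) (fun t => P t s - P t (s + k + k)) =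
   int y (y + h) (fun t => P t s - P t (s + k)) +
   int y (y + h) (fun t => P t (s + k) - P t (s + k + k)).
  rewrite -RintegralD//; last 2 first.
  - apply: continuous_compact_integrable; first exact: segment_compact.
    exact: contP.
  - apply: continuous_compact_integrable; first exact: segment_compact.
    by apply: contP => //; rewrite -addrA.
  by apply: eq_Rintegral => t _; rewrite addrA subrK.
have QD a b : s <= a -> a <= b -> b <= s + (k + k) ->
   int a b (fun t => Q (x + h + h) t - Q x t) =
   int a b (fun t => Q (x + h + h) t - Q (x + h) t) +
   int a b (fun t => Q (x + h) t - Q x t).
  move=> sa ab bs.
  have ci y z : mu.-integrable `[a, b] (EFin \o (fun t => Q y t - Q z t)).
    apply: continuous_compact_integrable; first exact: segment_compact.
    apply: continuous_in_subspaceT => t /set_mem/=.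
    rewrite in_itv/= => /andP[t1 t2].
    have tr : `|t| < rho by apply: (in_rho s0 s2); apply/andP; split; lra.
    by apply: cvgB; exact: closed_form_contQ.
  rewrite -RintegralD//.
  by apply: eq_Rintegral => t _; rewrite addrA subrK.
rewrite PE; [|by left|by right]; rewrite QE !PD !QD; try lra.
Qed.

(** The circulations of the four quarters add up to that of the whole, whose lower bound is four
    times the one asked of a quarter: they cannot all fall below it. *)
Lemma boundary_le_half x s h k e : 0 <= h -> 0 <= k -> `|s| < rho ->
  `|s + (k + k)| < rho ->
  e * ((h + h) + (k + k)) ^+ 2 <= `|boundary P Q x s (h + h) (k + k)| ->
  exists x' s', [/\ x' = x \/ x' = x + h, s' = s \/ s' = s + k &
     e * (h + k) ^+ 2 <= `|boundary P Q x' s' h k|].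
Proof.
move=> h0 k0 s0 s2 H; apply: contrapT => N.
have lt4 x' s' : (x' = x \/ x' = x + h) -> (s' = s \/ s' = s + k) ->
    `|boundary P Q x' s' h k| < e * (h + k) ^+ 2.
  by move=> xE sE; rewrite ltNge; apply/negP => L; apply: N; exists x', s'; split.
have := lt4 x s (or_introl erefl) (or_introl erefl).
have := lt4 x (s + k) (or_introl erefl) (or_intror erefl).
have := lt4 (x + h) s (or_intror erefl) (or_introl erefl).
have := lt4 (x + h) (s + k) (or_intror erefl) (or_intror erefl).
move: H; rewrite boundary_split// => H /ltr_normlP[a1 a2] /ltr_normlP[b1 b2]
  /ltr_normlP[c1 c2] /ltr_normlP[d1 d2].
have := le_lt_trans H; move=> {}H.
have : `|boundary P Q x s h k + boundary P Q (x + h) s h k +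
    boundary P Q x (s + k) h k + boundary P Q (x + h) (s + k) h k| <
    e * (h + h + (k + k)) ^+ 2.
  have -> : e * (h + h + (k + k)) ^+ 2 = (e * (h + k) ^+ 2) *+ 4 by ring.
  by apply/ltr_normlP; split; lra.
by move/H; rewrite ltxx.
Qed.

(** The linear parts of [P] and [Q] contribute [- (b * k * h)] and [b * k * h], which cancel because
    the two expansions share the coefficient [b]. Only the errors remain: each edge integrand is a
    difference of two values known up to [e / 2 * (h + k)]. *)
Lemma boundary_small x s : `|s| < rho -> forall e, 0 < e ->
  exists2 d, 0 < d & forall x0 s0 h k, 0 <= h -> 0 <= k ->
    `|s0| < rho -> `|s0 + k| < rho ->
    x0 <= x <= x0 + h -> s0 <= s <= s0 + k -> h + k < d ->
    `|boundary P Q x0 s0 h k| <= e * (h + k) ^+ 2.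
Proof.
move=> sr e e0; have [a [b [c]]] := PQ x sr.
have e20 : 0 < e / 2 by rewrite divr_gt0.
move=> /(_ _ e20) [d d0 H]; exists d => // x0 s0 h k h0 k0 s0r s0kr.
move=> /andP[x1 x2] /andP[s1 s2] hk.
have nx t : x0 <= t <= x0 + h -> `|t - x| <= h.
  by move=> /andP[? ?]; apply/ler_normlP; split; lra.
have ns t : s0 <= t <= s0 + k -> `|t - s| <= k.
  by move=> /andP[? ?]; apply/ler_normlP; split; lra.
have {}H x' s' : x0 <= x' <= x0 + h -> s0 <= s' <= s0 + k ->
    `|P x' s' - P x s - (a * (x' - x) + b * (s' - s))| <= e / 2 * (h + k) /\
    `|Q x' s' - Q x s - (b * (x' - x) + c * (s' - s))| <= e / 2 * (h + k).
  move=> /nx xh /ns sk.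
  have [] := H x' s'.
  - by apply: le_lt_trans xh _; lra.
  - by apply: le_lt_trans sk _; lra.
  move=> H1 H2; split; [apply: le_trans H1 _|apply: le_trans H2 _];
   by rewrite ler_pM2l// lerD.
have xl : x0 <= x0 <= x0 + h by apply/andP; split; lra.
have xr : x0 <= x0 + h <= x0 + h by apply/andP; split; lra.
have sl : s0 <= s0 <= s0 + k by apply/andP; split; lra.
have sR : s0 <= s0 + k <= s0 + k by apply/andP; split; lra.
have IP : `|int x0 (x0 + h) (fun t => P t s0 - P t (s0 + k)) -
    (- (b * k)) * (x0 + h - x0)| <= e * (h + k) * (x0 + h - x0).
  apply: Rintegral_near_cst; [lra|exact: contP|] => t tx.
  have [/ler_normlP[? ?] _] := H t s0 tx sl.
  have [/ler_normlP[? ?] _] := H t (s0 + k) tx sR.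
  by apply/ler_normlP; split; lra.
have IQ : `|int s0 (s0 + k) (fun t => Q (x0 + h) t - Q x0 t) -
    (b * h) * (s0 + k - s0)| <= e * (h + k) * (s0 + k - s0).
  apply: Rintegral_near_cst; [lra|exact: contQ|] => t ts.
  have [_ /ler_normlP[? ?]] := H x0 t xl ts.
  have [_ /ler_normlP[? ?]] := H (x0 + h) t xr ts.
  by apply/ler_normlP; split; lra.
rewrite /boundary; move: IP IQ.
set A := int x0 (x0 + h) (fun t => P t s0 - P t (s0 + k)).
set B := int s0 (s0 + k) (fun t => Q (x0 + h) t - Q x0 t).
have -> : e * (h + k) * (x0 + h - x0) = e * (h + k) * h by ring.
have -> : e * (h + k) * (s0 + k - s0) = e * (h + k) * k by ring.
have -> : - (b * k) * (x0 + h - x0) = - (b * k * h) by ring.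
have -> : b * h * (s0 + k - s0) = b * k * h by ring.
have -> : e * (h + k) ^+ 2 = e * (h + k) * h + e * (h + k) * k by ring.
by move=> /ler_normlP[? ?] /ler_normlP[? ?]; apply/ler_normlP; split; lra.
Qed.

(* Goursat's lemma, by bisection: no continuity of the derivatives of [P] and
   [Q] is assumed. *)
Lemma boundary_eq0 x s h k : 0 <= h -> 0 <= k -> `|s| < rho ->
  `|s + k| < rho -> boundary P Q x s h k = 0.
Proof.
move=> h0 k0 s0 sk0; apply/eqP/negPn/negP => B0.
have hk : 0 < h + k.
  rewrite lt_neqAle addr_ge0// andbT eq_sym; apply/negP => /eqP hk0.
  have h00 : h = 0 by lra.
  have k00 : k = 0 by lra.
  move/eqP: B0; apply.
  by rewrite /boundary h00 k00 !addr0 !set_itv1 !Rintegral_set1 addr0.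
(* Along the chosen quarters, the ratio of the circulation to the square of the side sum never drops
   below [e]; [boundary_small], used with [e / 2] at their common point, contradicts this. *)
pose e := `|boundary P Q x s h k| / (h + k) ^+ 2.
have e0 : 0 < e by rewrite divr_gt0 ?normr_gt0// exprn_gt0.
pose hn n := h / 2 ^+ n; pose kn n := k / 2 ^+ n.
have hnS n : hn n = hn n.+1 + hn n.+1.
  by rewrite /hn exprS invfM; field; rewrite expf_neq0.
have knS n : kn n = kn n.+1 + kn n.+1.
  by rewrite /kn exprS invfM; field; rewrite expf_neq0.
have hn0 n : 0 <= hn n by rewrite divr_ge0// exprn_ge0.
have kn0 n : 0 <= kn n by rewrite divr_ge0// exprn_ge0.
pose good n (p : R * R) := [/\ s <= p.2, p.2 + kn n <= s + k &
  e * (hn n + kn n) ^+ 2 <= `|boundary P Q p.1 p.2 (hn n) (kn n)|].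
pose next n (p q : R * R) := [/\ p.1 <= q.1, q.1 + hn n.+1 <= p.1 + hn n,
   p.2 <= q.2 & q.2 + kn n.+1 <= p.2 + kn n].
have step n p : good n p -> exists q, next n p q /\ good n.+1 q.
  case=> sp pk He.
  have [] := @boundary_le_half p.1 p.2 (hn n.+1) (kn n.+1) e.
  - exact: hn0.
  - exact: kn0.
  - by apply: (in_rho s0 sk0); have := kn0 n; move=> ?; apply/andP; split; lra.
  - rewrite -knS; apply: (in_rho s0 sk0); have := kn0 n; move=> ?.
    by apply/andP; split; lra.
  - by rewrite -hnS -knS.
  move=> x' [s' [xE sE He']]; exists (x', s'); rewrite /next /good/=.
  have := hnS n; have := knS n; have := hn0 n.+1; have := kn0 n.+1.
  by move: He'; case: xE => ->; case: sE => -> *; split=> //; split=> //; lra.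
have [q [q0 qS]] : exists q : nat -> R * R, good 0 (q 0) /\
    forall n, good n (q n) -> next n (q n) (q n.+1) /\ good n.+1 (q n.+1).
  have /choice[F HF] : forall np : nat * (R * R), exists q, good np.1 np.2 ->
      next np.1 np.2 q /\ good np.1.+1 q.
    move=> [n p]; have [gp|ngp] := pselect (good n p); last by exists p.
    by have [q ?] := step n p gp; exists q.
  pose q := fix q n := if n is m.+1 then F (m, q m) else (x, s).
  exists q; split; last by move=> n /(HF (n, q n)).
  split=> //=; rewrite /kn /hn expr0 !divr1// /e.
  by rewrite divfK// expf_neq0// gt_eqF.
have gq n : good n (q n) by elim: n => // n /qS[].
have {qS} nq n : next n (q n) (q n.+1) by have [] := qS n (gq n).
(* Nested intervals [[u n, u n + v n]] have a common point; this is applied to each coordinate. *)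
have aux (u v : nat -> R) : (forall n, 0 <= v n) ->
    (forall n, u n <= u n.+1) -> (forall n, u n.+1 + v n.+1 <= u n + v n) ->
    exists l, forall n, u n <= l <= u n + v n.
  move=> v0 ui ud; exists (lim (u @ \oo)).
  have uiP : nondecreasing_seq u by apply/nondecreasing_seqP.
  have udP : nonincreasing_seq (fun n => u n + v n).
    by apply/nonincreasing_seqP.
  have ub m n : u n <= u m + v m.
    have [mn|/ltnW nm] := leqP m n.
      by apply: le_trans (udP _ _ mn); rewrite lerDl.
    by apply: le_trans (uiP _ _ nm) _; rewrite lerDl.
  have cu : cvgn u.
    by apply: nondecreasing_is_cvgn => //; exists (u 0 + v 0) => _ [n _ <-]; exact: ub.
  move=> n; apply/andP; split; first exact: nondecreasing_cvgn_le.
  by apply: limr_le => //; apply: nearW => m; exact: ub.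
have [X HX] : exists l, forall n, (q n).1 <= l <= (q n).1 + hn n.
  by apply: aux => // n; have [] := nq n.
have [S HS] : exists l, forall n, (q n).2 <= l <= (q n).2 + kn n.
  by apply: aux => // n; have [] := nq n.
have Sr : `|S| < rho.
  apply: (in_rho s0 sk0); have [+ + _] := gq 0; have := HS 0.
  by move=> /andP[? ?] ? ?; apply/andP; split; lra.
have e20 : 0 < e / 2 by rewrite divr_gt0.
have [d d0 Hd] := @boundary_small X S Sr _ e20.
have [n hkd] : exists n, hn n + kn n < d.
  have [n] : exists n : nat, (h + k) / d < 2 ^+ n.
    have := @archi_boundP _ ((h + k) / d).
    rewrite divr_ge0 ?(ltW hk) ?(ltW d0)// => /(_ isT) Hn.
    exists (Num.bound ((h + k) / d)); apply: lt_trans Hn _.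
    by rewrite -natrX ltr_nat ltn_expl.
  move=> Hn; exists n; rewrite /hn /kn -mulrDl ltr_pdivrMr ?exprn_gt0//.
  by rewrite mulrC -ltr_pdivrMr.
have [gs gk ge] := gq n.
have := Hd _ _ _ _ (hn0 n) (kn0 n) _ _ (HX n) (HS n) hkd.
have Sn : `|(q n).2| < rho.
  by apply: (in_rho s0 sk0); have := kn0 n; move=> ?; apply/andP; split; lra.
have Snk : `|(q n).2 + kn n| < rho.
  by apply: (in_rho s0 sk0); have := kn0 n; move=> ?; apply/andP; split; lra.
move=> /(_ Sn Snk) /(le_trans ge).
have hkn : 0 < hn n + kn n by rewrite -mulrDl divr_gt0// exprn_gt0.
by rewrite ler_pM2r ?exprn_gt0//; move: e0; lra.
Qed.

End rectangle.
End Goursat.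

(** * Derivatives of integrals over slices, and vanishing total integrals *)

Section IntegralDerivative.
Context {R : realType}.
Local Notation mu := (@lebesgue_measure R).
Local Notation int a b f := (\int[mu]_(x in `[a, b]) f x).

Lemma is_derive_Rintegral (f : R -> R) (a x : R) : a < x ->
  continuous f -> is_derive x 1 (fun y => int a y f) (f x).
Proof.
move=> ax cf.
have fi : mu.-integrable `[a, x + 1] (EFin \o f).
  apply: continuous_compact_integrable; first exact: segment_compact.
  exact: continuous_subspaceT.
have xx1 : x < x + 1 by rewrite ltrDl.
have [df f'E] := continuous_FTC1_closed xx1 fi ax (cf x).
by apply: DeriveDef; [exact: df|rewrite -derive1E; exact: f'E].
Qed.

(** Goursat's lemma on the rectangle over [[x - 1, y]] and [[0, S]] shows that the integral of [Q y]
    is, up to a constant, the integral of [P t S - P t 0] for [t] from [x - 1] to [y]. The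
    fundamental theorem of calculus is applied to the latter, so nothing is differentiated under the
    integral sign. *)
Lemma is_derive_slice (P Q : R -> R -> R) (rho S x : R) :
  (forall x s, `|s| < rho -> closed_form_at P Q x s) -> 0 <= S < rho ->
  is_derive x 1 (fun y => int 0 S (Q y)) (P x S - P x 0).
Proof.
move=> PQ /andP[S0 Sr].
have r0 : 0 < rho by exact: le_lt_trans Sr.
have n0 : `|0 : R| < rho by rewrite normr0.
have nS : `|S| < rho by rewrite ger0_norm.
have iQ y : mu.-integrable `[0, S] (EFin \o (Q y)).
  apply: continuous_compact_integrable; first exact: segment_compact.
  apply: continuous_in_subspaceT => t /set_mem/=.
  rewrite in_itv/= => /andP[t0 tS]; apply: (closed_form_contQ PQ).
  by rewrite ger0_norm// (le_lt_trans tS).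
have cP s : `|s| < rho -> continuous (P ^~ s) by move=> sr; exact: (closed_form_contP PQ sr).
pose f t := P t S - P t 0.
have cf : continuous f by move=> t; apply: cvgB; exact: cP.
pose G y := int 0 S (Q (x - 1)) + int (x - 1) y f.
have : is_derive x 1 G (f x).
  have x1 : x - 1 < x by rewrite ltrBlDr ltrDl.
  have := is_deriveD (is_derive_cst (int 0 S (Q (x - 1))) x 1)
    (is_derive_Rintegral x1 cf).
  by rewrite add0r.
apply: near_eq_is_derive; near=> y.
have xy : x - 1 <= y.
  by near: y; apply: lt_le_nbhsr; rewrite ltrBlDr ltrDl.
have h0 : 0 <= y - (x - 1) by rewrite subr_ge0.
have := @boundary_eq0 _ _ _ _ PQ (x - 1) 0 (y - (x - 1)) S h0 S0 n0.
rewrite add0r => /(_ nS); rewrite /boundary add0r addrC.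
have -> : x - 1 + (y - (x - 1)) = y by ring.
rewrite RintegralB// /G => H.
have -> : int (x - 1) y f = - int (x - 1) y (fun t => P t 0 - P t S).
  have ci t : `|t| < rho -> mu.-integrable `[x - 1, y] (EFin \o (P ^~ t)).
    move=> tr; apply: continuous_compact_integrable.
      exact: segment_compact.
    by apply: continuous_subspaceT; exact: cP.
  by rewrite /f !RintegralB ?opprB//; exact: ci.
by move/eqP: H; rewrite -addrA addr_eq0 opprD opprK => /eqP ->; ring.
Unshelve. all: by end_near. Qed.

(** Otherwise [|F|] would stay above [e] on intervals of every length [n]. The left ends [c n] are
    free, so that such points can be sought near either infinity. *)
Lemma integrable_unbounded_small (F : R -> R) (c : nat -> R) (e : R) : 0 < e ->
  mu.-integrable setT (EFin \o F) ->
  exists n x, c n <= x <= c n + n%:R /\ `|F x| < e.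
Proof.
move=> e0 iF; apply: contrapT => N.
have big n x : c n <= x <= c n + n%:R -> e <= `|F x|.
  by move=> cx; rewrite leNgt; apply/negP => Fx; apply: N; exists n, x.
have aF : mu.-integrable setT (EFin \o (fun x => `|F x|)).
  by move/integrable_norm : iF.
have le n : e * n%:R <= \int[mu]_x `|F x|.
  have muI : mu `[c n, c n + n%:R] = n%:R%:E.
    have := @lebesgue_measure_itv R `[c n, c n + n%:R].
    rewrite /= lte_fin => ->; case: ltP => [_|].
      by rewrite -EFinB addrAC subrr add0r.
    by rewrite gerDl lern0 => /eqP ->.
  rewrite -[e * _]/(fine (e%:E * n%:R%:E)) -muI -integral_cst//.
  rewrite -/(Rintegral _ _ (fun=> e)).
  rewrite [leRHS](_ : _ = Rintegral mu setT (fun x => `|F x|))//.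
  apply: (@le_trans _ _ (int (c n) (c n + n%:R) (fun x => `|F x|))).
    apply: le_Rintegral => //.
    - apply: continuous_compact_integrable; first exact: segment_compact.
      by move=> x; exact: cvg_cst.
    - exact: integrableS aF.
    - by move=> x /=; rewrite in_itv/=; exact: big.
  apply: fine_le.
  - by apply: integrable_fin_num => //; exact: integrableS aF.
  - exact: integrable_fin_num.
  apply: ge0_subset_integral => //.
  - by have /integrableP[] := aF.
have C0 : 0 <= \int[mu]_x `|F x| / e.
  by rewrite divr_ge0 ?(ltW e0)//; apply: Rintegral_ge0.
have := archi_boundP C0.
rewrite ltr_pdivrMr// mulrC => /lt_le_trans /(_ (le _)).
by rewrite ltxx.
Qed.

(** The boundary terms are evaluated at points [a n], [b n] going to both infinities along which [F]
    tends to 0. Integrability of [F] provides them; decay of [F] at infinity is not at hand in the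
    application, where [F] is only controlled by [phi]. *)
Lemma Rintegral_derive_eq0 (F f : R -> R) : (forall x : R, is_derive x 1 F (f x)) ->
  continuous f -> mu.-integrable setT (EFin \o F) ->
  mu.-integrable setT (EFin \o f) -> \int[mu]_x f x = 0.
Proof.
move=> Ff cf iF fi.
have pos n : 0 < n.+1%:R^-1 :> R by rewrite invr_gt0.
have /choice[b bP] : forall n : nat, exists b : R,
    n%:R <= b /\ `|F b| < n.+1%:R^-1.
  move=> n; have [k [x [/andP[xk _] Fx]]] :=
    integrable_unbounded_small (fun=> n%:R) (pos n) iF.
  by exists x.
have /choice[a aP] : forall n : nat, exists a : R,
    a <= - n%:R /\ `|F a| < n.+1%:R^-1.
  move=> n; have [k [x [/andP[_ xk] Fx]]] :=
    integrable_unbounded_small (fun k => - n%:R - k%:R) (pos n) iF.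
  by exists x; split=> //; rewrite subrK in xk.
pose fn n : R -> R := f \_ `[a n, b n].
have : (\int[mu]_x (fn n x)%:E)%E @[n --> \oo] --> (\int[mu]_x (f x)%:E)%E.
  have mf : measurable_fun setT f.
    by apply/measurable_EFinP; have /integrableP[] := fi.
  apply: (@dominated_cvg _ _ _ mu setT measurableT (fun n x => (fn n x)%:E) _
    (fun x => `|f x|%:E)) => //.
  - move=> n; apply/measurable_EFinP; apply/(measurable_restrictT f) => //.
    exact: measurable_funTS.
  - move=> x _; apply/cvg_EFin; first exact: nearW.
    apply: cvg_near_cst; near=> n; rewrite /= /fn patchE ifT// inE/= in_itv/=.
    have xn : `|x| <= n%:R.
      near: n; exists (Num.bound `|x|) => // n /= xn.
      apply: ltW; apply: lt_le_trans (archi_boundP _) _ => //.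
      by rewrite ler_nat.
    have [an _] := aP n; have [bn _] := bP n; move/ler_normlP : xn => [? ?].
    by apply/andP; split; lra.
  - by move/integrable_norm : fi.
  - move=> n x _; rewrite /fn patchE lee_fin; case: ifP => // _.
    by rewrite normr0.
have Fcvg (c : nat -> R) : (forall n, `|F (c n)| < n.+1%:R^-1) ->
    F (c n) @[n --> \oo] --> 0.
  move=> cP; apply/norm_cvg0P.
  apply: (@squeeze_cvgr _ _ _ _ (fun=> 0) (fun n => n.+1%:R^-1)).
  - by apply: nearW => n; rewrite normr_ge0 ltW.
  - exact: cvg_cst.
  - exact: cvg_harmonic.
have : (\int[mu]_x (fn n x)%:E)%E @[n --> \oo] --> 0%:E.
  have : (F (b n) - F (a n))%:E @[n --> \oo] --> (0 - 0)%:E.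
    apply/cvg_EFin; first exact: nearW.
    by apply: cvgB; apply: Fcvg => n; [have [] := bP n|have [] := aP n].
  rewrite subr0; apply: cvg_trans; apply: near_eq_cvg; near=> n.
  have ab : a n < b n.
    have n0 : 0 < n%:R :> R by rewrite ltr0n; near: n; exact: nbhs_infty_gt.
    by have [? _] := aP n; have [? _] := bP n; lra.
  have -> : (\int[mu]_x (fn n x)%:E = \int[mu]_(x in `[a n, b n]) (f x)%:E)%E.
    by rewrite [RHS]integral_mkcond restrict_EFin.
  rewrite EFinB.
  rewrite -(@continuous_FTC2 _ f F)//.
  - exact: continuous_subspaceT.
  - have cF x : {for x, continuous F}.
      apply/differentiable_continuous/derivable1_diffP.
      by have [] := Ff x.
    split=> [x _||]; first by have [] := Ff x.
    + by apply: cvg_at_right_filter; exact: cF.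
    + by apply: cvg_at_left_filter; exact: cF.
  - by move=> x _; rewrite derive1E; have [_ ->] := Ff x.
move=> H1 H2; rewrite /Rintegral.
by have -> := cvg_unique (@ereal_hausdorff R) H2 H1.
Unshelve. all: by end_near. Qed.

End IntegralDerivative.

(** * Hermite functions *)

Section Hermite.
Context {R : realType}.
Local Notation mu := (@lebesgue_measure R).
Local Notation pdf := (normal_pdf (0 : R) 1).

Lemma std_pdfE (x : R) : pdf x = normal_peak 1 * expR (- (x ^+ 2 / 2)).
Proof.
by rewrite normal_pdfE ?oner_neq0// /normal_fun subr0 expr1n mulNr.
Qed.

Lemma is_derive_std_pdf (x : R) : is_derive x 1 pdf (- x * pdf x).
Proof.
have -> : pdf = normal_peak 1 \*: (expR \o horner (- (2^-1 *: 'X^2))).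
  apply/funext => y; rewrite std_pdfE /= /GRing.scale /=; congr (_ * expR _).
  by rewrite hornerN hornerZ hornerXn mulrC.
have := is_derive1_comp (@is_derive_expR R (horner (- (2^-1 *: 'X^2)) x))
  (@is_derive_poly R (- (2^-1 *: 'X^2)) x).
move=> /(@is_deriveZ R _ _ _ (normal_peak 1)) /is_derive_eq; apply.
rewrite /= derivN derivZ derivXn /= !hornerE /= /GRing.scale /= -mulr_natl.
by field.
Qed.

(** Up to the sign [(-1)^m], the [m]-th derivative of the standard Gaussian density. *)
Definition hermite_gauss (m : nat) (x : R) := (hermite_prob m).[x] * pdf x.

Lemma is_derive_hermite_gauss m (x : R) :
  is_derive x 1 (hermite_gauss m) (- hermite_gauss m.+1 x).
Proof.
have := is_deriveM (is_derive_poly (hermite_prob m) x) (is_derive_std_pdf x).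
move/is_derive_eq; apply; rewrite /hermite_gauss /= !hornerE /= /GRing.scale /=; ring.
Qed.

Lemma continuous_std_pdf : continuous pdf.
Proof. by apply: continuous_normal_pdf; exact: oner_neq0. Qed.

Lemma continuous_hermite_gauss m : continuous (hermite_gauss m).
Proof.
by move=> x; apply: cvgM; [exact: continuous_horner|exact: continuous_std_pdf].
Qed.

(** The exponent [x^2 / 4] is half of the Gaussian one: a polynomial times the density is then
    dominated by a multiple of the Gaussian density of variance 2. *)
Lemma le_horner_expR (p : {poly R}) :
  exists2 C, 0 <= C & forall x, `|p.[x]| <= C * expR (x ^+ 2 / 4).
Proof.
have mono n : exists2 C : R, 0 <= C & forall x : R, `|x| ^+ n <= C * expR (x ^+ 2 / 4).
  exists (1 + 4 ^+ n.+1 * n.+1`!%:R); first by rewrite addr_ge0// mulr_ge0// exprn_ge0.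
  move=> x.
  have x0 : 0 <= x ^+ 2 / 4 by rewrite divr_ge0// sqr_ge0.
  have e1 : 1 <= expR (x ^+ 2 / 4).
    by apply: le_trans (expR_ge1Dx _); rewrite lerDl.
  rewrite mulrDl mul1r.
  have [x1|x1] := leP `|x| 1.
    apply: (@le_trans _ _ 1); first by rewrite exprn_ile1.
    by rewrite (le_trans e1)// lerDl mulr_ge0 ?expR_ge0// mulr_ge0// exprn_ge0.
  apply: (@le_trans _ _ ((x ^+ 2) ^+ n.+1)).
    rewrite -[x ^+ 2]real_normK ?num_real// -exprM ler_eXn2l//.
    by rewrite mul2n -addnn (leq_trans (leqnSn n))// leq_addr.
  have := @expR_ge1Dxn R _ n x0.
  rewrite -lerBrDl => /le_trans /(_ (lerB (lexx _) ler01)); rewrite subr0.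
  rewrite expr_div_n ler_pdivrMr ?ltr0n ?fact_gt0// ler_pdivrMr ?exprn_gt0//.
  move=> /le_trans; apply.
  rewrite [leLHS](_ : _ = 4 ^+ n.+1 * n.+1`!%:R * expR (x ^+ 2 / 4)); last by ring.
  by rewrite lerDr expR_ge0.
have /choice[C CP] : forall n : nat, exists C : R, 0 <= C /\
    forall x : R, `|x| ^+ n <= C * expR (x ^+ 2 / 4).
  by move=> n; have [C ? ?] := mono n; exists C.
exists (\sum_(i < size p) `|p`_i| * C i).
  by apply: sumr_ge0 => i _; rewrite mulr_ge0//; have [] := CP i.
move=> x; rewrite horner_coef (le_trans (ler_norm_sum _ _ _))// mulr_suml.
apply: ler_sum => i _; rewrite normrM normrX -mulrA ler_wpM2l//.
by have [] := CP i.
Qed.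

Lemma integrable_poly_gauss (p : {poly R}) :
  mu.-integrable setT (EFin \o (fun x => p.[x] * pdf x)).
Proof.
have [C C0 HC] := le_horner_expR p.
have s0 : Num.sqrt 2 != 0 :> R by rewrite gt_eqF// sqrtr_gt0.
have I2 := @integrable_normal_pdf R 0 (Num.sqrt 2).
pose K := C * normal_peak 1 / normal_peak (Num.sqrt 2).
have HK (x : R) : `|p.[x] * pdf x| <= K * normal_pdf 0 (Num.sqrt 2) x.
  rewrite normrM (ger0_norm (normal_pdf_ge0 0 1 x)).
  apply: (@le_trans _ _ (C * expR (x ^+ 2 / 4) * pdf x)).
    by rewrite ler_wpM2r// normal_pdf_ge0.
  rewrite std_pdfE (@normal_pdfE R 0 _ s0) /normal_fun subr0 sqr_sqrtr//.
  have a0 : normal_peak (Num.sqrt 2) != 0 :> R by rewrite gt_eqF// normal_peak_gt0.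
  rewrite /K -[_ / _ * _]mulrA mulKf//.
  rewrite mulrACA -expRD le_eqVlt; apply/orP; left; apply/eqP.
  by congr (_ * expR _); rewrite -mulr_natl; field.
apply: (@le_integrable _ _ _ mu setT measurableT _
  (fun x => K%:E * (normal_pdf 0 (Num.sqrt 2) x)%:E)%E).
- apply/measurable_EFinP; apply: measurable_funM; last exact: measurable_normal_pdf.
  by apply: continuous_measurable_fun; exact: continuous_horner.
- move=> x _; rewrite -EFinM !abse_EFin lee_fin.
  by apply: le_trans (HK x) _; exact: ler_norm.
- by apply: integrableZl.
Qed.

Lemma integrable_poly_hermite_gauss (p : {poly R}) m :
  mu.-integrable setT (EFin \o (fun x => p.[x] * hermite_gauss m x)).
Proof.
have := integrable_poly_gauss (p * hermite_prob m).
by congr (_.-integrable _ _); apply/funext => x /=; rewrite hornerM -mulrA.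
Qed.

(** The difference of the integrands is, up to sign, the derivative of the product of [p] and
    [hermite_gauss m], and its total integral vanishes. *)
Lemma Rintegral_deriv_hermite (p : {poly R}) m :
  \int[mu]_x (p.[x] * hermite_gauss m.+1 x) =
  \int[mu]_x (p^`().[x] * hermite_gauss m x).
Proof.
apply/eqP; rewrite -subr_eq0 -RintegralB//; try exact: integrable_poly_hermite_gauss.
rewrite -oppr_eq0 -mulN1r -RintegralZl//; last first.
  under [X in _ _ X]eq_fun do rewrite /= EFinB.
  by apply: integrableB => //; exact: integrable_poly_hermite_gauss.
apply/eqP; apply: (@Rintegral_derive_eq0 _ (fun x => p.[x] * hermite_gauss m x)).
- move=> x; have := is_deriveM (is_derive_poly p x) (is_derive_hermite_gauss m x).
  by move/is_derive_eq; apply; rewrite /GRing.scale /=; ring.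
- move=> x; apply: cvgM; first exact: cvg_cst.
  by apply: cvgB; apply: cvgM; solve [exact: continuous_horner|exact: continuous_hermite_gauss].
- exact: integrable_poly_hermite_gauss.
- under [X in _ _ X]eq_fun do rewrite /= EFinM EFinB.
  apply: integrableZl => //; apply: integrableB => //;
  exact: integrable_poly_hermite_gauss.
Qed.

Lemma deriv_hermite_prob m :
  (@hermite_prob R m.+1)^`() = m.+1%:R *: hermite_prob m.
Proof.
elim: m => [|m IH].
  by rewrite /= derivC subr0 mulr1 derivX scale1r.
rewrite -[hermite_prob m.+2]/('X * hermite_prob m.+1 - (hermite_prob m.+1)^`()).
rewrite derivB derivM derivX mul1r IH derivZ -scalerAr -addrA -scalerBr.
by rewrite -[in RHS]natr1 scalerDl scale1r addrC.
Qed.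

(** Each integration by parts lowers both indices by one and releases a factor [m], until one of
    them is 0. *)
Lemma Rintegral_hermite_prob2 m n :
  \int[mu]_x ((hermite_prob m).[x] * hermite_gauss n x) = (m`! * (m == n))%:R.
Proof.
elim: n m => [|n IH] [|m].
- rewrite /= fact0 mul1n -[RHS]/(fine 1%E) -(@integral_normal_pdf R 0 1).
  by apply: eq_Rintegral => x _; rewrite /hermite_gauss /= hornerC !mul1r.
- rewrite muln0.
  transitivity (\int[mu]_x ((1 : {poly R}).[x] * hermite_gauss m.+1 x)).
    apply: eq_Rintegral => x _.
    by rewrite /hermite_gauss [hermite_prob 0]/= hornerC !mul1r.
  rewrite Rintegral_deriv_hermite derivC.
  by under eq_Rintegral do rewrite horner0 mul0r; rewrite Rintegral_cst// mul0r.
- rewrite Rintegral_deriv_hermite /= derivC muln0.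
  by under eq_Rintegral do rewrite horner0 mul0r; rewrite Rintegral_cst// mul0r.
- rewrite Rintegral_deriv_hermite deriv_hermite_prob.
  under eq_Rintegral do rewrite hornerZ -mulrA.
  rewrite RintegralZl//; last exact: integrable_poly_hermite_gauss.
  by rewrite IH eqSS factS -natrM mulnA.
Qed.

End Hermite.

(** * Taylor expansion of one-dimensional Hermite integrals *)

Section HermiteTaylor.
Context {R : realType}.
Local Notation mu := (@lebesgue_measure R).
Local Notation int a b f := (\int[mu]_(x in `[a, b]) f x).
Local Notation pdf := (normal_pdf (0 : R) 1).

(* In the application, [P k x s] is the real part of the inner product of
   [f (x + s w)] with [conj(w)^k c], for [w] of modulus 1; by Cauchy-Riemann,
   the form [P k dx + P k.+1 ds] is closed. *)
Variables (P : nat -> R -> R -> R) (rho : R) (phi : R -> R).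
Hypothesis closedP : forall k x s, `|s| < rho -> closed_form_at (P k) (P k.+1) x s.
Hypothesis P_le : forall k x s, `|s| < rho -> `|P k x s| <= phi x.
Hypothesis mphi : measurable_fun setT phi.
Hypothesis iphi : mu.-integrable setT (EFin \o (fun x => phi x ^+ 2 * pdf x)).

Lemma integrable_phi_hermite m :
  mu.-integrable setT (EFin \o (fun x => phi x * `|hermite_gauss m x|)).
Proof.
pose g (x : R) := phi x ^+ 2 * pdf x + (hermite_prob m ^+ 2).[x] * pdf x.
apply: (@le_integrable _ _ _ mu setT measurableT _ (EFin \o g)).
- apply/measurable_EFinP; apply: measurable_funM => //.
  apply: measurableT_comp => //.
  by apply: continuous_measurable_fun; exact: continuous_hermite_gauss.
- move=> x _; rewrite !abse_EFin lee_fin.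
  apply: le_trans (ler_norm _); rewrite /g horner_exp -mulrDl.
  rewrite /hermite_gauss !normrM !normr_id (ger0_norm (normal_pdf_ge0 0 1 x)).
  rewrite mulrA ler_wpM2r ?normal_pdf_ge0//.
  rewrite -[phi x ^+ 2]real_normK ?num_real//.
  rewrite -[_.[x] ^+ 2]real_normK ?num_real//.
  have := sqr_ge0 (`|phi x| - `|(hermite_prob m).[x]|).
  have : 0 <= `|phi x| * `|(hermite_prob m).[x]| by rewrite mulr_ge0.
  by rewrite sqrrB; lra.
- under [X in _ _ X]eq_fun do rewrite /g /= EFinD.
  by apply: integrableD => //; exact: integrable_poly_gauss.
Qed.

Definition hermite_bound m := \int[mu]_x (phi x * `|hermite_gauss m x|).

Lemma integrable_le_phi (f : R -> R) C m : measurable_fun setT f ->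
  (forall x, `|f x| <= C * phi x) ->
  mu.-integrable setT (EFin \o (fun x => f x * hermite_gauss m x)).
Proof.
move=> mf fC.
apply: (@le_integrable _ _ _ mu setT measurableT _
  (fun x => C%:E * (phi x * `|hermite_gauss m x|)%:E)%E).
- apply/measurable_EFinP; apply: measurable_funM => //.
  by apply: continuous_measurable_fun; exact: continuous_hermite_gauss.
- move=> x _; rewrite -EFinM !abse_EFin lee_fin.
  apply: le_trans (ler_norm _); rewrite normrM mulrA ler_wpM2r//.
- by apply: integrableZl => //; exact: integrable_phi_hermite.
Qed.

Lemma le_Rintegral_phi (f : R -> R) C m : measurable_fun setT f ->
  (forall x, `|f x| <= C * phi x) ->
  `|\int[mu]_x (f x * hermite_gauss m x)| <= C * hermite_bound m.
Proof.
move=> mf fC; rewrite /hermite_bound -RintegralZl//; last exact: integrable_phi_hermite.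
apply: le_trans (le_normr_Rintegral _ _) _ => //.
  exact: integrable_le_phi fC.
apply: le_Rintegral => //.
- exact/integrable_norm/integrable_le_phi/fC.
- under [X in _ _ X]eq_fun do rewrite /= EFinM.
  by apply: integrableZl => //; exact: integrable_phi_hermite.
- by move=> x _; rewrite normrM mulrA ler_wpM2r.
Qed.

Let measurableP k s : `|s| < rho -> measurable_fun setT (P k ^~ s).
Proof.
move=> sr; apply: continuous_measurable_fun.
exact: (closed_form_contP (@closedP k) sr).
Qed.

(** Up to the factor [sqrt(m!)], the Hermite coefficient of index [m] of the slice [P k] at height
    [s]. *)
Definition hermite_int (k m : nat) (s : R) :=
  \int[mu]_x (P k x s * hermite_gauss m x).

Definition primitive_int (k m : nat) (S : R) :=
  \int[mu]_x (int 0 S (P k x) * hermite_gauss m x).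

Let le_int k (x S : R) : 0 <= S < rho -> `|int 0 S (P k x)| <= S * phi x.
Proof.
move=> /andP[S0 Sr].
have := @Rintegral_near_cst _ (P k x) 0 S 0 (phi x) S0.
rewrite mul0r !subr0 mulrC; apply.
  apply: continuous_in_subspaceT => t /set_mem/=.
  rewrite in_itv/= => /andP[t0 tS].
  have tr : `|t| < rho by rewrite ger0_norm// (le_lt_trans tS).
  by have [] := cvg_of_closed_form (@closedP k x t tr).
move=> t /andP[t0 tS]; rewrite subr0; apply: P_le.
by rewrite ger0_norm// (le_lt_trans tS).
Qed.

Let derive_int k (x S : R) : 0 <= S < rho ->
  is_derive x 1 (fun y => int 0 S (P k.+1 y)) (P k x S - P k x 0).
Proof. by apply: is_derive_slice => ? ?; exact: closedP. Qed.

Let continuous_int k (S : R) : 0 <= S < rho ->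
  continuous (fun y => int 0 S (P k.+1 y)).
Proof.
move=> Sr x; apply/differentiable_continuous/derivable1_diffP.
by have [] := derive_int k x Sr.
Qed.

(* Closedness turns the increment in [s] into an [x]-derivative, which is moved
   by parts onto [hermite_gauss m], whose derivative is [- hermite_gauss m.+1]. *)
Lemma hermite_int_primitive k m S : 0 <= S < rho ->
  hermite_int k m S - hermite_int k m 0 = primitive_int k.+1 m.+1 S.
Proof.
move=> Sr; have /andP[S0 SR] := Sr.
have r0 : 0 < rho by exact: le_lt_trans SR.
have n0 : `|0 : R| < rho by rewrite normr0.
have nS : `|S| < rho by rewrite ger0_norm.
have iP s : `|s| < rho ->
    mu.-integrable setT (EFin \o (fun x => P k x s * hermite_gauss m x)).
  move=> sr; apply: (@integrable_le_phi _ 1); first exact: measurableP.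
  by move=> x; rewrite mul1r; exact: P_le.
have mI : measurable_fun setT (fun x => int 0 S (P k.+1 x)).
  by apply: continuous_measurable_fun; exact: continuous_int.
have iI n : mu.-integrable setT
    (EFin \o (fun x => int 0 S (P k.+1 x) * hermite_gauss n x)).
  by apply: (@integrable_le_phi _ S) => // x; exact: le_int.
apply/eqP; rewrite -subr_eq0 /hermite_int /primitive_int; apply/eqP.
have iB : mu.-integrable setT (EFin \o (fun x =>
    P k x S * hermite_gauss m x - P k x 0 * hermite_gauss m x)).
  under [X in _ _ X]eq_fun do rewrite /= EFinB.
  by apply: integrableB => //; exact: iP.
rewrite -(RintegralB measurableT (iP S nS) (iP 0 n0)).
rewrite -(RintegralB measurableT iB (iI m.+1)).
apply: (@Rintegral_derive_eq0 _ (fun x => int 0 S (P k.+1 x) * hermite_gauss m x)).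
- move=> x; have := is_deriveM (derive_int k x Sr) (is_derive_hermite_gauss m x).
  by move/is_derive_eq; apply; rewrite /GRing.scale /=; ring.
- have cP s : `|s| < rho -> continuous (P k ^~ s).
    by move=> sr; exact: (closed_form_contP (@closedP k) sr).
  move=> x; apply: cvgB; first apply: cvgB;
    (apply: cvgM; last exact: continuous_hermite_gauss).
  + exact: cP.
  + exact: cP.
  + exact: continuous_int.
- exact: iI.
- under [X in _ _ X]eq_fun do rewrite /= EFinB.
  by apply: integrableB => //; exact: iI.
Qed.

(** Differentiation under the integral: the derivative in [S] of the integrand comes from the
    fundamental theorem of calculus, and it is dominated by [phi] times [|hermite_gauss m|]
    uniformly in [S]. *)
Lemma is_derive_primitive_int k m (S : R) : 0 < S < rho ->
  is_derive S 1 (primitive_int k.+1 m) (hermite_int k.+1 m S).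
Proof.
move=> /andP[S0 Sr].
pose f s x := int 0 s (P k.+1 x) * hermite_gauss m x.
have df s x : 0 < s < rho -> is_derive s 1 (f ^~ x) (P k.+1 x s * hermite_gauss m x).
  move=> /andP[s0 sr].
  pose u := (s + rho) / 2.
  have su : s < u by rewrite /u; lra.
  have ur : u < rho by rewrite /u; lra.
  have fi : mu.-integrable `[0, u] (EFin \o (P k.+1 x)).
    apply: continuous_compact_integrable; first exact: segment_compact.
    apply: continuous_in_subspaceT => t /set_mem/=.
    rewrite in_itv/= => /andP[t0 tu]; apply: (closed_form_contQ (@closedP k)).
    by rewrite ger0_norm// (le_lt_trans tu).
  have cs : {for s, continuous (P k.+1 x)}.
    by apply: (closed_form_contQ (@closedP k)); rewrite gtr0_norm.
  have [dI IE] := continuous_FTC1_closed su fi s0 cs.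
  have dI' : is_derive s 1 (fun y => int 0 y (P k.+1 x)) (P k.+1 x s).
    by apply: DeriveDef; [exact: dI|rewrite -derive1E; exact: IE].
  have := is_deriveM dI' (is_derive_cst (hermite_gauss m x) s 1).
  by move/is_derive_eq; apply; rewrite /GRing.scale /= mulr0 add0r mulrC.
have Ia : `]0, rho[%classic S by rewrite /= in_itv/= S0.
have intf s : `]0, rho[%classic s -> mu.-integrable setT (EFin \o f s).
  rewrite /= in_itv/= => /andP[s0 sr].
  have s0r : 0 <= s < rho by rewrite (ltW s0).
  apply: (@integrable_le_phi _ s) => [|x]; last exact: le_int.
  by apply: continuous_measurable_fun; exact: continuous_int.
have derf1 s x : `]0, rho[%classic s -> setT x -> derivable (f ^~ x) s 1.
  by rewrite /= in_itv/= => /df H _; have [] := H x.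
have d1 s x : 0 < s < rho -> partial1of2 f s x = P k.+1 x s * hermite_gauss m x.
  by move=> /df H; rewrite partial1of2E; have [] := H x.
have r0 : 0 < rho by exact: lt_trans Sr.
have G0 x : 0 <= phi x * `|hermite_gauss m x|.
  rewrite mulr_ge0//; apply: le_trans (normr_ge0 _) (@P_le 0 x 0 _).
  by rewrite normr0.
have G_ub s x : `]0, rho[%classic s -> setT x ->
    `|partial1of2 f s x| <= phi x * `|hermite_gauss m x|.
  rewrite /= in_itv/= => sr _; rewrite d1// normrM ler_wpM2r//.
  by apply: P_le; case/andP : sr => s0 sr; rewrite gtr0_norm.
have iG := integrable_phi_hermite m.
apply: DeriveDef.
  exact: (derivable_under_integral measurableT Ia intf derf1 G0 iG G_ub).
rewrite -derive1E.
have -> := differentiation_under_integral measurableT Ia intf derf1 G0 iG G_ub.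
by apply: eq_Rintegral => x _; rewrite d1// S0.
Qed.

(** Up to a constant, [hermite_int k m] is [primitive_int k.+1 m.+1]. A derivative in [s] thus
    merely raises both indices, which stands in for the successive derivatives of [f]. *)
Lemma is_derive_hermite_int k m (S : R) : 0 < S < rho ->
  is_derive S 1 (hermite_int k m) (hermite_int k.+1 m.+1 S).
Proof.
move=> Sr; have /andP[S0 SR] := Sr.
have := is_deriveD (is_derive_cst (hermite_int k m 0) S 1)
  (is_derive_primitive_int k m.+1 Sr).
rewrite add0r; apply: near_eq_is_derive; near=> s.
rewrite fctE -hermite_int_primitive; first by rewrite addrC subrK.
apply/andP; split.
  by near: s; exact: lt_le_nbhsr.
by near: s; exact: lt_nbhsl.
Unshelve. all: by end_near. Qed.

Lemma le_hermite_int k m S : `|S| < rho -> `|hermite_int k m S| <= hermite_bound m.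
Proof.
move=> Sr; rewrite -[leRHS]mul1r; apply: le_Rintegral_phi.
  exact: measurableP.
by move=> x; rewrite mul1r; exact: P_le.
Qed.

(** Derivatives are known for [S > 0] only; right continuity lets the comparison in the Taylor bound
    start from 0. *)
Lemma hermite_int_cvg_at_right k m : 0 < rho ->
  hermite_int k m @ 0^'+ --> hermite_int k m 0.
Proof.
move=> r0.
have B0 : 0 <= hermite_bound m.+1.
  by apply: le_trans (normr_ge0 _) (@le_hermite_int 0 m.+1 0 _); rewrite normr0.
apply/cvgrPdist_le => /= e e0; near=> s.
have s0 : 0 < s by near: s; exact: nbhs_right_gt.
have sr : 0 <= s < rho by rewrite ltW//=; near: s; exact: nbhs_right_lt.
rewrite distrC hermite_int_primitive//.
apply: le_trans (@le_Rintegral_phi _ s m.+1 _ _) _.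
- by apply: continuous_measurable_fun; exact: continuous_int.
- by move=> x; exact: le_int.
apply: (@le_trans _ _ (s * (hermite_bound m.+1 + 1))).
  by rewrite ler_wpM2l ?ltW// ltrDl.
rewrite -ler_pdivlMr ?ltr_wpDl//; near: s; apply: nbhs_right_le.
by apply: divr_gt0 => //; apply: ltr_wpDl.
Unshelve. all: by end_near. Qed.

(** The [s]-derivative of the remainder of order [K.+1] at [(k, m)] is the remainder of order [K] at
    [(k.+1, m.+1)], bounded by induction by the derivative of the monomial [q]; the remainder and
    [q] both vanish at 0. *)
Theorem hermite_int_taylor K k m (S : R) : 0 <= S < rho ->
  `|hermite_int k m S -
    \sum_(i < K) S ^+ i / i`!%:R * hermite_int (k + i) (m + i) 0| <=
  S ^+ K / K`!%:R * hermite_bound (m + K).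
Proof.
elim: K k m S => [|K IH] k m S /andP[S0 Sr].
  rewrite big_ord0 subr0 expr0 divr1 mul1r addn0; apply: le_hermite_int.
  by rewrite ger0_norm.
have r0 : 0 < rho by exact: le_lt_trans Sr.
pose c i : R := hermite_int (k + i) (m + i) 0 / i`!%:R.
pose p := \poly_(i < K.+1) c i.
pose B := hermite_bound (m + K.+1).
pose q : {poly R} := (B / K.+1`!%:R) *: 'X^(K.+1).
have pE s : p.[s] = \sum_(i < K.+1) s ^+ i / i`!%:R * hermite_int (k + i) (m + i) 0.
  rewrite horner_poly; apply: eq_bigr => i _.
  by rewrite /c mulrC mulrA mulrAC mulrC mulrA mulrAC.
have p'E s : p^`().[s] =
    \sum_(i < K) s ^+ i / i`!%:R * hermite_int (k.+1 + i) (m.+1 + i) 0.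
  have -> : p^`() = \poly_(i < K) (hermite_int (k.+1 + i) (m.+1 + i) 0 / i`!%:R).
    apply/polyP => i; rewrite coef_deriv !coef_poly ltnS.
    case: ifP => _; last by rewrite mul0rn.
    rewrite /c !addSnnS factS natrM -mulr_natl; field.
    by rewrite nat1r !pnatr_eq0 -lt0n fact_gt0.
  rewrite horner_poly; apply: eq_bigr => i _.
  by rewrite mulrC mulrA mulrAC mulrC mulrA mulrAC.
have q'E s : q^`().[s] = s ^+ K / K`!%:R * hermite_bound (m.+1 + K).
  rewrite derivZ derivXn !hornerE hornerMn hornerXn -mulr_natl /B addSnnS.
  rewrite factS natrM; field.
  by rewrite nat1r !pnatr_eq0 -lt0n fact_gt0.
have qE s : q.[s] = s ^+ K.+1 / K.+1`!%:R * B.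
  by rewrite /q !hornerE; ring.
have p0 : p.[0] = hermite_int k m 0.
  rewrite pE big_ord_recl /= expr0 fact0 divr1 mul1r !addn0 big1 ?addr0// => i _.
  by rewrite expr0n /= !mul0r.
have q0 : q.[0] = 0 by rewrite qE expr0n !mul0r.
(* The sign [t] is 1 or -1, so that both halves of the absolute value follow from a single
   monotonicity argument. *)
have H (t : R) (t2 : t ^+ 2 = 1) : t * (hermite_int k m S - p.[S]) <= q.[S].
  rewrite -subr_le0.
  pose h s := t * (hermite_int k m s - p.[s]) - q.[s].
  have h0 : h 0 = 0 by rewrite /h p0 q0 subrr mulr0 subrr.
  rewrite -/(h S) -h0.
  have [->//|Sn0] := eqVneq S 0.
  have Sp : 0 < S by rewrite lt_neqAle eq_sym Sn0.
  have dh s : 0 < s < rho -> is_derive s 1 h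
      (t * (hermite_int k.+1 m.+1 s - p^`().[s]) - q^`().[s]).
    move=> /(is_derive_hermite_int k m) d.
    have := is_deriveB (is_deriveZ t (is_deriveB d (is_derive_poly p s)))
      (is_derive_poly q s).
    by [].
  have cat0 : h @ 0^'+ --> h 0.
    apply: cvgB; last by apply: cvg_at_right_filter; exact: continuous_horner.
    apply: cvgM; first exact: cvg_cst.
    apply: cvgB; first exact: hermite_int_cvg_at_right.
    by apply: cvg_at_right_filter; exact: continuous_horner.
  have dS s : 0 < s < rho -> {for s, continuous h}.
    move=> /dh[d _]; apply/differentiable_continuous/derivable1_diffP; exact: d.
  apply: (@ler0_derive1_le_cc _ h 0 S) => //.
  - move=> s; rewrite in_itv/= => /andP[s0 sS].
    by have [] := dh s; rewrite // s0 (lt_trans sS).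
  - move=> s; rewrite in_itv/= => /andP[s0 sS].
    have sr : 0 < s < rho by rewrite s0 (lt_trans sS).
    have [_] := dh s sr; rewrite -derive1E => ->.
    rewrite subr_le0 q'E p'E; apply: le_trans (ler_norm _) _.
    have -> : `|t * (hermite_int k.+1 m.+1 s -
        \sum_(i < K) s ^+ i / i`!%:R * hermite_int (k.+1 + i) (m.+1 + i) 0)| =
        `|hermite_int k.+1 m.+1 s -
        \sum_(i < K) s ^+ i / i`!%:R * hermite_int (k.+1 + i) (m.+1 + i) 0|.
      have t1 : `|t| = 1.
        by apply/eqP; rewrite -(@pexpr_eq1 _ `|t| 2)// -normrX t2 normr1.
      by rewrite normrM t1 mul1r.
    by apply: IH; rewrite (ltW s0); case/andP : sr.
  - apply/(continuous_within_itvP _ Sp); split => //.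
    + move=> s; rewrite in_itv/= => /andP[s0 sS]; apply: dS.
      by rewrite s0 (lt_trans sS).
    + by apply: cvg_at_left_filter; apply: dS; rewrite Sp.
  - by rewrite bound_itvE.
  - by rewrite bound_itvE.
rewrite -pE -/B -qE; apply/ler_normlP; split.
  by have := H (-1); rewrite mulN1r; apply; rewrite sqrrN expr1n.
by have := H 1; rewrite mul1r; apply; rewrite expr1n.
Qed.

End HermiteTaylor.

(** * Real inner product and holomorphic slices *)

Section RealInnerProduct.
Context {R : realType} {X : completeNormedModType R[i]}.
Implicit Types (x y : X) (z : R[i]).

Lemma rnormE x : (rnorm x)%:C = `|x|.
Proof. by rewrite /rnorm RRe_real// normr_real. Qed.

Lemma rnorm_ge0 x : 0 <= rnorm x.
Proof. by rewrite -ler0c rnormE. Qed.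

Lemma rnorm0 : rnorm (0 : X) = 0.
Proof. by rewrite /rnorm normr0. Qed.

Lemma ler_rnormD x y : rnorm (x + y) <= rnorm x + rnorm y.
Proof. by rewrite -lecR rmorphD /= !rnormE ler_normD. Qed.

Lemma rnormZ z x : rnorm (z *: x) = complex.Re `|z| * rnorm x.
Proof.
apply: complexI; by rewrite rmorphM /= !rnormE normrZ.
Qed.

Lemma rnormN x : rnorm (- x) = rnorm x.
Proof. by rewrite /rnorm normrN. Qed.

Lemma rnorm_eq0 x : (rnorm x == 0) = (x == 0).
Proof. by rewrite -[x == 0]normr_eq0 -(rnormE x) eq_complex /= eqxx andbT. Qed.

Variable dot : {dot X for @Num.conj R[i]}.
Hypothesis dot_norm : forall x, dot x x = `|x| ^+ 2.

(** The real part turns [X] into a real Hilbert space, so that pairings are real functions with real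
    integrals. Complex phases are not lost: [ip_conj] moves them to the second argument. *)
Definition ip x y : R := complex.Re (dot x y).

Lemma ipDl x y w : ip (x + y) w = ip x w + ip y w.
Proof. by rewrite /ip linearDl raddfD. Qed.

Lemma ipNl x w : ip (- x) w = - ip x w.
Proof. by rewrite /ip linearNl raddfN. Qed.

Lemma ipBl x y w : ip (x - y) w = ip x w - ip y w.
Proof. by rewrite ipDl ipNl. Qed.

Lemma ip0l w : ip 0 w = 0.
Proof. by rewrite /ip linear0l. Qed.

Lemma ipC x y : ip x y = ip y x.
Proof. by rewrite /ip hermC /= expr0 mul1r; case: (dot y x). Qed.

Lemma ipDr x y w : ip w (x + y) = ip w x + ip w y.
Proof. by rewrite ipC ipDl !(ipC w). Qed.

Lemma ipBr x y w : ip w (x - y) = ip w x - ip w y.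
Proof. by rewrite ipC ipBl !(ipC w). Qed.

Lemma ip0r w : ip w 0 = 0.
Proof. by rewrite ipC ip0l. Qed.

Lemma ipZl (k : R) x w : ip (k%:C *: x) w = k * ip x w.
Proof.
by rewrite /ip linearZl_LR /=; case: (dot x w) => a b /=; rewrite mul0r subr0.
Qed.

Lemma ipZr (k : R) x w : ip w (k%:C *: x) = k * ip w x.
Proof. by rewrite ipC ipZl ipC. Qed.

Lemma ip_sumr (I : Type) (r : seq I) (P : pred I) (F : I -> X) w :
  ip w (\sum_(i <- r | P i) F i) = \sum_(i <- r | P i) ip w (F i).
Proof.
by elim/big_rec2 : _ => [|i a b _ <-]; [exact: ip0r|rewrite ipDr].
Qed.

Lemma ip_suml (I : Type) (r : seq I) (P : pred I) (F : I -> X) w :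
  ip (\sum_(i <- r | P i) F i) w = \sum_(i <- r | P i) ip (F i) w.
Proof. by rewrite ipC ip_sumr; apply: eq_bigr => i _; exact: ipC. Qed.

Lemma ip_conj z x y : ip (z *: x) y = ip x (Num.conj z *: y).
Proof. by rewrite /ip linearZl_LR linearZr_LR /= conjCK. Qed.

Lemma ip_rnorm x : ip x x = rnorm x ^+ 2.
Proof. by rewrite /ip dot_norm -rnormE -rmorphXn. Qed.

Lemma ip_CauchySchwarz x y : `|ip x y| <= rnorm x * rnorm y.
Proof.
have [y0|y0] := eqVneq (rnorm y) 0.
  by move/eqP: (y0); rewrite rnorm_eq0 => /eqP ->; rewrite ip0r normr0 rnorm0 mulr0.
have y2 : 0 < rnorm y ^+ 2 by rewrite exprn_even_gt0.
have : 0 <= rnorm ((rnorm y ^+ 2)%:C *: x - (ip x y)%:C *: y) ^+ 2.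
  exact: sqr_ge0.
rewrite -ip_rnorm ipBl !ipBr !ipZl !ipZr !ip_rnorm (ipC y x).
rewrite [leRHS](_ : _ =
    rnorm y ^+ 2 * ((rnorm x * rnorm y) ^+ 2 - `|ip x y| ^+ 2)); last first.
  by rewrite real_normK ?num_real//; ring.
rewrite pmulr_rge0// subr_ge0 ler_pXn2r// nnegrE ?normr_ge0//.
by rewrite mulr_ge0// rnorm_ge0.
Qed.

End RealInnerProduct.

Section Slice.
Context {R : realType} {X : completeNormedModType R[i]}.
Variable dot : {dot X for @Num.conj R[i]}.
Hypothesis dot_norm : forall x, dot x x = `|x| ^+ 2.
Local Notation ip := (ip dot).

(** The differential is restricted to a complex line, with real tolerances. That [t] ranges over all
    complex numbers with one and the same [l] is the form in which Cauchy-Riemann is used. *)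
Lemma differentiable_approx N (f : 'rV[R[i]^o]_N -> X) (z e : 'rV[R[i]^o]_N) :
  differentiable f z -> exists l : X, forall eps : R, 0 < eps ->
  exists2 d, 0 < d & forall t : R[i], `|t| < d%:C ->
    rnorm (f (z + t *: e) - f z - t *: l) <= eps * complex.Re `|t|.
Proof.
move=> df; exists ('d f z e) => eps eps0.
have /eqaddoP := diff_locally df.
pose k := rnorm (e : 'rV[R[i]^o]_N) + 1.
have ke : (`|e| : R[i]) <= k%:C.
  by rewrite /k /rnorm rmorphD /= RRe_real ?normr_real// lerDl ler01.
have k0 : 0 < k.
  by rewrite /k ltr_wpDl// -ler0c /rnorm RRe_real// normr_real.
have ek0 : 0 < (eps / k)%:C by rewrite ltcR divr_gt0.
move=> /(_ _ ek0) /nbhs_norm0P [d d0 Hd].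
have dR : d = (complex.Re d)%:C by rewrite RRe_real// ger0_real// ltW.
have Rd0 : 0 < complex.Re d by rewrite -ltcR -dR.
exists (complex.Re d / k); first by rewrite divr_gt0.
move=> t td.
have te : `|t *: e| < d.
  rewrite normrZ; apply: (@le_lt_trans _ _ (`|t| * k%:C)).
    by rewrite ler_wpM2l.
  have -> : d = (complex.Re d / k)%:C * k%:C.
    by rewrite -rmorphM /= divfK ?gt_eqF.
  by rewrite ltr_pM2r// ltcR.
have fE : f (z + t *: e) - f z - t *: 'd f z e =
    ((f \o shift z) - (cst (f z) + 'd f z)) (t *: e).
  by rewrite !fctE /= opprD addrA [z + _]addrC [X in _ = _ - X]linearZ.
rewrite -lecR rnormE fE; apply: le_trans (Hd _ te) _.
have -> : (eps * complex.Re `|t|)%:C = eps%:C * `|t|.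
  by rewrite -[X in _ = _ * X]RRe_real ?normr_real// -rmorphM.
rewrite normrZ mulrCA.
rewrite [leRHS]mulrC ler_wpM2l//.
apply: (@le_trans _ _ ((eps / k)%:C * k%:C)).
  by rewrite ler_wpM2l// ltW.
by rewrite -rmorphM /= divfK ?gt_eqF.
Qed.

(** For an increment [(dx, ds)] the derivative is [(dx + ds w) l]. Paired with [c], its [ds]
    coefficient is [ip (w *: l) c]; paired with [conj(w) c], its [dx] coefficient is the same
    number, by [ip_conj]. This is closedness. *)
Lemma closed_form_slice N (f : 'rV[R[i]^o]_N -> X) (z e : 'rV[R[i]^o]_N)
    (w : R[i]) (c : X) (x s : R) :
  differentiable f (z + (x%:C + s%:C * w) *: e) ->
  closed_form_at (fun x s => ip (f (z + (x%:C + s%:C * w) *: e)) c)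
    (fun x s => ip (f (z + (x%:C + s%:C * w) *: e)) (Num.conj w *: c)) x s.
Proof.
move=> /(@differentiable_approx _ _ _ e) [l Hl].
exists (ip l c), (ip (w *: l) c), (ip (w *: l) (Num.conj w *: c)) => eps eps0.
pose W := complex.Re `|w| + 1.
have W0 : 0 < W.
  by rewrite /W ltr_wpDl// -ler0c RRe_real// normr_real.
pose K := W * (rnorm c + rnorm (Num.conj w *: c) + 1).
have K0 : 0 < K by rewrite mulr_gt0// ltr_wpDl// addr_ge0// rnorm_ge0.
have [d d0 Hd] := Hl (eps / K) (divr_gt0 eps0 K0).
exists (d / (2 * W)); first by rewrite divr_gt0// mulr_gt0.
move=> x' s' xx' ss'.
pose t : R[i] := (x' - x)%:C + (s' - s)%:C * w.
have tn : complex.Re `|t| <= W * (`|x' - x| + `|s' - s|).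
  rewrite -lecR RRe_real ?normr_real// (le_trans (ler_normD _ _))//.
  rewrite normrM !normc_def /= expr0n !addr0 !sqrtr_sqr.
  rewrite -rmorphM -rmorphD lecR.
  have wW : Num.sqrt (complex.Re w ^+ 2 + complex.Im w ^+ 2) = W - 1.
    by rewrite /W addrK normc_def.
  rewrite wW; have : 0 <= `|x' - x| by [].
  have : 0 <= `|s' - s| by [].
  have : 1 <= W by rewrite /W lerDr -ler0c RRe_real// normr_real.
  move: `|x' - x| `|s' - s| => a b W1 b0 a0.
  have : 0 <= (W - 1) * a + b by rewrite addr_ge0// mulr_ge0// subr_ge0.
  by clear; lra.
have td : `|t| < d%:C.
  rewrite -[X in X < _]RRe_real ?normr_real// ltcR (le_lt_trans tn)// mulrC.
  rewrite -ltr_pdivlMr//.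
  have -> : d / W = d / (2 * W) + d / (2 * W) by field; rewrite gt_eqF.
  exact: ltrD.
have zE : z + (x'%:C + s'%:C * w) *: e = z + (x%:C + s%:C * w) *: e + t *: e.
  rewrite -addrA -scalerDl /t !rmorphB /=; congr (_ + _ *: _); ring.
have est (c' : X) : rnorm c' <= rnorm c + rnorm (Num.conj w *: c) + 1 ->
   `|ip (f (z + (x'%:C + s'%:C * w) *: e) - f (z + (x%:C + s%:C * w) *: e) - t *: l) c'|
    <= eps * (`|x' - x| + `|s' - s|).
  move=> cc; apply: le_trans (ip_CauchySchwarz dot_norm _ _) _.
  rewrite zE; apply: le_trans (ler_pM (rnorm_ge0 _) (rnorm_ge0 _) (Hd t td) cc) _.
  have -> : eps / K = eps / W / (rnorm c + rnorm (Num.conj w *: c) + 1).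
    by rewrite /K invfM mulrA.
  rewrite mulrAC divfK; last first.
    by rewrite gt_eqF// ltr_wpDl// addr_ge0// rnorm_ge0.
  by rewrite mulrAC ler_pdivrMr// -mulrA ler_wpM2l ?(ltW eps0)// mulrC.
have tl (c' : X) : ip (t *: l) c' = ip l c' * (x' - x) + ip (w *: l) c' * (s' - s).
  rewrite /t scalerDl ipDl ipZl -scalerA ipZl.
  by rewrite mulrC [X in _ + X]mulrC.
split.
- rewrite -ipBl -tl -ipBl; apply: est.
  by rewrite -addrA lerDl addr_ge0// rnorm_ge0.
- rewrite ip_conj -ipBl -tl -ipBl; apply: est.
  by rewrite addrAC lerDr addr_ge0// rnorm_ge0.
Qed.

End Slice.

(** * The Gaussian measure on sequences *)

Section GaussianProduct.
Context {R : realType}.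
Local Notation normal := (normal_prob (0 : R) 1).

Definition gaussian_boxes (T : Type) (I : choiceType) (coord : I -> T -> R) :
    set (set T) :=
  [set B | exists (J : {fset I}) (A : I -> set R), (forall j, measurable (A j)) /\
     B = [set y | forall j, j \in J -> A j (coord j y)]].

(** Boxes over [J] and [J'] meet in a box over the union, so that boxes form a pi-system, here a
    generating one. *)
Lemma gaussian_product_unique d (T : measurableType d) (I : choiceType)
    (coord : I -> T -> R) (m1 m2 : {measure set T -> \bar R}) :
  (forall j, measurable_fun setT (coord j)) ->
  @measurable _ T `<=` <<s gaussian_boxes coord >> ->
  (forall (J : {fset I}) (A : I -> set R), (forall j, measurable (A j)) ->
    m1 [set y | forall j, j \in J -> A j (coord j y)] =
    (\prod_(j <- J) normal (A j))%E) ->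
  (forall (J : {fset I}) (A : I -> set R), (forall j, measurable (A j)) ->
    m2 [set y | forall j, j \in J -> A j (coord j y)] =
    (\prod_(j <- J) normal (A j))%E) ->
  forall B, measurable B -> m1 B = m2 B.
Proof.
move=> mcoord gen H1 H2 B mB.
have setTE : [set: T] = [set y | forall j, j \in (fset0 : {fset I}) -> setT (coord j y)].
  by apply/seteqP; split.
apply: (@g_sigma_algebra_measure_unique _ R T (gaussian_boxes coord) _ (fun=> setT)).
- move=> _ [J [A [mA ->]]].
  rewrite [X in measurable X](_ : _ = \big[setI/setT]_(j <- J) coord j @^-1` (A j)).
    apply: bigsetI_measurable => j _.
    by rewrite -[X in measurable X]setTI; exact: mcoord.
  rewrite -bigcap_fset; apply/seteqP; split => y /=; first by move=> H j; exact: H.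
  by move=> H j jJ; exact: H.
- by move=> _; exists fset0, (fun=> setT); split.
- by rewrite bigcup_const//; exists 0%N.
- move=> _ _ [J [A [mA ->]]] [J' [A' [mA' ->]]].
  exists (J `|` J')%fset, (fun j => (if j \in J then A j else setT) `&`
     (if j \in J' then A' j else setT)); split.
    by move=> j; apply: measurableI; case: ifP.
  apply/seteqP; split => y /=.
    by move=> [HA HA'] j; rewrite inE => _; split; case: ifP => //; [exact: HA|exact: HA'].
  by move=> H; split => j jJ; have := H j; rewrite inE jJ ?orbT => /(_ isT) [].
- by move=> _ [J [A [mA ->]]]; rewrite H1// H2.
- by move=> _; rewrite [X in m1 X]setTE (H1 fset0 (fun=> setT))// big_seq_fset0 ltry.
- exact: gen.
Qed.

End GaussianProduct.

Section Rinfty.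
Context {R : realType}.

Lemma measurable_coord (j : nat) : measurable_fun [set: Rinfty R] (fun y : Rinfty R => y j).
Proof.
by move=> _ A mA; rewrite setTI; apply: sub_sigma_algebra; exists j, A.
Qed.

Lemma measurable_fun_Rinfty d (T : measurableType d) (f : T -> Rinfty R) :
  (forall j, measurable_fun setT (fun t => f t j)) -> measurable_fun setT f.
Proof.
move=> mf; apply: (@measurability _ _ T (Rinfty R) setT f (@cylinders R) erefl).
by move=> _ [_ [j [A [mA ->]]] <-]; rewrite setTI -[X in measurable X]setTI; exact: mf.
Qed.

Lemma Rinfty_gen : @measurable _ (Rinfty R) `<=`
  <<s gaussian_boxes (fun (j : nat) (y : Rinfty R) => y j) >>.
Proof.
apply: smallest_sub; first exact: smallest_sigma_algebra.
move=> _ [j [A [mA ->]]]; apply: sub_sigma_algebra.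
exists [fset j]%fset, (fun=> A); split=> //; apply/seteqP; split => y /=.
  by move=> Ay i /fset1P ->.
by apply; rewrite inE.
Qed.

Lemma tuple_gen N : @measurable _ (N.-tuple R) `<=`
  <<s gaussian_boxes (fun (j : 'I_N) (y : N.-tuple R) => tnth y j) >>.
Proof.
apply: smallest_sub; first exact: smallest_sigma_algebra.
rewrite -bigcup_seq => B [j _ [A mA <-]]; apply: sub_sigma_algebra.
exists [fset j]%fset, (fun=> A); split=> //; apply/seteqP; split => y /=.
  by move=> [_ Ay] i /fset1P ->.
by move=> H; split => //; apply: H; rewrite inE.
Qed.

End Rinfty.

(** * Integrating one coordinate at a time *)

Section Resampling.
Context {R : realType}.
Local Notation normal := (normal_prob (0 : R) 1).

Definition upd (j : nat) (t : R) (y : nat -> R) : nat -> R :=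
  fun i => if i == j then t else y i.

Lemma upd_same j t y : upd j t y j = t.
Proof. by rewrite /upd eqxx. Qed.

Lemma measurable_upd j : measurable_fun setT
  (fun p : measurableTypeR R * Rinfty R => (upd j p.1 p.2 : Rinfty R)).
Proof.
apply: measurable_fun_Rinfty => i; rewrite /upd.
case: (i == j); first exact: measurable_fst.
exact: (measurableT_comp (measurable_coord i) measurable_snd).
Qed.

Lemma measurable_updl j y :
  measurable_fun setT (fun t : measurableTypeR R => (upd j t y : Rinfty R)).
Proof. by apply: measurable_fun_Rinfty => i; rewrite /upd; case: (i == j). Qed.

Variable gamma : probability (Rinfty R) R.
Hypothesis hgamma : std_gaussian_infty gamma.

(** Replacing one coordinate by an independent standard Gaussian variable preserves all box
    probabilities. This serves as Fubini's theorem in the coordinate [j], without splitting the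
    infinite product. *)
Lemma resampling j (B : set (Rinfty R)) : measurable B ->
  gamma B = (normal \x gamma)%E
    ((fun p : measurableTypeR R * Rinfty R => (upd j p.1 p.2 : Rinfty R)) @^-1` B).
Proof.
pose m2 := measure_function_pushforward__canonical__measure_function_Measure
  (normal \x gamma)%E (measurable_upd j).
apply: (@gaussian_product_unique R _ _ _ (fun (j : nat) (y : Rinfty R) => y j) gamma m2).
- exact: measurable_coord.
- exact: Rinfty_gen.
- exact: hgamma.
- move=> J A mA; rewrite /m2 /= /pushforward.
  (* The fresh coordinate is constrained only when [j] lies in [J], and the other constraints do not
     see it: the preimage of the box is a rectangle. *)
  pose A1 := if j \in J then A j else setT.
  pose B1 := [set y : Rinfty R | forall i, i \in (J `\ j)%fset -> A i (y i)].
  have mA1 : measurable A1 by rewrite /A1; case: ifP.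
  have mB1 : measurable B1.
    rewrite [B1](_ : _ = \big[setI/setT]_(i <- (J `\ j)%fset) (fun y : Rinfty R => y i) @^-1` (A i)).
      apply: bigsetI_measurable => i _.
      by rewrite -[X in measurable X]setTI; exact: measurable_coord.
    rewrite -bigcap_fset; apply/seteqP; split => y /=; first by move=> H i; exact: H.
    by move=> H i iJ; exact: H.
  rewrite [X in (_ \x _)%E X](_ : _ = A1 `*` B1); last first.
    apply/seteqP; split => -[t y] /=.
      move=> H; split => /=.
        by rewrite /A1; case: ifP => // jJ; have := H j jJ; rewrite upd_same.
      move=> i; rewrite !inE => /andP[ij iJ]; have := H i iJ.
      by rewrite /upd (negbTE ij).
    move=> [/= At By] i iJ; rewrite /upd; case: eqP => [ij|/eqP ij].
      by move: At; rewrite /A1 -ij iJ.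
    by apply: By; rewrite !inE ij.
  transitivity (normal A1 * gamma B1)%E; first exact: product_measure1E.
  rewrite /B1 hgamma// /A1; case: ifP => jJ.
    by rewrite [RHS](big_fsetD1 j).
  by rewrite probability_setT mul1e mem_fsetD1// jJ.
Qed.

Lemma ge0_integral_resampling j (f : Rinfty R -> \bar R) :
  measurable_fun setT f -> (forall y, 0 <= f y)%E ->
  (\int[gamma]_y f y = \int[gamma]_y \int[normal]_t f (upd j t y))%E.
Proof.
move=> mf f0.
pose m2 := measure_function_pushforward__canonical__measure_function_Measure
  (normal \x gamma)%E (measurable_upd j).
rewrite (@eq_measure_integral _ _ _ _ m2); last by move=> A mA _; exact: resampling.
rewrite ge0_integral_pushforward//; last exact: measurable_upd.
rewrite preimage_setT fubini_tonelli2//; last by move=> ? /=; exact: f0.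
by apply: measurableT_comp => //; exact: measurable_upd.
Qed.

Lemma integrable_resampling j (f : Rinfty R -> \bar R) :
  gamma.-integrable setT f ->
  (normal \x gamma)%E.-integrable setT
    (fun p : measurableTypeR R * Rinfty R => f (upd j p.1 p.2)).
Proof.
move=> /integrableP[mf fi]; apply/integrableP; split.
  exact: (measurableT_comp mf (measurable_upd j)).
rewrite fubini_tonelli2//=; last first.
  by apply: measurableT_comp => //; exact: (measurableT_comp mf (measurable_upd j)).
by rewrite (ge0_integral_resampling j) in fi => //; exact: measurableT_comp.
Qed.

Lemma integral_resampling j (f : Rinfty R -> \bar R) :
  gamma.-integrable setT f ->
  (\int[gamma]_y f y = \int[gamma]_y \int[normal]_t f (upd j t y))%E.
Proof.
move=> fi; have fi2 := integrable_resampling j fi.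
pose m2 := measure_function_pushforward__canonical__measure_function_Measure
  (normal \x gamma)%E (measurable_upd j).
rewrite (@eq_measure_integral _ _ _ _ m2); last by move=> A mA _; exact: resampling.
have [mf _] := integrableP _ _ _ fi.
rewrite integral_pushforward//; last exact: measurable_upd.
by rewrite preimage_setT -integral21_prod_meas1.
Qed.

Lemma ae_integrable_resampling j (f : Rinfty R -> \bar R) :
  gamma.-integrable setT f ->
  {ae gamma, forall y, normal.-integrable setT (fun t => f (upd j t y))}.
Proof. by move=> /(integrable_resampling j) /ae_integrable2. Qed.

Lemma measurable_inner_resampling j (f : Rinfty R -> \bar R) :
  gamma.-integrable setT f ->
  measurable_fun setT (fun y : Rinfty R => \int[normal]_t f (upd j t y))%E.
Proof. by move=> /(integrable_resampling j) fi; exact: (measurable_fubini_G fi). Qed.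

Lemma measurable_truncate N :
  measurable_fun [set: Rinfty R] (fun y : Rinfty R => truncate N y).
Proof.
apply/measurable_fun_tnthP => i.
rewrite (_ : _ \o _ = fun y : Rinfty R => y i); first exact: measurable_coord.
by apply/funext => y /=; rewrite tnth_mktuple.
Qed.

Lemma ge0_integral_truncate N (gammaN : probability (N.-tuple R) R)
    (f : N.-tuple R -> \bar R) : std_gaussian_fin gammaN ->
  measurable_fun setT f -> (forall y, 0 <= f y)%E ->
  (\int[gamma]_y f (truncate N y) = \int[gammaN]_y f y)%E.
Proof.
move=> hN mf f0.
pose m2 := measure_function_pushforward__canonical__measure_function_Measure
  gamma (@measurable_truncate N).
transitivity (\int[m2]_y f y)%E.
  by rewrite ge0_integral_pushforward//; exact: measurable_truncate.
apply: (@eq_measure_integral _ _ _ _ gammaN m2) => A mA _.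
apply: (@gaussian_product_unique R _ _ _ (fun (j : 'I_N) y => tnth y j)) mA.
- by move=> j; exact: measurable_tnth.
- exact: tuple_gen.
- move=> J B mB; rewrite /m2 /= /pushforward.
  (* A box over ['I_N] is read as a box over the naturals that leaves the coordinates from [N] on
     free. *)
  pose C (i : nat) := if insub i is Some j then B j else setT.
  pose K := [fset (nat_of_ord j) | j in J]%fset.
  transitivity (gamma [set y | forall i, i \in K -> C i (y i)]).
    congr (gamma _); apply/seteqP; split => y /=.
      move=> H _ /imfsetP[/= j jJ ->]; rewrite /C valK.
      by have := H j jJ; rewrite tnth_mktuple.
    move=> H j jJ; have := H j; rewrite /C valK tnth_mktuple; apply.
    by apply/imfsetP; exists j.
  rewrite hgamma; last by move=> i; rewrite /C; case: insub.
  rewrite big_imfset/=; last by move=> i j _ _; exact: val_inj.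
  by apply: eq_bigr => j _; rewrite /C valK.
- exact: hN.
Qed.

End Resampling.

(** * Gaussian integrals as Lebesgue integrals against the density *)

Section NormalDensity.
Context {R : realType}.
Local Notation mu := (@lebesgue_measure R).
Local Notation normal := (normal_prob (0 : R) 1).
Local Notation pdf := (normal_pdf (0 : R) 1).

Let p0 (x : R) : (0 <= (pdf x)%:E)%E.
Proof. by rewrite lee_fin normal_pdf_ge0. Qed.

Let mpdf : measurable_fun setT (fun x : measurableTypeR R => (pdf x)%:E).
Proof. by apply/measurable_EFinP; exact: measurable_normal_pdf. Qed.

Let integral_normal_indic (E : set (measurableTypeR R)) : measurable E ->
  (\int[normal]_x (\1_E x)%:E = \int[mu]_x ((\1_E x)%:E * (pdf x)%:E))%E.
Proof.
move=> mE; rewrite integral_indic//= /normal_prob setIT [LHS]integral_mkcond.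
apply: eq_integral => x _; rewrite patchE indicE.
by case: ifP => _; rewrite ?mul1e ?mul0e.
Qed.

Import HBNNSimple.

Let integral_normal_nnsfun (f : {nnsfun measurableTypeR R >-> R}) :
  (\int[normal]_x (f x)%:E = \int[mu]_x ((f x)%:E * (pdf x)%:E))%E.
Proof.
under [LHS]eq_integral do rewrite fimfunE -fsumEFin//.
rewrite [LHS]ge0_integral_fsum//; last 2 first.
  - by move=> r; exact/measurable_EFinP/measurableT_comp.
  - by move=> n x _; rewrite EFinM nnfun_muleindic_ge0.
under [RHS]eq_integral.
  move=> x xD; rewrite fimfunE -fsumEFin// ge0_mule_fsuml; last first.
    by move=> r; rewrite EFinM nnfun_muleindic_ge0.
  over.
rewrite [RHS]ge0_integral_fsum//; last 2 first.
  - move=> r; apply: emeasurable_funM => //.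
    exact/measurable_EFinP/measurableT_comp.
  - by move=> n x _; rewrite EFinM mule_ge0// nnfun_muleindic_ge0.
apply: eq_fsbigr => r _.
under [RHS]eq_integral do rewrite EFinM -muleA.
have [r0|r0] := leP 0 r; last first.
  rewrite integral0_eq; last first.
    by move=> x _; rewrite preimage_nnfun0// indic0 mulr0.
  rewrite integral0_eq// => x _.
  by rewrite preimage_nnfun0// indic0 mul0e mule0.
under [LHS]eq_integral do rewrite EFinM.
rewrite !ge0_integralZl//=.
- by rewrite integral_normal_indic.
- by apply: emeasurable_funM => //; exact/measurable_EFinP.
- by move=> x _; rewrite mule_ge0// lee_fin.
- exact/measurable_EFinP.
Qed.

Lemma ge0_integral_normal_prob (f : measurableTypeR R -> \bar R) :
  measurable_fun setT f -> (forall x, 0 <= f x)%E ->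
  (\int[normal]_x f x = \int[mu]_x (f x * (pdf x)%:E))%E.
Proof.
move=> mf f0.
pose f_ := nnsfun_approx measurableT mf.
transitivity (lim (\int[normal]_x (f_ n x)%:E @[n --> \oo])%E).
  rewrite -monotone_convergence//=.
  - apply: eq_integral => x _; apply/esym/cvg_lim => //.
    exact: cvg_nnsfun_approx.
  - by move=> n; exact/measurable_EFinP.
  - by move=> n x _; rewrite lee_fin.
  - by move=> x _ a b ab; rewrite lee_fin; exact/lefP/nd_nnsfun_approx.
transitivity (lim (\int[mu]_x ((f_ n x)%:E * (pdf x)%:E) @[n --> \oo])%E); last first.
  rewrite -monotone_convergence//=.
  - apply: eq_integral => x _; apply/cvg_lim => //.
    apply: cvgeZr => //; exact: cvg_nnsfun_approx.
  - by move=> n; apply: emeasurable_funM => //; exact/measurable_EFinP.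
  - by move=> n x _; rewrite mule_ge0// lee_fin.
  - move=> x _ a b ab; rewrite lee_wpmul2r// lee_fin.
    exact/lefP/nd_nnsfun_approx.
by apply: congr_lim; apply/funext => n /=; exact: integral_normal_nnsfun.
Qed.

Lemma integral_normal_prob (f : measurableTypeR R -> R) :
  measurable_fun setT f ->
  (\int[normal]_x (f x)%:E = \int[mu]_x (f x * pdf x)%:E)%E.
Proof.
move=> mf; rewrite integralE [RHS]integralE.
have mf' : measurable_fun setT (fun x : measurableTypeR R => (f x)%:E).
  exact/measurable_EFinP.
rewrite ge0_integral_normal_prob//; last exact: measurable_funepos.
rewrite ge0_integral_normal_prob//; last exact: measurable_funeneg.
congr (_ - _)%E; apply: eq_integral => x _.
  by rewrite !funeposE -EFin_max -!EFinM -EFin_max maxr_pMl ?normal_pdf_ge0// mul0r.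
by rewrite !funenegE -!EFinN -EFin_max -!EFinM -EFin_max maxr_pMl ?normal_pdf_ge0// mul0r mulNr.
Qed.

Lemma integrable_normal_prob (f : measurableTypeR R -> R) :
  measurable_fun setT f ->
  normal.-integrable setT (EFin \o f) <->
  mu.-integrable setT (EFin \o (fun x => f x * pdf x)).
Proof.
move=> mf.
have E : (\int[normal]_x `|(f x)%:E| = \int[mu]_x `|(f x * pdf x)%:E|)%E.
  rewrite ge0_integral_normal_prob//; last first.
    by apply: measurableT_comp => //; exact/measurable_EFinP.
  apply: eq_integral => x _.
  by rewrite -EFinM !abse_EFin normrM (ger0_norm (normal_pdf_ge0 0 1 x)).
split=> /integrableP[_ fi]; apply/integrableP; split.
- apply/measurable_EFinP; apply: measurable_funM => //.
  exact: measurable_normal_pdf.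
- by rewrite -E.
- exact/measurable_EFinP.
- by rewrite /= E.
Qed.

End NormalDensity.

(** * Measurability by countable approximation *)

Section Discrete.
Context {d : measure_display} {T : measurableType d} {R : realType}.

(** With countably many values and measurable fibres, composition with an arbitrary map to [R] is
    measurable. No sigma-algebra on [X] is then needed: real functions built from [X]-valued ones
    are limits of such compositions. *)
Definition discrete_fun (Y : Type) (f : T -> Y) :=
  countable (range f) /\ forall y, measurable (f @^-1` [set y]).

Lemma discrete_fun_measurable_comp (Y : Type) (f : T -> Y) (g : Y -> R) :
  discrete_fun f -> measurable_fun setT (fun t => g (f t)).
Proof.
move=> [/countable_injP[code inj_code] mf] _ B mB; rewrite setTI.
pose F n := f @^-1` [set y | range f y /\ code y = n /\ B (g y)].
rewrite [X in measurable X](_ : _ = \bigcup_n F n); last first.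
  apply/seteqP; split => t /=; last by move=> [n _ [_ []]].
  by move=> Bt; exists (code (f t)) => //; split => //; exists t.
apply: bigcupT_measurable => n.
have [[y [ry [cy By]]]|N] := pselect (exists y, range f y /\ code y = n /\ B (g y)).
  rewrite [X in measurable X](_ : _ = f @^-1` [set y])//.
  apply/seteqP; split => t /=; last by rewrite /F /= => ->.
  move=> [rt [ct Bt]]; apply: (inj_code _ _); rewrite ?inE//.
  by rewrite ct.
rewrite [X in measurable X](_ : _ = set0)//.
by apply/seteqP; split => t //= Ht; apply: N; exists (f t).
Qed.

Lemma discrete_fun_pair (Y Z : Type) (f : T -> Y) (g : T -> Z) :
  discrete_fun f -> discrete_fun g -> discrete_fun (fun t => (f t, g t)).
Proof.
move=> [cf mf] [cg mg]; split.
  apply: sub_countable (countableX cf cg); apply: subset_card_le.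
  by move=> _ [t _ <-] /=; split; exists t.
move=> [y z]; rewrite [X in measurable X](_ : _ = f @^-1` [set y] `&` g @^-1` [set z]).
  exact: measurableI.
by apply/seteqP; split => t /=; case=> <- <-.
Qed.

End Discrete.

Section Dyadic.
Context {R : realType} {X : completeNormedModType R[i]}.
Variable dot : {dot X for @Num.conj R[i]}.
Hypothesis dot_norm : forall x, dot x x = `|x| ^+ 2.
Local Notation ip := (ip dot).

(* Rounding the coordinates to dyadic numbers exhibits a continuous function of
   finitely many coordinates as a limit of functions with countably many
   values. *)
Definition dyadic_code (n N : nat) (y : nat -> R) : N.-tuple int :=
  [tuple Num.floor (2 ^+ n * y j) | j < N].

Definition dyadic_decode (n N : nat) (k : N.-tuple int) : N.-tuple R :=
  [tuple (tnth k j)%:~R / 2 ^+ n | j < N].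

Lemma discrete_dyadic_code n N :
  discrete_fun (fun y : Rinfty R => dyadic_code n N y).
Proof.
split; first exact: countableP.
move=> k.
rewrite [X in measurable X](_ : _ = \big[setI/setT]_(j <- enum 'I_N)
   (fun y : Rinfty R => y j) @^-1`
     [set x : R | (tnth k j)%:~R <= 2 ^+ n * x < (tnth k j + 1)%:~R]).
  apply: bigsetI_measurable => j _.
  rewrite -[X in measurable X]setTI; apply: measurable_coord => //.
  rewrite [X in measurable X](_ : _ =
    `[(tnth k j)%:~R / 2 ^+ n, (tnth k j + 1)%:~R / 2 ^+ n[%classic)//.
  apply/seteqP; split => x /=; rewrite in_itv/= ler_pdivrMr ?exprn_gt0//;
  by rewrite ltr_pdivlMr ?exprn_gt0// mulrC.
rewrite -bigcap_seq; apply/seteqP; split => y /=.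
  by move=> <- j _ /=; rewrite tnth_mktuple; exact: floor_itv.
move=> H; apply: eq_from_tnth => j; rewrite tnth_mktuple.
by apply: floor_def; apply: (H j); rewrite /= mem_enum.
Qed.

Lemma dyadic_approx n N (y : nat -> R) (j : 'I_N) :
  `|tnth (dyadic_decode n (dyadic_code n N y)) j - y j| <= (2 ^+ n)^-1.
Proof.
rewrite !tnth_mktuple; have /andP[] := floor_itv (2 ^+ n * y j).
set k := Num.floor _; move=> k1 k2.
have n0 : 0 < 2 ^+ n :> R by rewrite exprn_gt0.
have -> : k%:~R / 2 ^+ n - y j = - ((2 ^+ n * y j - k%:~R) * (2 ^+ n)^-1).
  by field; rewrite gt_eqF.
rewrite normrN normrM ger0_norm ?subr_ge0//.
rewrite ger0_norm ?invr_ge0 ?(ltW n0)// ler_piMl ?invr_ge0 ?(ltW n0)//.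
by move: k2; rewrite intrD => k2; rewrite lerBlDl ltW.
Qed.

Lemma embC_dist N (a b : N.-tuple R) (e : R) :
  (forall j, `|tnth a j - tnth b j| <= e) ->
  `|embC a - embC b| <= e%:C * \sum_(j < N) `|delta_mx 0 j : 'rV[R[i]^o]_N|.
Proof.
move=> ab.
have -> : embC a - embC b =
    \sum_(j < N) (tnth a j - tnth b j)%:C *: (delta_mx 0 j : 'rV[R[i]^o]_N).
  rewrite [LHS]row_sum_delta; apply: eq_bigr => j _.
  by rewrite !mxE -rmorphB.
rewrite (le_trans (ler_norm_sum _ _ _))// mulr_sumr; apply: ler_sum => j _.
rewrite normrZ ler_wpM2r// normc_def /= expr0n addr0 sqrtr_sqr lecR.
exact: ab.
Qed.

Lemma dyadic_cvg N (f : 'rV[R[i]^o]_N -> X) (z : 'rV[R[i]^o]_N) (y : nat -> R) :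
  {for embC (truncate N y) + z, continuous f} ->
  rnorm (f (embC (dyadic_decode n (dyadic_code n N y)) + z) -
    f (embC (truncate N y) + z)) @[n --> \oo] --> 0.
Proof.
move=> cf; apply/cvgrPdist_lt => e e0.
have e0C : 0 < e%:C by rewrite ltcR.
have /cvgrPdist_lt/(_ _ e0C) := cf.
move=> /nbhs_normP[r /= r0 Hr].
pose C : R[i] := \sum_(j < N) `|delta_mx 0 j : 'rV[R[i]^o]_N| + 1.
have C0 : 0 < C by rewrite ltr_wpDl// sumr_ge0.
have CR : C = (complex.Re C)%:C by rewrite RRe_real// ger0_real// ltW.
have rR : r = (complex.Re r)%:C by rewrite RRe_real// ger0_real// ltW.
have RC0 : 0 < complex.Re C by rewrite -ltcR -CR.
have Rr0 : 0 < complex.Re r by rewrite -ltcR -rR.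
near=> n.
rewrite sub0r normrN ger0_norm ?rnorm_ge0// -ltcR rnormE distrC.
apply: Hr; rewrite /ball_ /= opprD addrACA subrr addr0.
rewrite distrC; apply: (@le_lt_trans _ _ (((2 ^+ n)^-1)%:C * C)).
  apply: le_trans (embC_dist (e := (2 ^+ n)^-1) _) _.
    by move=> j; rewrite [tnth (truncate _ _) _]tnth_mktuple; exact: dyadic_approx.
  by rewrite ler_wpM2l ?ler0c ?invr_ge0 ?exprn_ge0// lerDl.
rewrite CR rR -rmorphM ltcR -ltr_pdivlMr// -[X in _ < X]invrK ltf_pV2 ?posrE ?exprn_gt0 ?invr_gt0 ?divr_gt0//.
apply: (@lt_le_trans _ _ n%:R); last by rewrite -natrX ler_nat ltnW// ltn_expl.
by near: n; exact: nbhs_infty_gtr.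
Unshelve. all: by end_near. Qed.

Lemma measurable_ip_embC N (f : 'rV[R[i]^o]_N -> X) (z : 'rV[R[i]^o]_N) (c : X) :
  (forall y : N.-tuple R, {for embC y + z, continuous f}) ->
  measurable_fun setT (fun y : Rinfty R => ip (f (embC (truncate N y) + z)) c).
Proof.
move=> cf; apply: (@measurable_fun_cvg _ _ _ _ (fun n (y : Rinfty R) =>
  ip (f (embC (dyadic_decode n (dyadic_code n N y)) + z)) c)).
  move=> n; exact: (discrete_fun_measurable_comp
    (fun k => ip (f (embC (dyadic_decode n k) + z)) c) (discrete_dyadic_code n N)).
move=> y _; apply/subr_cvg0/norm_cvg0P.
apply: (@squeeze_cvgr _ _ _ _ (fun=> 0) (fun n =>
  rnorm (f (embC (dyadic_decode n (dyadic_code n N y)) + z) -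
    f (embC (truncate N y) + z)) * rnorm c)).
- by apply: nearW => n; rewrite normr_ge0 -ipBl; exact: ip_CauchySchwarz.
- exact: cvg_cst.
- by rewrite -(mul0r (rnorm c)); apply: cvgMl; exact: dyadic_cvg.
Qed.

(** The simple approximation of [u] and the dyadic rounding of [y] form one discrete pair, so that
    the norm of the difference is a measurable function of the pair at each [n], and then in the
    limit. *)
Lemma measurable_rnorm_sub N (f : 'rV[R[i]^o]_N -> X) (u : Rinfty R -> X) :
  strongly_measurable u ->
  (forall y : N.-tuple R, {for embC y, continuous f}) ->
  measurable_fun setT (fun y : Rinfty R => rnorm (u y - f (embC (truncate N y)))).
Proof.
move=> [s [ss su]] cf; apply: (@measurable_fun_cvg _ _ _ _ (fun n (y : Rinfty R) =>
  rnorm (s n y - f (embC (dyadic_decode n (dyadic_code n N y)))))).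
  move=> n; apply: (@discrete_fun_measurable_comp _ _ R _
    (fun y : Rinfty R => (s n y, dyadic_code n N y))
    (fun p => rnorm (p.1 - f (embC (dyadic_decode n p.2))))).
  apply: discrete_fun_pair; last exact: discrete_dyadic_code.
  by have [fs ms] := ss n; split => //; exact: finite_set_countable.
move=> y _; apply/subr_cvg0/norm_cvg0P.
have rs : rnorm (s n y - u y) @[n --> \oo] --> 0.
  have /cvgrPdist_lt H := su y; apply/cvgrPdist_lt => e e0.
  have e0C : 0 < e%:C by rewrite ltcR.
  have := H _ e0C; apply: filterS => n.
  by rewrite sub0r normrN ger0_norm ?rnorm_ge0// -ltcR rnormE distrC.
have rf := @dyadic_cvg N f 0 y.
rewrite addr0 in rf; have {}rf := rf (cf _).
apply: (@squeeze_cvgr _ _ _ _ (fun=> 0) (fun n => rnorm (s n y - u y) +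
  rnorm (f (embC (dyadic_decode n (dyadic_code n N y)) + 0) - f (embC (truncate N y))))).
- apply: nearW => n; rewrite normr_ge0 addr0.
  set a := s n y; set b := u y; set a' := f _; set b' := f _.
  have H1 := ler_rnormD (a - a' - (b - b')) (b - b').
  have H2 := ler_rnormD (b - b' - (a - a')) (a - a').
  have H3 := ler_rnormD (a - b) (- (a' - b')).
  have E1 : a - a' - (b - b') = a - b - (a' - b').
    by rewrite !opprB [b' - b]addrC addrACA [- a' + b']addrC.
  have E2 : b - b' - (a - a') = - (a - b - (a' - b')).
    by rewrite -E1 [RHS]opprB.
  rewrite subrK E1 in H1; rewrite subrK E2 rnormN in H2; rewrite rnormN in H3.
  by apply/ler_normlP; split; lra.
- exact: cvg_cst.
- by rewrite -[X in _ --> X](addr0 0); exact: (cvgD rs rf).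
Qed.

Lemma strongly_measurable_ip d (T : measurableType d) (u : T -> X) (c : X) :
  strongly_measurable u -> measurable_fun setT (fun y => ip (u y) c).
Proof.
move=> [s [ss su]]; apply: (@measurable_fun_cvg _ _ _ _ (fun n y => ip (s n y) c)).
  move=> n; apply: (@discrete_fun_measurable_comp _ _ R _ (s n) (fun p => ip p c)).
  by have [fs ms] := ss n; split => //; exact: finite_set_countable.
move=> y _; apply/subr_cvg0/norm_cvg0P.
apply: (@squeeze_cvgr _ _ _ _ (fun=> 0) (fun n => rnorm (s n y - u y) * rnorm c)).
- by apply: nearW => n; rewrite normr_ge0 -ipBl; exact: ip_CauchySchwarz.
- exact: cvg_cst.
- rewrite -(mul0r (rnorm c)); apply: cvgMl.
  have /cvgrPdist_lt H := su y; apply/cvgrPdist_lt => e e0.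
  have e0C : 0 < e%:C by rewrite ltcR.
  have := H _ e0C; apply: filterS => n.
  by rewrite sub0r normrN ger0_norm ?rnorm_ge0// -ltcR rnormE distrC.
Qed.

End Dyadic.

(** * Integrals of products over coordinates, and orthonormality *)

Section ProductIntegral.
Context {R : realType}.
Local Notation normal := (normal_prob (0 : R) 1).
Variable gamma : probability (Rinfty R) R.
Hypothesis hgamma : std_gaussian_infty gamma.

Lemma prod_upd n (f : nat -> R -> R) (y : nat -> R) t :
  \prod_(i < n.+1) f i (upd n t y i) = (\prod_(i < n) f i (y i)) * f n t.
Proof.
rewrite big_ord_recr /= upd_same; congr (_ * _).
by apply: eq_bigr => i _; rewrite /upd ltn_eqF.
Qed.

Lemma measurable_prod_coord n (f : nat -> measurableTypeR R -> R) :
  (forall i, measurable_fun setT (f i)) ->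
  measurable_fun setT (fun y : Rinfty R => \prod_(i < n) f i (y i)).
Proof.
move=> mf; elim: n => [|n IH].
  rewrite (_ : (fun _ => _) = fun=> 1); first exact: measurable_cst.
  by apply/funext => y; rewrite big_ord0.
rewrite (_ : (fun _ => _) =
    fun y : Rinfty R => (\prod_(i < n) f i (y i)) * f n (y n)); last first.
  by apply/funext => y; rewrite big_ord_recr.
apply: measurable_funM => //.
exact: (measurableT_comp (mf n) (measurable_coord n)).
Qed.

(** Resampling the coordinate [n] separates the last factor from a product that does not see it. The
    same computation with absolute values comes first, to get integrability. *)
Lemma integral_prod_coord n (f : nat -> measurableTypeR R -> R) :
  (forall i, normal.-integrable setT (EFin \o f i)) ->
  gamma.-integrable setT (EFin \o (fun y : Rinfty R => \prod_(i < n) f i (y i))) /\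
  \int[gamma]_y (\prod_(i < n) f i (y i)) = \prod_(i < n) \int[normal]_x f i x.
Proof.
move=> fi.
have mf i : measurable_fun setT (f i).
  by apply/measurable_EFinP; exact: measurable_int (fi i).
elim: n => [|n [IHi IH]].
  have -> : (fun y : Rinfty R => \prod_(i < 0) f i (y i)) = fun=> 1.
    by apply/funext => y; rewrite big_ord0.
  rewrite big_ord0; split; last by rewrite Rintegral_cst// [X in fine X]probability_setT mulr1.
  exact: finite_measure_integrable_cst.
have iF : gamma.-integrable setT
    (EFin \o (fun y : Rinfty R => \prod_(i < n.+1) f i (y i))).
  apply/integrableP; split.
    by apply/measurable_EFinP; exact: measurable_prod_coord.
  rewrite (ge0_integral_resampling hgamma n)//=; last first.
    by apply/measurable_EFinP/measurableT_comp => //; exact: measurable_prod_coord.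
  under eq_integral.
    move=> y _; under eq_integral do rewrite prod_upd normrM EFinM.
    rewrite ge0_integralZl//; last first.
      by apply/measurable_EFinP/measurableT_comp.
    over.
  rewrite ge0_integralZr//.
  - apply: lte_mul_pinfty.
    + exact: integral_ge0.
    + by have := integrable_fin_num measurableT (integrable_abse IHi).
    + by have /integrableP[] := fi n.
  - by apply/measurable_EFinP/measurableT_comp => //; exact: measurable_prod_coord.
  - exact: integral_ge0.
split=> //; rewrite big_ord_recr /= -IH.
rewrite {1}/Rintegral (integral_resampling hgamma n)//.
pose r := \int[normal]_x f n x.
have rE : (\int[normal]_x (f n x)%:E)%E = r%:E.
  by rewrite /r /Rintegral fineK//; exact: (integrable_fin_num measurableT (fi n)).
under eq_integral.
  move=> y _; under eq_integral do rewrite /= prod_upd EFinM.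
  rewrite integralZl//; last exact: fi.
  rewrite rE.
  over.
rewrite integralZr// fineM//; exact: (integrable_fin_num measurableT IHi).
Qed.

End ProductIntegral.

Section HermiteProduct.
Context {R : realType}.
Local Notation mu := (@lebesgue_measure R).
Local Notation normal := (normal_prob (0 : R) 1).
Local Notation pdf := (normal_pdf (0 : R) 1).

Lemma sqrt_fact_gt0 n : 0 < Num.sqrt n`!%:R :> R.
Proof. by rewrite sqrtr_gt0 ltr0n fact_gt0. Qed.

Lemma hermite_gaussE n (x : R) :
  hermite_gauss n x = Num.sqrt n`!%:R * ((hermite n).[x] * pdf x).
Proof.
by rewrite /hermite_gauss /hermite hornerZ !mulrA mulfV ?mul1r// gt_eqF// sqrt_fact_gt0.
Qed.

Lemma measurable_horner (p : {poly R}) :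
  measurable_fun setT (fun x : measurableTypeR R => p.[x]).
Proof. by apply: continuous_measurable_fun; exact: continuous_horner. Qed.

Lemma integrable_normal_poly (p : {poly R}) :
  normal.-integrable setT (EFin \o (fun x => p.[x])).
Proof.
apply/integrable_normal_prob; first exact: measurable_horner.
exact: integrable_poly_gauss.
Qed.

Lemma Rintegral_hermite2 m n :
  \int[normal]_x ((hermite m).[x] * (hermite n).[x]) = (m == n)%:R :> R.
Proof.
rewrite /Rintegral integral_normal_prob; last first.
  by apply: measurable_funM; exact: measurable_horner.
rewrite -/(Rintegral mu setT (fun x => (hermite m).[x] * (hermite n).[x] * pdf x)).
have c0 k : Num.sqrt k`!%:R != 0 :> R by rewrite gt_eqF// sqrt_fact_gt0.
have E : \int[mu]_x ((hermite_prob m).[x] * hermite_gauss n x) =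
    Num.sqrt m`!%:R * Num.sqrt n`!%:R *
    \int[mu]_x ((hermite m).[x] * (hermite n).[x] * pdf x).
  rewrite -RintegralZl//; last first.
    rewrite (_ : (fun x => _) = fun x => (hermite m * hermite n).[x] * pdf x).
      exact: integrable_poly_gauss.
    by apply/funext => x; rewrite hornerM.
  apply: eq_Rintegral => x _; rewrite hermite_gaussE /hermite !hornerZ.
  by field; rewrite !c0.
have {}E := etrans (esym E) (Rintegral_hermite_prob2 m n).
apply: (mulfI (mulf_neq0 (c0 m) (c0 n))); rewrite E.
have [<-|mn] := eqVneq m n; last by rewrite muln0 mulr0.
by rewrite muln1 mulr1 -expr2 sqr_sqrtr.
Qed.

Variable gamma : probability (Rinfty R) R.
Hypothesis hgamma : std_gaussian_infty gamma.

Definition hermite_prod (N : nat) (nu : nat -> nat) (y : nat -> R) : R :=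
  \prod_(i < N) (hermite (nu i)).[y i].

Lemma measurable_hermite_prod N nu :
  measurable_fun setT (fun y : Rinfty R => hermite_prod N nu y).
Proof.
by apply: (measurable_prod_coord N (f := fun i x => (hermite (nu i)).[x])) => i;
   exact: measurable_horner.
Qed.

Lemma hermite_prod2 N nu nu' :
  gamma.-integrable setT
    (EFin \o (fun y : Rinfty R => hermite_prod N nu y * hermite_prod N nu' y)) /\
  \int[gamma]_y (hermite_prod N nu y * hermite_prod N nu' y) =
  [forall i : 'I_N, nu i == nu' i]%:R.
Proof.
pose f i (x : measurableTypeR R) := (hermite (nu i) * hermite (nu' i)).[x].
have fE : (fun y : Rinfty R => hermite_prod N nu y * hermite_prod N nu' y) =
    fun y : Rinfty R => \prod_(i < N) f i (y i).
  apply/funext => y; rewrite /hermite_prod -big_split /=.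
  by apply: eq_bigr => i _; rewrite /f hornerM.
have [fi fI] := @integral_prod_coord R gamma hgamma N f
  (fun i => integrable_normal_poly _).
rewrite fE; split=> //; rewrite fI.
rewrite (eq_bigr (fun i : 'I_N => (nu i == nu' i)%:R)); last first.
  move=> i _; rewrite -Rintegral_hermite2; apply: eq_Rintegral => x _.
  by rewrite /f hornerM.
case: forallP => [H|/forallP]; first by rewrite big1// => i _; rewrite H.
rewrite negb_forall => /existsP[i ni].
by rewrite (bigD1 i)//= (negbTE ni) mul0r.
Qed.

Lemma integrable_hermite_prod_sqr N nu :
  gamma.-integrable setT (EFin \o (fun y : Rinfty R => hermite_prod N nu y ^+ 2)).
Proof. by have [] := hermite_prod2 N nu nu. Qed.

Lemma Rintegral_hermite_prod_sqr N nu :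
  \int[gamma]_y (hermite_prod N nu y ^+ 2) = 1.
Proof.
have [_ H] := hermite_prod2 N nu nu; rewrite -[RHS]/(true%:R).
by rewrite [LHS]H; congr (nat_of_bool _)%:R; apply/forallP => i.
Qed.

End HermiteProduct.

(** * Taylor expansion of Hermite coefficients in one coordinate *)

Section RintegralSum.
Context d (T : measurableType d) (R : realType).
Variable m : {measure set T -> \bar R}.

Lemma integrable_Rsum (I : Type) (s : seq I) (F : I -> T -> R) :
  (forall i, m.-integrable setT (EFin \o F i)) ->
  m.-integrable setT (EFin \o (fun x => \sum_(i <- s) F i x)).
Proof.
move=> Fi; elim: s => [|i s IH].
  rewrite (_ : _ \o _ = cst 0%E); first exact: integrable0.
  by apply/funext => x /=; rewrite big_nil.
rewrite (_ : _ \o _ = fun x => ((F i x)%:E + (\sum_(i <- s) F i x)%:E)%E).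
  exact: (integrableD measurableT (Fi i) IH).
by apply/funext => x /=; rewrite big_cons.
Qed.

Lemma Rintegral_sum (I : Type) (s : seq I) (F : I -> T -> R) :
  (forall i, m.-integrable setT (EFin \o F i)) ->
  \int[m]_x (\sum_(i <- s) F i x) = \sum_(i <- s) \int[m]_x F i x.
Proof.
move=> Fi; elim: s => [|i s IH].
  rewrite big_nil; under eq_Rintegral do rewrite big_nil.
  by rewrite Rintegral_cst// mul0r.
rewrite big_cons -IH -RintegralD//; last exact: integrable_Rsum.
by apply: eq_Rintegral => x _; rewrite big_cons.
Qed.

Lemma integrable_amgm (f g : T -> R) : measurable_fun setT f -> measurable_fun setT g ->
  m.-integrable setT (EFin \o (fun x => f x ^+ 2)) ->
  m.-integrable setT (EFin \o (fun x => g x ^+ 2)) ->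
  m.-integrable setT (EFin \o (fun x => f x * g x)).
Proof.
move=> mf mg fi gi.
apply: (@le_integrable _ _ _ m setT measurableT _
  (fun x => ((f x ^+ 2)%:E + (g x ^+ 2)%:E)%E)).
- by apply/measurable_EFinP; exact: measurable_funM.
- move=> x _; rewrite !abse_EFin lee_fin normrM.
  apply: le_trans (ler_norm _).
  rewrite -[f x ^+ 2]real_normK ?num_real// -[g x ^+ 2]real_normK ?num_real//.
  have := sqr_ge0 (`|f x| - `|g x|).
  have : 0 <= `|f x| * `|g x| by rewrite mulr_ge0.
  by rewrite sqrrB; lra.
- exact: (integrableD measurableT fi gi).
Qed.

End RintegralSum.

Section TaylorN.
Context {R : realType} {X : completeNormedModType R[i]}.
Variable dot : {dot X for @Num.conj R[i]}.
Hypothesis dot_norm : forall x, dot x x = `|x| ^+ 2.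
Local Notation ip := (ip dot).
Local Notation mu := (@lebesgue_measure R).
Local Notation normal := (normal_prob (0 : R) 1).
Local Notation pdf := (normal_pdf (0 : R) 1).
Variable gamma : probability (Rinfty R) R.
Hypothesis hgamma : std_gaussian_infty gamma.

Variables (N : nat) (rho : 'I_N -> R) (f : 'rV[R[i]^o]_N -> X).
Variables (phi : N.-tuple R -> R).
Hypothesis rho_gt0 : forall j, 0 < rho j.
Hypothesis holo : holomorphic_on (strip rho) f.
Hypothesis mphi : measurable_fun setT phi.
Hypothesis f_le : forall y z, polydisc rho z -> rnorm (f (embC y + z)) <= phi y.
Local Notation Phi := (fun y : nat -> R => phi (truncate N y)).
Hypothesis iphi : gamma.-integrable setT (EFin \o (fun y : Rinfty R => Phi y ^+ 2)).

(** Coefficient of index [nu] of the translate of [f] by [z], paired with [c]. The coefficients of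
    [f] enter the finite-dimensional argument in this scalar form only. *)
Definition hermite_coef_at (nu : nat -> nat) (z : 'rV[R[i]^o]_N) (c : X) : R :=
  \int[gamma]_y (ip (f (embC (truncate N y) + z)) c * hermite_prod N nu y).

Definition add_at (nu : nat -> nat) (j i : nat) : nat -> nat :=
  fun l => if l == j then (nu l + i)%N else nu l.

Definition taylor_coef (m i : nat) : R :=
  Num.sqrt (m + i)`!%:R / Num.sqrt m`!%:R / i`!%:R.

Lemma strip_polydisc y z : polydisc rho z -> strip rho (embC y + z).
Proof.
move=> Hz j; apply: le_lt_trans (Hz j).
rewrite !mxE /= raddfD /= add0r /rnorm normc_def /=.
by rewrite -sqrtr_sqr ler_wsqrtr// lerDr sqr_ge0.
Qed.

Lemma holo_cts y z : polydisc rho z -> {for embC y + z, continuous f}.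
Proof.
by move=> Hz; apply: differentiable_continuous; apply: holo; exact: strip_polydisc.
Qed.

Lemma phi_ge0 y : 0 <= phi y.
Proof.
apply: le_trans (rnorm_ge0 _) (f_le y (z := 0) _) => j.
by rewrite mxE /rnorm normr0.
Qed.

Lemma measurable_Phi : measurable_fun setT (fun y : Rinfty R => Phi y).
Proof. exact: (measurableT_comp mphi (@measurable_truncate R N)). Qed.

Lemma integrable_Phi_hermite nu : gamma.-integrable setT
  (EFin \o (fun y : Rinfty R => Phi y * `|hermite_prod N nu y|)).
Proof.
apply: integrable_amgm => //.
- exact: measurable_Phi.
- by apply: measurableT_comp => //; exact: measurable_hermite_prod.
- rewrite (_ : (fun _ => _) = fun y : Rinfty R => hermite_prod N nu y ^+ 2).
    exact: integrable_hermite_prod_sqr.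
  by apply/funext => y; rewrite real_normK ?num_real.
Qed.

Lemma measurable_ip_hermite nu z c : polydisc rho z ->
  measurable_fun setT (fun y : Rinfty R =>
     ip (f (embC (truncate N y) + z)) c * hermite_prod N nu y).
Proof.
move=> Hz; apply: measurable_funM; last exact: measurable_hermite_prod.
by apply: measurable_ip_embC => // y; exact: holo_cts.
Qed.

Lemma integrable_hermite_coef_at nu z c : polydisc rho z ->
  gamma.-integrable setT (EFin \o (fun y : Rinfty R =>
     ip (f (embC (truncate N y) + z)) c * hermite_prod N nu y)).
Proof.
move=> Hz; apply: (@le_integrable _ _ _ gamma setT measurableT _
  (fun y => (rnorm c)%:E * (Phi y * `|hermite_prod N nu y|)%:E)%E).
- by apply/measurable_EFinP; exact: measurable_ip_hermite.
- move=> y _; rewrite -EFinM !abse_EFin lee_fin; apply: le_trans (ler_norm _).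
  rewrite normrM mulrA ler_wpM2r//.
  apply: le_trans (ip_CauchySchwarz dot_norm _ _) _; rewrite mulrC.
  by rewrite ler_wpM2l ?rnorm_ge0//; exact: f_le.
- by apply: integrableZl => //; exact: integrable_Phi_hermite.
Qed.

Variables (j : 'I_N) (z : 'rV[R[i]^o]_N) (w : R[i]) (S : R).
Hypothesis zP : polydisc rho z.
Hypothesis zj0 : z 0 j = 0.
Hypothesis w1 : `|w| = 1.
Hypothesis SP : 0 <= S < rho j.

Local Notation e := (delta_mx 0 j : 'rV[R[i]^o]_N).

Lemma polydisc_shift s : `|s| < rho j -> polydisc rho (z + (s%:C * w) *: e).
Proof.
move=> sr i; rewrite !mxE eqxx /=.
have [->|ij] := eqVneq i j; last by rewrite /= mulr0 addr0; exact: zP.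
rewrite zj0 add0r mulr1 /rnorm normrM w1 mulr1 normc_def /= expr0n addr0.
by rewrite sqrtr_sqr.
Qed.

Lemma embC_upd y x : embC (truncate N (upd j x y)) =
  embC (truncate N (upd j 0 y)) + x%:C *: e.
Proof.
apply/rowP => i; rewrite !mxE !tnth_mktuple /upd eqxx /=.
have [->|ij] := eqVneq i j; first by rewrite eqxx mulr1 add0r.
by rewrite (inj_eq val_inj) (negbTE ij) mulr0 addr0.
Qed.

(** Here [x] is the coordinate [j] of the Gaussian variable and [s w] a shift of that same
    coordinate, the other coordinates being frozen; each derivative in [s] contributes one more
    phase [conj(w)]. *)
Let P (y : nat -> R) (c : X) (k : nat) (x s : R) : R :=
  ip (f (embC (truncate N (upd j x y)) + (z + (s%:C * w) *: e)))
    (Num.conj w ^+ k *: c).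

Let closedP y c k x s : `|s| < rho j ->
  closed_form_at (P y c k) (P y c k.+1) x s.
Proof.
move=> sr.
pose z0 := embC (truncate N (upd j 0 y)) + z.
have E x' s' : embC (truncate N (upd j x' y)) + (z + (s'%:C * w) *: e) =
    z0 + (x'%:C + s'%:C * w) *: e.
  by rewrite embC_upd scalerDl addrACA.
have PE k' : P y c k' = fun x s =>
    ip (f (z0 + (x%:C + s%:C * w) *: e)) (Num.conj w ^+ k' *: c).
  by apply/funext => x'; apply/funext => s'; rewrite /P E.
rewrite !PE exprS -scalerA; apply: closed_form_slice => //.
rewrite -E; apply: holo; apply: strip_polydisc; exact: polydisc_shift.
Qed.

Let P_le y c k x s : `|s| < rho j -> `|P y c k x s| <= rnorm c * Phi (upd j x y).
Proof.
move=> sr; apply: le_trans (ip_CauchySchwarz dot_norm _ _) _.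
rewrite rnormZ normrX norm_conjC w1 expr1n mul1r mulrC ler_wpM2l ?rnorm_ge0//.
by apply: f_le; exact: polydisc_shift.
Qed.

Definition hermite_prod_off (nu : nat -> nat) (y : nat -> R) : R :=
  \prod_(i < N | i != j) (hermite (nu i)).[y i].

Lemma hermite_prod_upd nu y x : hermite_prod N nu (upd j x y) =
  hermite_prod_off nu y * (hermite (nu j)).[x].
Proof.
rewrite /hermite_prod (bigD1 j)//= upd_same mulrC; congr (_ * _).
by apply: eq_bigr => i ij; rewrite /upd (inj_eq val_inj) (negbTE ij).
Qed.

Lemma hermite_prod_off_add nu i y :
  hermite_prod_off (add_at nu j i) y = hermite_prod_off nu y.
Proof.
by apply: eq_bigr => l lj; rewrite /add_at (inj_eq val_inj) (negbTE lj).
Qed.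


Let B := rho j.

Lemma taylor_coef_ge0 m i : 0 <= taylor_coef m i.
Proof. by rewrite !divr_ge0// sqrtr_ge0. Qed.

Lemma taylor_inner y c nu K :
  normal.-integrable setT (EFin \o (fun x => Phi (upd j x y) ^+ 2)) ->
  `|\int[normal]_x (P y c 0 x S * hermite_prod N nu (upd j x y)
     - \sum_(i < K) S ^+ i * taylor_coef (nu j) i *
        (P y c i x 0 * hermite_prod N (add_at nu j i) (upd j x y)))| <=
  S ^+ K * taylor_coef (nu j) K * rnorm c *
    \int[normal]_x (Phi (upd j x y) * `|hermite_prod N (add_at nu j K) (upd j x y)|).
Proof.
move=> iy; have /andP[S0 Sr] := SP.
pose m := nu j; pose h := hermite_prod_off nu y; pose s := Num.sqrt m`!%:R : R.
have s0 : 0 < s by exact: sqrt_fact_gt0.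
pose ph x := rnorm c * Phi (upd j x y).
have mphj : measurable_fun setT (fun x : measurableTypeR R => Phi (upd j x y)).
  exact: (measurableT_comp measurable_Phi (measurable_updl j y)).
have mph : measurable_fun setT ph by apply: (measurable_funM (measurable_cst _) mphj).
have iy' : mu.-integrable setT (EFin \o (fun x => Phi (upd j x y) ^+ 2 * pdf x)).
  have /integrable_normal_prob := iy.
  by move=> /(_ (measurable_funX 2 mphj)).
have iph : mu.-integrable setT (EFin \o (fun x => ph x ^+ 2 * pdf x)).
  rewrite (_ : _ \o _ = fun x => ((rnorm c ^+ 2)%:E * (Phi (upd j x y) ^+ 2 * pdf x)%:E)%E).
    exact: integrableZl.
  apply/funext => x /=; rewrite /ph exprMn -!EFinM.
  by congr EFin; rewrite -[LHS]mulrA.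
have cP := @closedP y c; have lP := @P_le y c.
have ad i : add_at nu j i j = (m + i)%N by rewrite /add_at eqxx.
have iP k n t : `|t| < rho j ->
    mu.-integrable setT (EFin \o (fun x => P y c k x t * hermite_gauss n x)).
  move=> tr; apply: (integrable_le_phi mph iph (C := 1)).
    apply: continuous_measurable_fun.
    exact: (closed_form_contP (fun x s => @closedP y c k x s) tr).
  by move=> x; rewrite mul1r; exact: lP.
have n0 : `|0 : R| < rho j by rewrite normr0.
have nS : `|S| < rho j by rewrite ger0_norm.
(* Passing from normalized polynomials to [hermite_gauss] costs [sqrt(m!)] on the left and
   [sqrt((m + i)!)] in the [i]-th term; this is the origin of [taylor_coef]. *)
have lhsE x : (P y c 0 x S * hermite_prod N nu (upd j x y)
     - \sum_(i < K) S ^+ i * taylor_coef (nu j) i *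
        (P y c i x 0 * hermite_prod N (add_at nu j i) (upd j x y))) * pdf x =
   (h / s) * (P y c 0 x S * hermite_gauss m x -
     \sum_(i < K) S ^+ i / i`!%:R * (P y c i x 0 * hermite_gauss (m + i) x)).
  rewrite hermite_prod_upd -/h -/m hermite_gaussE -/s mulrBl mulrBr; congr (_ - _).
    by field; rewrite gt_eqF.
  rewrite mulr_suml mulr_sumr; apply: eq_bigr => i _.
  rewrite hermite_prod_upd hermite_prod_off_add -/h ad hermite_gaussE /taylor_coef -/s.
  field; rewrite !gt_eqF// ltr0n fact_gt0//.
have mI n k : measurable_fun setT (fun x : R => P y c k x 0 * (hermite n).[x]).
  apply: measurable_funM; last exact: measurable_horner.
  apply: continuous_measurable_fun.
  exact: (closed_form_contP (fun x s => @closedP y c k x s) n0).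
have mup : measurable_fun setT (fun x : measurableTypeR R => P y c 0 x S * hermite_prod N nu (upd j x y)
     - \sum_(i < K) S ^+ i * taylor_coef (nu j) i *
        (P y c i x 0 * hermite_prod N (add_at nu j i) (upd j x y))).
  have mH nu' : measurable_fun setT (fun x : measurableTypeR R => hermite_prod N nu' (upd j x y)).
    exact: (measurableT_comp (measurable_hermite_prod N nu') (measurable_updl j y)).
  apply: measurable_funB.
    apply: measurable_funM => //; apply: continuous_measurable_fun.
    exact: (closed_form_contP (fun x s => @closedP y c 0 x s) nS).
  apply: measurable_sum => i; apply: measurable_funM => //.
  apply: measurable_funM => //; apply: continuous_measurable_fun.
  exact: (closed_form_contP (fun x s => @closedP y c i x s) n0).
have -> : \int[normal]_x (P y c 0 x S * hermite_prod N nu (upd j x y)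
     - \sum_(i < K) S ^+ i * taylor_coef (nu j) i *
        (P y c i x 0 * hermite_prod N (add_at nu j i) (upd j x y))) =
   (h / s) * (hermite_int (P y c) 0 m S -
     \sum_(i < K) S ^+ i / i`!%:R * hermite_int (P y c) i (m + i) 0).
  rewrite {1}/Rintegral (integral_normal_prob mup).
  rewrite -/(Rintegral mu setT _).
  under eq_Rintegral do rewrite lhsE.
  have iS : mu.-integrable setT (EFin \o (fun x => \sum_(i < K) S ^+ i / i`!%:R *
      (P y c i x 0 * hermite_gauss (m + i) x))).
    apply: integrable_Rsum => i.
    rewrite (_ : _ \o _ = fun x => ((S ^+ i / i`!%:R)%:E *
      (P y c i x 0 * hermite_gauss (m + i) x)%:E)%E)//.
    by apply: integrableZl => //; exact: iP.
  rewrite RintegralZl//; last first.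
    rewrite (_ : _ \o _ = fun x => ((P y c 0 x S * hermite_gauss m x)%:E -
      (\sum_(i < K) S ^+ i / i`!%:R * (P y c i x 0 * hermite_gauss (m + i) x))%:E)%E)//.
    by apply: integrableB => //; exact: iP.
  rewrite RintegralB//; last exact: iP.
  rewrite Rintegral_sum; last first.
    move=> i; rewrite (_ : _ \o _ = fun x => ((S ^+ i / i`!%:R)%:E *
      (P y c i x 0 * hermite_gauss (m + i) x)%:E)%E)//.
    by apply: integrableZl => //; exact: iP.
  congr (_ * (_ - _)); apply: eq_bigr => i _.
  by rewrite RintegralZl//; exact: iP.
rewrite normrM.
have := hermite_int_taylor cP lP mph iph K 0 m SP.
rewrite (eq_bigr (fun i : 'I_K => S ^+ i / i`!%:R * hermite_int (P y c) i (m + i) 0)); last first.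
  by move=> i _; rewrite add0n.
move=> /(ler_wpM2l (normr_ge0 (h / s))) /le_trans; apply.
have mup2 : measurable_fun setT (fun x : measurableTypeR R =>
    Phi (upd j x y) * `|hermite_prod N (add_at nu j K) (upd j x y)|).
  apply: measurable_funM => //; apply: measurableT_comp => //.
  exact: (measurableT_comp (measurable_hermite_prod N _) (measurable_updl j y)).
have -> : \int[normal]_x (Phi (upd j x y) * `|hermite_prod N (add_at nu j K) (upd j x y)|) =
   \int[mu]_x (`|h| / Num.sqrt (m + K)`!%:R * (Phi (upd j x y) * `|hermite_gauss (m + K) x|)).
  rewrite {1}/Rintegral (integral_normal_prob mup2).
  apply: eq_Rintegral => x _.
  rewrite hermite_prod_upd hermite_prod_off_add -/h ad hermite_gaussE !normrM.
  rewrite (ger0_norm (sqrtr_ge0 _)) (ger0_norm (normal_pdf_ge0 0 1 x)).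
  by field; rewrite gt_eqF ?sqrt_fact_gt0.
rewrite /hermite_bound /ph.
have iR := integrable_phi_hermite mphj iy' (m + K).
rewrite RintegralZl//.
rewrite [X in _ * (_ * X) <= _](_ : _ = rnorm c *
    \int[mu]_x (Phi (upd j x y) * `|hermite_gauss (m + K) x|)); last first.
  by rewrite -RintegralZl//; apply: eq_Rintegral => x _; rewrite mulrA.
rewrite normf_div (gtr0_norm s0) le_eqVlt; apply/orP; left; apply/eqP.
rewrite /taylor_coef -/m -/s; field.
by rewrite !gt_eqF ?sqrt_fact_gt0// ltr0n fact_gt0.
Qed.


Let integrand nu z' c := fun y : Rinfty R =>
  ip (f (embC (truncate N y) + z')) c * hermite_prod N nu y.

Theorem hermite_coef_taylor nu c K :
  `|hermite_coef_at nu (z + (S%:C * w) *: e) c -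
    \sum_(i < K) S ^+ i * taylor_coef (nu j) i *
      hermite_coef_at (add_at nu j i) z (Num.conj w ^+ i *: c)| <=
  S ^+ K * taylor_coef (nu j) K * rnorm c *
    \int[gamma]_y (Phi y * `|hermite_prod N (add_at nu j K) y|).
Proof.
have /andP[S0 Sr] := SP.
have nS : `|S| < rho j by rewrite ger0_norm.
have zS := polydisc_shift nS.
pose F0 := integrand nu (z + (S%:C * w) *: e) c.
pose F1 i := integrand (add_at nu j i) z (Num.conj w ^+ i *: c).
pose F i (y : Rinfty R) := S ^+ i * taylor_coef (nu j) i * F1 i y.
pose G (y : Rinfty R) := F0 y - \sum_(i < K) F i y.
have i0 : gamma.-integrable setT (EFin \o F0) by exact: integrable_hermite_coef_at.
have i1 i : gamma.-integrable setT (EFin \o F1 i) by exact: integrable_hermite_coef_at.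
have iF i : gamma.-integrable setT (EFin \o F i).
  rewrite (_ : _ \o _ = fun y => ((S ^+ i * taylor_coef (nu j) i)%:E * (F1 i y)%:E)%E)//.
  by apply: integrableZl => //; exact: i1.
have iG : gamma.-integrable setT (EFin \o G).
  rewrite (_ : _ \o _ = fun y => ((F0 y)%:E - (\sum_(i < K) F i y)%:E)%E)//.
  by apply: integrableB => //; exact: integrable_Rsum.
have -> : hermite_coef_at nu (z + (S%:C * w) *: e) c -
    \sum_(i < K) S ^+ i * taylor_coef (nu j) i *
      hermite_coef_at (add_at nu j i) z (Num.conj w ^+ i *: c) = \int[gamma]_y G y.
  rewrite RintegralB//; last exact: integrable_Rsum.
  rewrite Rintegral_sum//; congr (_ - _); apply: eq_bigr => i _.
  by rewrite RintegralZl.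
pose C := S ^+ K * taylor_coef (nu j) K * rnorm c.
have C0 : 0 <= C.
  by rewrite mulr_ge0 ?rnorm_ge0// mulr_ge0 ?taylor_coef_ge0// exprn_ge0.
pose H (y : Rinfty R) := Phi y * `|hermite_prod N (add_at nu j K) y|.
have iH : gamma.-integrable setT (EFin \o H) by exact: integrable_Phi_hermite.
have H0 (y : Rinfty R) : 0 <= H y by rewrite mulr_ge0// phi_ge0.
have mH : measurable_fun setT (fun y : Rinfty R => (H y)%:E).
  by have /integrableP[] := iH.
rewrite -/C -lee_fin EFin_normr_Rintegral// (integral_resampling hgamma j iG).
apply: (@le_trans _ _ (\int[gamma]_y `|\int[normal]_t (G (upd j t y))%:E|)%E).
  by apply: le_abse_integral => //; exact: (measurable_inner_resampling hgamma j iG).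
have -> : (C * \int[gamma]_y H y)%:E =
    (\int[gamma]_y (C%:E * \int[normal]_t (H (upd j t y))%:E))%E.
  rewrite EFinM /Rintegral fineK; last exact: (integrable_fin_num measurableT iH).
  rewrite (integral_resampling hgamma j iH) ge0_integralZl//.
  - exact: (measurable_inner_resampling hgamma j iH).
  - by move=> y _; apply: integral_ge0 => t _; rewrite lee_fin.
apply: ae_ge0_le_integral => //.
- apply: measurableT_comp => //.
  exact: (measurable_inner_resampling hgamma j iG).
- move=> y _; rewrite mule_ge0//; apply: integral_ge0 => t _; rewrite lee_fin.
  exact: H0.
- apply: emeasurable_funM => //.
  exact: (measurable_inner_resampling hgamma j iH).
(* By Fubini, the slices of [Phi ^+ 2], [G] and [H] in the coordinate [j] are integrable outside a
   null set, which is enough to integrate [taylor_inner] over [y]. *)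
have a1 := ae_integrable_resampling hgamma j iphi.
have a2 := ae_integrable_resampling hgamma j iG.
have a3 := ae_integrable_resampling hgamma j iH.
apply: (@filterS3 _ _ (ae_filter_ringOfSetsType gamma) _ _ _ _ _ a1 a2 a3).
move=> y iy iGy iHy _.
have := @taylor_inner y c nu K iy.
rewrite -lee_fin EFinM.
have -> : (fun x => P y c 0 x S * hermite_prod N nu (upd j x y)
     - \sum_(i < K) S ^+ i * taylor_coef (nu j) i *
        (P y c i x 0 * hermite_prod N (add_at nu j i) (upd j x y))) =
   fun x => G (upd j x y).
  apply/funext => x; rewrite /G /F0 /F /F1 /integrand /P expr0 scale1r; congr (_ - _).
  by apply: eq_bigr => i _; rewrite mul0r scale0r addr0.
rewrite EFin_normr_Rintegral//.
by rewrite /Rintegral fineK//; exact: (integrable_fin_num measurableT iHy).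
Qed.

End TaylorN.

(** * Averages over roots of unity *)

Section RootsOfUnity.
Context {C : numClosedFieldType}.

(** The polynomial ['X^n - 1] is separable, so it has [n] distinct roots, and a group of [n] roots
    of unity of exponent [n] has a generator. *)
Lemma prim_root_exists n : (n > 0)%N -> exists w : C, n.-primitive_root w.
Proof.
move=> n0; have [r] := closed_field_poly_normal ('X^n - 1 : {poly C}).
rewrite (monicP (monicXnsubC _ n0)) scale1r => rE.
have ur : uniq r.
  by rewrite -separable_prod_XsubC -rE separable_Xn_sub_1// pnatr_eq0 -lt0n.
have sr : size r = n.
  by apply: succn_inj; rewrite -(size_prod_XsubC r id) -rE size_XnsubC.
have r1 : all n.-unity_root r.
  by apply/allP => z; rewrite -root_prod_XsubC -rE.
have /hasP[w _ wn] : has n.-primitive_root r by rewrite has_prim_root ?sr.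
by exists w.
Qed.

Variables (n : nat) (w : C).
Hypothesis prim_w : n.-primitive_root w.

Lemma norm_prim_root : `|w| = 1.
Proof.
have n0 := prim_order_gt0 prim_w.
apply/eqP; rewrite -(@pexpr_eq1 _ _ n)//.
by rewrite -normrX (prim_expr_order prim_w) normr1.
Qed.

Lemma conj_prim_root : Num.conj w = w^-1.
Proof.
have w0 : w != 0 by rewrite -normr_eq0 norm_prim_root oner_eq0.
by apply: (mulfI w0); rewrite mulfV// -normCK norm_prim_root expr1n.
Qed.

(** A geometric sum of ratio [w^(l - i)], which is 1 only for [i = l] since both indices are below
    [n]. *)
Lemma sum_prim_root i l : (i < n)%N -> (l < n)%N ->
  \sum_(k < n) Num.conj (w ^+ k) ^+ i * (w ^+ k) ^+ l = (n * (i == l))%:R.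
Proof.
move=> iN lN; have n0 := prim_order_gt0 prim_w.
have w0 : w != 0 by rewrite -normr_eq0 norm_prim_root oner_eq0.
pose q := w ^- i * w ^+ l.
have -> : \sum_(k < n) Num.conj (w ^+ k) ^+ i * (w ^+ k) ^+ l = \sum_(k < n) q ^+ k.
  apply: eq_bigr => k _; rewrite rmorphXn /= conj_prim_root /q exprMn -[w ^- i]exprVn -!exprM.
  by rewrite (mulnC k) (mulnC k l).
have [il|il] := eqVneq i l.
  rewrite muln1 (eq_bigr (fun=> 1)); first by rewrite sumr_const card_ord.
  by move=> k _; rewrite /q -il mulVf ?expr1n// expf_neq0.
rewrite muln0; have q1 : q != 1.
  apply/eqP => q1; have : w ^+ l = w ^+ i.
    by rewrite -[RHS]mulr1 -q1 /q mulrA mulfV ?mul1r// expf_neq0.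
  move/eqP; rewrite (eq_prim_root_expr prim_w) !modn_small// eq_sym.
  by rewrite (negbTE il).
apply: (mulfI (x := q - 1)); first by rewrite subr_eq0.
rewrite -subrX1 mulr0 /q exprMn exprVn -!exprM !(mulnC _ n) !exprM.
by rewrite !(prim_expr_order prim_w) !expr1n invr1 mulr1 subrr.
Qed.

End RootsOfUnity.

Section Parseval.
Context {R : realType} {X : completeNormedModType R[i]}.
Variable dot : {dot X for @Num.conj R[i]}.
Hypothesis dot_norm : forall x, dot x x = `|x| ^+ 2.
Local Notation ip := (ip dot).

Lemma ip_shift (z z' : R[i]) x y : ip (z *: x) (z' *: y) = ip x ((Num.conj z * z') *: y).
Proof. by rewrite ip_conj scalerA. Qed.

(** The condition [D <= n] keeps the frequencies distinct modulo [n], so that all the cross terms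
    average to 0. *)
Lemma parseval n (w : R[i]) D (a : nat -> R) (x : nat -> X) :
  n.-primitive_root w -> (D <= n)%N ->
  \sum_(k < n) rnorm (\sum_(i < D) (a i)%:C *: ((w ^+ k) ^+ i *: x i)) ^+ 2 =
  n%:R * \sum_(i < D) a i ^+ 2 * rnorm (x i) ^+ 2.
Proof.
move=> prim_w Dn.
have lt (i : 'I_D) : (i < n)%N by exact: leq_trans (ltn_ord i) Dn.
transitivity (\sum_(k < n) \sum_(i < D) \sum_(l < D) a i * a l *
   ip (x i) ((Num.conj (w ^+ k) ^+ i * (w ^+ k) ^+ l) *: x l)).
  apply: eq_bigr => k _; rewrite -(ip_rnorm dot_norm) ip_suml.
  apply: eq_bigr => i _; rewrite ip_sumr; apply: eq_bigr => l _.
  by rewrite ipZl ipZr ip_shift rmorphXn mulrA.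
rewrite exchange_big mulr_sumr; apply: eq_bigr => i _ /=.
rewrite exchange_big /= (bigD1 i)//= [X in _ + X]big1 ?addr0.
  rewrite -mulr_sumr -ip_sumr -scaler_suml sum_prim_root// eqxx muln1.
  rewrite -(rmorph_nat (real_complex R)) ipZr (ip_rnorm dot_norm); ring.
move=> l li; rewrite -mulr_sumr -ip_sumr -scaler_suml sum_prim_root//.
by rewrite eq_sym (inj_eq val_inj) (negbTE li) muln0 scale0r ip0r mulr0.
Qed.

End Parseval.

Section Tail.
Context {R : realType}.

Lemma bin_le_exp2 n m : ('C(n, m) <= 2 ^ n)%N.
Proof.
have [mn|nm] := leqP m n; last by rewrite bin_small.
have := expnDn 1 1 n; rewrite add1n => ->.
rewrite (bigD1 (Ordinal (n := n.+1) (m := m) mn))//= !exp1n !muln1.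
exact: leq_addr.
Qed.

Lemma taylor_coef_sqr m k :
  taylor_coef m k ^+ 2 = 'C(m + k, k)%:R / k`!%:R :> R.
Proof.
rewrite /taylor_coef !expr_div_n !sqr_sqrtr//.
have := bin_fact (leq_addl m k); rewrite addnK => <-.
rewrite !natrM; field.
by rewrite !gt_eqF// ltr0n fact_gt0.
Qed.

(** The binomial in [taylor_coef_sqr] is at most [2^(m + K)], so that the square is at most [2^m]
    times a term of the exponential series of [2 * kappa ^+ 2]. The radius need not be small. *)
Lemma taylor_tail (kappa : R) m e : 0 <= kappa -> 0 < e ->
  \forall K \near \oo, kappa ^+ K * taylor_coef m K <= e.
Proof.
move=> k0 e0.
have e20 : 0 < e ^+ 2 / 2 ^+ m by rewrite divr_gt0// exprn_gt0.
have := cvg_series_cvg_0 (is_cvg_series_exp_coeff (2 * kappa ^+ 2)).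
move/cvgrPdist_le => /(_ _ e20); apply: filterS => K.
rewrite sub0r normrN ger0_norm; last first.
  by rewrite exp_coeff_ge0// mulr_ge0// sqr_ge0.
rewrite /exp_coeff /= ler_pdivlMr ?exprn_gt0// => H.
rewrite -(@ler_pXn2r _ 2)//; last 2 first.
  by rewrite nnegrE mulr_ge0 ?exprn_ge0//; exact: taylor_coef_ge0.
  by rewrite nnegrE ltW.
apply: le_trans H.
rewrite exprMn taylor_coef_sqr exprMn -exprM mulnC exprM mulrA.
rewrite [leRHS](_ : _ = (kappa ^+ 2) ^+ K * 2 ^+ (m + K) / K`!%:R); last first.
  by rewrite exprD; ring.
rewrite ler_wpM2r ?invr_ge0// ler_wpM2l ?exprn_ge0//.
by rewrite -natrX ler_nat bin_le_exp2.
Qed.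

End Tail.

(** * The dual bound in finite dimension *)

Section Weights.
Context {R : realType}.

(* By [taylor_coef_sqr], this is the sum of ['C(n, k) * kappa^(2k) / k!]. *)
Definition weight (kappa : R) (n : nat) : R :=
  \sum_(k < n.+1) (kappa ^+ k * taylor_coef (n - k) k) ^+ 2.

Lemma weight_ge0 kappa n : 0 <= weight kappa n.
Proof. by apply: sumr_ge0 => k _; exact: sqr_ge0. Qed.

Variables (N D : nat).
Local Notation box := {ffun 'I_N -> 'I_D.+1}.

Definition box_ext (m : box) : nat -> nat :=
  fun l => if insub l is Some i then nat_of_ord (m i) else 0%N.

Lemma box_extE (m : box) (i : 'I_N) : box_ext m i = m i.
Proof. by rewrite /box_ext valK. Qed.

(** [inord] gives a junk value when [m j + k] exceeds [D]; sums involving the shift are therefore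
    guarded by [m j + k < D.+1]. *)
Definition box_shift (j : 'I_N) (k : nat) (m : box) : box :=
  [ffun i => if i == j then inord (m i + k) else m i].

Definition box_unshift (j : 'I_N) (k : nat) (m : box) : box :=
  [ffun i => if i == j then inord (m i - k) else m i].

(** The weights reached once the coordinates below [j] have been averaged; the remaining ones still
    count with weight 1. *)
Definition box_weight (kappa : 'I_N -> R) (j : nat) (m : box) : R :=
  \prod_(i < N | (i < j)%N) weight (kappa i) (m i).

Lemma box_weight_ge0 kappa j (m : box) : 0 <= box_weight kappa j m.
Proof. by apply: prodr_ge0 => i _; exact: weight_ge0. Qed.

Lemma box_weight_eq kappa (j : 'I_N) (m m' : box) : (forall i, i != j -> m i = m' i) ->
  box_weight kappa j m = box_weight kappa j m'.
Proof.
move=> mm'; apply: eq_bigr => i ij; rewrite mm'//.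
by apply: contraTneq ij => ->; rewrite ltnn.
Qed.

Lemma box_weightS kappa (j : 'I_N) (m : box) :
  box_weight kappa j.+1 m = box_weight kappa j m * weight (kappa j) (m j).
Proof.
rewrite /box_weight (bigD1 j)//= mulrC; congr (_ * _); apply: eq_bigl => i.
by rewrite ltnS ltn_neqAle andbC (inj_eq val_inj).
Qed.

(** For fixed [k], adding [k] to the coordinate [j] is a bijection from the boxes that do not
    overflow to those with [k <= m j], and [box_weight kappa j] ignores that coordinate. *)
Lemma box_reindex kappa (j : 'I_N) (F : nat -> nat -> box -> R) :
  \sum_(m : box) box_weight kappa j m * \sum_(k < (m j).+1) F (m j - k)%N k m =
  \sum_(m : box) box_weight kappa j m *
    \sum_(k < D.+1 | (m j + k < D.+1)%N) F (m j) k (box_shift j k m).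
Proof.
under [LHS]eq_bigr => m _.
  rewrite (big_ord_widen D.+1 (fun k => F (m j - k)%N k m)) ?ltn_ord// mulr_sumr.
  under eq_bigl => k do rewrite ltnS.
  over.
under [RHS]eq_bigr do rewrite mulr_sumr.
rewrite (exchange_big_dep xpredT)//= [RHS](exchange_big_dep xpredT)//=.
apply: eq_bigr => k _.
rewrite (reindex_onto (box_shift j k) (box_unshift j k)) /=; last first.
  move=> m km; apply/ffunP => i; rewrite !ffunE.
  case: eqP => [->|//]; apply: val_inj; rewrite /= inordK.
    by rewrite inordK ?subnK// (leq_ltn_trans (leq_subr _ _)).
  by rewrite inordK ?subnK// (leq_ltn_trans (leq_subr _ _)).
have sj (m : box) : (m j + k < D.+1)%N -> box_shift j k m j = (m j + k)%N :> nat.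
  by move=> mk; rewrite ffunE eqxx inordK.
apply: eq_big => [m|m /andP[km /eqP mE]].
  apply/idP/idP => [/andP[km /eqP <-]|mk].
    rewrite ffunE eqxx inordK ?subnK ?ltn_ord//.
    by rewrite (leq_ltn_trans (leq_subr _ _)).
  rewrite sj// leq_addl /=; apply/eqP/ffunP => i; rewrite !ffunE.
  by case: eqP => [->|//]; apply: val_inj; rewrite /= !inordK ?addnK.
have mk : (m j + k < D.+1)%N.
  rewrite -mE ffunE eqxx inordK ?subnK ?ltn_ord//.
  by rewrite (leq_ltn_trans (leq_subr _ _)).
rewrite sj// addnK; congr (_ * _); apply: box_weight_eq => i ij.
by rewrite ffunE (negbTE ij).
Qed.

End Weights.

(** * Induction over the coordinates *)

Section DualInduction.
Context {R : realType} {X : completeNormedModType R[i]}.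
Variable dot : {dot X for @Num.conj R[i]}.
Hypothesis dot_norm : forall x, dot x x = `|x| ^+ 2.
Local Notation ip := (ip dot).
Variable gamma : probability (Rinfty R) R.
Hypothesis hgamma : std_gaussian_infty gamma.

Variables (N : nat) (rho : 'I_N -> R) (f : 'rV[R[i]^o]_N -> X).
Variables (phi : N.-tuple R -> R).
Hypothesis rho_gt0 : forall j, 0 < rho j.
Hypothesis holo : holomorphic_on (strip rho) f.
Hypothesis mphi : measurable_fun setT phi.
Hypothesis f_le : forall y z, polydisc rho z -> rnorm (f (embC y + z)) <= phi y.
Local Notation Phi := (fun y : nat -> R => phi (truncate N y)).
Hypothesis iphi : gamma.-integrable setT (EFin \o (fun y : Rinfty R => Phi y ^+ 2)).
Local Notation E := (hermite_coef_at dot gamma f).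
Local Notation e j := (delta_mx 0 j : 'rV[R[i]^o]_N).

Lemma hermite_coef_at_sum nu z n (a : nat -> R) (x : nat -> X) : polydisc rho z ->
  E nu z (\sum_(i < n) (a i)%:C *: x i) = \sum_(i < n) a i * E nu z (x i).
Proof.
move=> zP.
pose F i (y : Rinfty R) := a i * (ip (f (embC (truncate N y) + z)) (x i) * hermite_prod N nu y).
have iF i : gamma.-integrable setT (EFin \o F i).
  rewrite (_ : _ \o _ = fun y => ((a i)%:E * (ip (f (embC (truncate N y) + z)) (x i)
      * hermite_prod N nu y)%:E)%E)//.
  by apply: integrableZl => //; exact: (integrable_hermite_coef_at dot_norm hgamma holo mphi f_le iphi).
transitivity (\int[gamma]_y (\sum_(i < n) F i y)).
  apply: eq_Rintegral => y _; rewrite ip_sumr mulr_suml.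
  by apply: eq_bigr => i _; rewrite ipZr -mulrA.
rewrite Rintegral_sum//; apply: eq_bigr => i _; rewrite RintegralZl//.
exact: (integrable_hermite_coef_at dot_norm hgamma holo mphi f_le iphi).
Qed.

Definition L2bound := \int[gamma]_y Phi y ^+ 2.

Lemma L2bound_ge0 : 0 <= L2bound.
Proof. by apply: Rintegral_ge0 => y _; exact: sqr_ge0. Qed.

(** AM-GM with a Hermite product of norm 1. The bound is independent of [nu], as needed in the
    Taylor remainder, where the index grows with [K]. *)
Lemma Phi_hermite_le nu :
  \int[gamma]_y (Phi y * `|hermite_prod N nu y|) <= (L2bound + 1) / 2.
Proof.
have iH := integrable_hermite_prod_sqr hgamma N nu.
have iS : gamma.-integrable setT
    (EFin \o (fun y : Rinfty R => Phi y ^+ 2 + hermite_prod N nu y ^+ 2)).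
  exact: (integrableD measurableT iphi iH).
have -> : L2bound + 1 = \int[gamma]_y (Phi y ^+ 2 + hermite_prod N nu y ^+ 2).
  by rewrite RintegralD// (Rintegral_hermite_prod_sqr hgamma).
rewrite mulrC -RintegralZl//; apply: le_Rintegral => //.
- exact: (integrable_Phi_hermite hgamma mphi iphi).
- rewrite (_ : _ \o _ = fun y => (2^-1%:E * (Phi y ^+ 2 + hermite_prod N nu y ^+ 2)%:E)%E)//.
  exact: integrableZl.
- move=> y _; rewrite -[hermite_prod N nu y ^+ 2]real_normK ?num_real//.
  by have := sqr_ge0 (phi (truncate N y) - `|hermite_prod N nu y|); rewrite sqrrB; lra.
Qed.

(** The phase [w^(l k)] carried by [c] meets [conj(w)^(l i)] in the [i]-th Taylor term; summed over
    [l], only [i = k] survives, with the factor [K]. *)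
Lemma avg_taylor (j : 'I_N) (z : 'rV[R[i]^o]_N) (S : R) K (w : R[i]) nu k c :
  polydisc rho z -> z 0 j = 0 -> 0 <= S < rho j ->
  K.-primitive_root w -> (k < K)%N ->
  `|\sum_(l < K) E nu (z + (S%:C * w ^+ l) *: e j) ((w ^+ l) ^+ k *: c) -
    K%:R * (S ^+ k * taylor_coef (nu j) k * E (add_at nu j k) z c)| <=
  K%:R * (S ^+ K * taylor_coef (nu j) K * rnorm c * ((L2bound + 1) / 2)).
Proof.
move=> zP zj0 SP wK kK.
have wl1 l : `|w ^+ l| = 1 by rewrite normrX (norm_prim_root wK) expr1n.
pose T l := \sum_(i < K) S ^+ i * taylor_coef (nu j) i *
      E (add_at nu j i) z (Num.conj (w ^+ l) ^+ i *: ((w ^+ l) ^+ k *: c)).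
have -> : K%:R * (S ^+ k * taylor_coef (nu j) k * E (add_at nu j k) z c) =
    \sum_(l < K) T l.
  rewrite exchange_big /= (bigD1 (Ordinal kK))//= [X in _ + X]big1 ?addr0.
    rewrite -mulr_sumr mulrCA; congr (_ * _).
    rewrite (eq_bigr (fun l : 'I_K => 1 * E (add_at nu j k) z
      ((Num.conj (w ^+ l) ^+ k * (w ^+ l) ^+ k) *: c))); last first.
      by move=> l _; rewrite mul1r scalerA.
    rewrite -(hermite_coef_at_sum _ _ (fun=> 1) (fun l =>
      ((Num.conj (w ^+ l) ^+ k * (w ^+ l) ^+ k) *: c)) zP).
    rewrite (eq_bigr (fun l : 'I_K => (Num.conj (w ^+ l) ^+ k * (w ^+ l) ^+ k) *: c)); last first.
      by move=> l _; rewrite scale1r.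
    rewrite -scaler_suml (sum_prim_root wK)// eqxx muln1.
    have := hermite_coef_at_sum (add_at nu j k) 1 (fun=> K%:R) (fun=> c) zP.
    by rewrite !big_ord1 rmorph_nat => ->.
  move=> i ik; rewrite -mulr_sumr.
  rewrite (eq_bigr (fun l : 'I_K => 1 * E (add_at nu j i) z
    ((Num.conj (w ^+ l) ^+ i * (w ^+ l) ^+ k) *: c))); last first.
    by move=> l _; rewrite mul1r scalerA.
  rewrite -(hermite_coef_at_sum _ _ (fun=> 1) (fun l =>
      ((Num.conj (w ^+ l) ^+ i * (w ^+ l) ^+ k) *: c)) zP).
  rewrite (eq_bigr (fun l : 'I_K => (Num.conj (w ^+ l) ^+ i * (w ^+ l) ^+ k) *: c)); last first.
    by move=> l _; rewrite scale1r.
  have ik' : (nat_of_ord i == k) = false.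
    by apply/negbTE; apply: contraNneq ik => ik; apply/eqP/val_inj.
  rewrite -scaler_suml (sum_prim_root wK)// ik' muln0 scale0r.
  have := hermite_coef_at_sum (add_at nu j i) 0 (fun=> 0) (fun=> 0) zP.
  by rewrite !big_ord0 => ->; rewrite mulr0.
rewrite -sumrB (le_trans (ler_norm_sum _ _ _))//.
rewrite [leRHS](_ : _ = \sum_(l < K)
  (S ^+ K * taylor_coef (nu j) K * rnorm c * ((L2bound + 1) / 2))); last first.
  by rewrite sumr_const card_ord -[RHS]mulr_natl.
apply: ler_sum => l _.
have := hermite_coef_taylor dot_norm hgamma rho_gt0 holo mphi f_le iphi zP zj0 (wl1 l) SP nu
  ((w ^+ l) ^+ k *: c) K.
move=> /le_trans; apply.
have -> : rnorm ((w ^+ l) ^+ k *: c) = rnorm c.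
  by rewrite rnormZ normrX wl1 expr1n mul1r.
rewrite ler_wpM2l ?Phi_hermite_le//.
rewrite mulr_ge0 ?rnorm_ge0// mulr_ge0 ?taylor_coef_ge0// exprn_ge0//.
by case/andP: SP.
Qed.

Variables (D : nat) (kappa : 'I_N -> R).
Hypothesis kappa_rho : forall i, 0 <= kappa i < rho i.
Local Notation box := {ffun 'I_N -> 'I_D.+1}.
Local Notation V := (box_weight kappa).

(** Coordinates below [j] have been treated and stay at 0; the others may still be shifted by up to
    [kappa], which leaves room for the averages to come. *)
Definition closed_polydisc (j : nat) : set 'rV[R[i]^o]_N :=
  [set z | forall i : 'I_N, rnorm (z 0 i) <= kappa i /\ ((i < j)%N -> z 0 i = 0)].

Lemma closed_polydiscP j z : closed_polydisc j z -> polydisc rho z.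
Proof.
move=> zP i; have [zk _] := zP i; apply: le_lt_trans zk _.
by case/andP: (kappa_rho i).
Qed.

(* AM-GM form of a duality: when [c m] has pairing [rnorm (c m) ^+ 2] with the
   coefficient, it yields the bound [L2bound] on a weighted sum of squares. *)
Lemma dual_bound0 z (c : box -> X) : closed_polydisc 0 z ->
  2 * \sum_(m : box) V 0 m * E (box_ext m) z (c m) <=
  L2bound + \sum_(m : box) V 0 m * rnorm (c m) ^+ 2.
Proof.
move=> /closed_polydiscP zP.
have V1 (m : box) : V 0 m = 1 by rewrite /box_weight big1.
under eq_bigr do rewrite V1 mul1r.
under [in leRHS]eq_bigr do rewrite V1 mul1r.
pose F (y : Rinfty R) := f (embC (truncate N y) + z).
pose h (m : box) (y : Rinfty R) := hermite_prod N (box_ext m) y.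
have iE (m : box) : gamma.-integrable setT (EFin \o (fun y => ip (F y) (c m) * h m y)).
  exact: (integrable_hermite_coef_at dot_norm hgamma holo mphi f_le iphi).
have iH (m m' : box) : gamma.-integrable setT (EFin \o (fun y => ip (c m) (c m') * (h m y * h m' y))).
  rewrite (_ : _ \o _ = fun y => ((ip (c m) (c m'))%:E * (h m y * h m' y)%:E)%E)//.
  by apply: integrableZl => //; have [] := hermite_prod2 hgamma N (box_ext m) (box_ext m').
have -> : \sum_m rnorm (c m) ^+ 2 =
    \int[gamma]_y (\sum_m \sum_m' (ip (c m) (c m') * (h m y * h m' y))).
  rewrite Rintegral_sum; last by move=> m; apply: integrable_Rsum.
  apply: eq_bigr => m _; rewrite Rintegral_sum//.
  rewrite (bigD1 m)//= big1 ?addr0.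
    rewrite RintegralZl//; last by have [] := hermite_prod2 hgamma N (box_ext m) (box_ext m).
    have [_ ->] := hermite_prod2 hgamma N (box_ext m) (box_ext m).
    rewrite (_ : [forall i, _] = true); last by apply/forallP => i.
    by rewrite -(ip_rnorm dot_norm); exact/esym/mulr1.
  move=> m' mm'; rewrite RintegralZl//; last by have [] := hermite_prod2 hgamma N (box_ext m) (box_ext m').
  have [_ ->] := hermite_prod2 hgamma N (box_ext m) (box_ext m').
  case: forallP => [H|_]; last by rewrite mulr0.
  case/eqP: mm'; apply/ffunP => i; apply: val_inj.
  by have /eqP := H i; rewrite !box_extE.
rewrite /L2bound -RintegralD//; last first.
  by apply: integrable_Rsum => m; apply: integrable_Rsum.
rewrite /hermite_coef_at -Rintegral_sum// -RintegralZl//; last exact: integrable_Rsum.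
apply: le_Rintegral => //.
- rewrite (_ : _ \o _ = fun y => (2%:E * (\sum_m ip (F y) (c m) * h m y)%:E)%E)//.
  by apply: integrableZl => //; exact: integrable_Rsum.
- rewrite (_ : _ \o _ = fun y => ((Phi y ^+ 2)%:E +
    (\sum_m \sum_m' (ip (c m) (c m') * (h m y * h m' y)))%:E)%E)//.
  apply: integrableD => //.
  by apply: integrable_Rsum => m; apply: integrable_Rsum.
(* Pointwise, [2 * ip F G] is at most the sum of the squared norms. Orthonormality has already
   identified the integral of [ip G G] with the sum of the [rnorm (c m) ^+ 2]. *)
- move=> y _; pose G := \sum_m (h m y)%:C *: c m.
  have -> : \sum_m ip (f (embC (truncate N y) + z)) (c m) * hermite_prod N (box_ext m) y = ip (F y) G.
    by rewrite /G ip_sumr; apply: eq_bigr => m _; rewrite ipZr mulrC.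
  have -> : \sum_m \sum_m' (ip (c m) (c m') * (h m y * h m' y)) = ip G G.
    rewrite /G ip_suml; apply: eq_bigr => m _; rewrite ip_sumr.
    by apply: eq_bigr => m' _; rewrite ipZl ipZr; ring.
  have FP : rnorm (F y) ^+ 2 <= Phi y ^+ 2.
    by rewrite ler_pXn2r// ?nnegrE ?rnorm_ge0 ?(phi_ge0 rho_gt0 f_le)//; exact: f_le.
  apply: le_trans (lerD FP (lexx _)).
  have := sqr_ge0 (rnorm (F y - G)).
  rewrite -!(ip_rnorm dot_norm) ipBl !ipBr (ipC dot G (F y)).
  lra.
Qed.

(* The hypothesis is applied at [z + kappa j w^l e_j] for all the powers of a
   primitive [K]-th root of unity [w], with coefficients that are combinations
   of the [c (box_shift j k m)] with phases [w^(l k)]. Averaging over [l]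
   isolates the terms of the Taylor expansion in the direction [j], whose
   remainder vanishes as [K] tends to infinity. *)
Lemma dual_bound_step (j : 'I_N) :
  (forall z (c : box -> X), closed_polydisc j z ->
    2 * \sum_(m : box) V j m * E (box_ext m) z (c m) <=
    L2bound + \sum_(m : box) V j m * rnorm (c m) ^+ 2) ->
  forall z (c : box -> X), closed_polydisc j.+1 z ->
    2 * \sum_(m : box) V j.+1 m * E (box_ext m) z (c m) <=
    L2bound + \sum_(m : box) V j.+1 m * rnorm (c m) ^+ 2.
Proof.
move=> IH z c zP; have zrho := closed_polydiscP zP.
have /andP[k0 kr] := kappa_rho j.
set S := kappa j in k0 kr.
have zj0 : z 0 j = 0 by have [_] := zP j; exact.
(* The value 0 on overflow absorbs the guard of [box_reindex], so that [k] can run over all of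
   ['I_D.+1] and the junk values of [box_shift] do not contribute. *)
pose a (m : box) (k : nat) : R :=
  if (m j + k < D.+1)%N then S ^+ k * taylor_coef (m j) k else 0.
have a0 (m : box) k : 0 <= a m k.
  by rewrite /a; case: ifP => // _; rewrite mulr_ge0 ?taylor_coef_ge0// exprn_ge0.
pose x (m : box) (k : nat) := c (box_shift j k m).
have reindexE (G : box -> R) : \sum_(m : box) V j.+1 m * G m =
    \sum_(m : box) V j m * \sum_(k < D.+1) a m k ^+ 2 * G (box_shift j k m).
  transitivity (\sum_(m : box) V j m * \sum_(k < (m j).+1)
     ((S ^+ k * taylor_coef (m j - k) k) ^+ 2 * G m)).
    by apply: eq_bigr => m _; rewrite box_weightS -mulrA -mulr_suml.
  rewrite (box_reindex kappa j (fun n k m => (S ^+ k * taylor_coef n k) ^+ 2 * G m)).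
  apply: eq_bigr => m _; congr (_ * _); rewrite big_mkcond /=.
  by apply: eq_bigr => k _; rewrite /a; case: ifP => // _; rewrite expr0n mul0r.
have extE (m : box) k : a m k != 0 ->
    E (box_ext (box_shift j k m)) z (x m k) = E (add_at (box_ext m) j k) z (x m k).
  rewrite /a; case: ifPn => [mk _|_]; last by rewrite eqxx.
  rewrite /hermite_coef_at; apply: eq_Rintegral => y _; congr (_ * _).
  apply: eq_bigr => i _; rewrite box_extE ffunE /add_at (inj_eq val_inj) box_extE.
  by case: eqP => [->|//]; rewrite inordK.
rewrite !reindexE.
pose Cst := \sum_(m : box) V j m * \sum_(k < D.+1) a m k * rnorm (x m k) * ((L2bound + 1) / 2).
have Cst0 : 0 <= Cst.
  apply: sumr_ge0 => m _; rewrite mulr_ge0 ?box_weight_ge0//.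
  apply: sumr_ge0 => k _; rewrite mulr_ge0 ?divr_ge0 ?addr_ge0 ?L2bound_ge0//.
  by rewrite mulr_ge0 ?rnorm_ge0.
apply/ler_addgt0Pr => eps eps0.
pose e0 := eps / (2 * Cst + 1).
have C1 : 0 < 2 * Cst + 1 by rewrite ltr_wpDl// mulr_ge0.
have e00 : 0 < e0 by rewrite divr_gt0.
(* [D < K] separates all the frequencies [k <= D]. The degrees [n <= D] are finitely many, so that
   one [K] makes all their remainders small. *)
have [K [KD Kt]] : exists K, (D < K)%N /\
    forall n : 'I_D.+1, S ^+ K * taylor_coef n K <= e0.
  have : \forall K \near \oo, forall n : 'I_D.+1, S ^+ K * taylor_coef n K <= e0.
    by apply: filter_forall => n; exact: taylor_tail.
  move=> [K0 _ HK0]; exists (maxn K0 D.+1); split; first by rewrite leq_maxr.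
  by move=> n; apply: HK0 => /=; exact: leq_maxl.
have K0 : (0 < K)%N by exact: leq_ltn_trans KD.
have [w wK] := @prim_root_exists R[i] K K0.
pose d l (m : box) := \sum_(k < D.+1) (a m k)%:C *: ((w ^+ l) ^+ k *: x m k).
pose zl l := z + (S%:C * w ^+ l) *: e j.
have wl1 l : `|w ^+ l| = 1 by rewrite normrX (norm_prim_root wK) expr1n.
have zlP l : closed_polydisc j (zl l).
  move=> i; have [zi zi0] := zP i; rewrite /zl !mxE eqxx /=.
  have [ij|ij] := eqVneq i j.
    split; last by rewrite ij ltnn.
    rewrite ij zj0 add0r mulr1 /rnorm normrM wl1 mulr1 normc_def /= expr0n addr0.
    by rewrite sqrtr_sqr ger0_norm.
  rewrite mulr0 addr0; split => // lij; apply: zi0.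
  exact: ltn_trans lij (ltnSn j).
(* The induction hypotheses at the [K] points are added. Parseval evaluates the right side exactly,
   [avg_taylor] bounds the left side from below up to the remainder, and the common factor [K]
   cancels. *)
have main : \sum_(l < K) (2 * \sum_(m : box) V j m * E (box_ext m) (zl l) (d l m)) <=
    \sum_(l < K) (L2bound + \sum_(m : box) V j m * rnorm (d l m) ^+ 2).
  by apply: ler_sum => l _; exact: IH.
rewrite -mulr_sumr exchange_big /= big_split /= sumr_const card_ord in main.
rewrite [X in _ <= _ + X]exchange_big /= in main.
have rhsE : \sum_(m : box) \sum_(l < K) V j m * rnorm (d l m) ^+ 2 =
    K%:R * \sum_(m : box) V j m * \sum_(k < D.+1) a m k ^+ 2 * rnorm (x m k) ^+ 2.
  rewrite mulr_sumr; apply: eq_bigr => m _.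
  by rewrite -mulr_sumr (parseval dot_norm (a m) (x m) wK KD) mulrCA.
rewrite rhsE -(mulr_natl L2bound K) -mulrDr in main.
have lhsE : \sum_(m : box) \sum_(l < K) V j m * E (box_ext m) (zl l) (d l m) =
    \sum_(m : box) V j m * \sum_(k < D.+1) a m k *
      \sum_(l < K) E (box_ext m) (zl l) ((w ^+ l) ^+ k *: x m k).
  apply: eq_bigr => m _; rewrite -mulr_sumr; congr (_ * _).
  rewrite (eq_bigr (fun l : 'I_K => \sum_(k < D.+1) a m k *
     E (box_ext m) (zl l) ((w ^+ l) ^+ k *: x m k))); last first.
    move=> l _; rewrite (hermite_coef_at_sum _ _ (a m) (fun k => (w ^+ l) ^+ k *: x m k))//.
    exact: closed_polydiscP (zlP l).
  by rewrite exchange_big /=; apply: eq_bigr => k _; rewrite -mulr_sumr.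
rewrite lhsE in main.
have KR : 0 < K%:R :> R by rewrite ltr0n.
pose A := \sum_(m : box) V j m * \sum_(k < D.+1) a m k ^+ 2 *
  E (box_ext (box_shift j k m)) z (c (box_shift j k m)).
have lower : K%:R * (A - e0 * Cst) <= \sum_(m : box) V j m * \sum_(k < D.+1) a m k *
      \sum_(l < K) E (box_ext m) (zl l) ((w ^+ l) ^+ k *: x m k).
  rewrite /A /Cst mulr_sumr -sumrB mulr_sumr; apply: ler_sum => m _.
  rewrite mulrCA -mulrBr mulrCA ler_wpM2l ?box_weight_ge0//.
  rewrite mulr_sumr -sumrB mulr_sumr; apply: ler_sum => k _.
  have [am0|am0] := eqVneq (a m k) 0.
    by rewrite am0 expr0n /= !(mul0r, mulr0) subrr mulr0.
  rewrite extE// expr2.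
  have kK : (k < K)%N by exact: leq_trans (ltn_ord k) KD.
  have amE : a m k = S ^+ k * taylor_coef (box_ext m j) k.
    by move: am0; rewrite /a box_extE; case: ifP => //; rewrite eqxx.
  have Sj : 0 <= S < rho j by rewrite k0.
  have := @avg_taylor j z S K w (box_ext m) k (x m k) zrho zj0 Sj wK kK.
  rewrite -amE => /ler_normlP[H _].
  have -> : K%:R * (a m k * a m k * E (add_at (box_ext m) j k) z (x m k) -
      e0 * (a m k * rnorm (x m k) * ((L2bound + 1) / 2))) =
    a m k * (K%:R * (a m k * E (add_at (box_ext m) j k) z (x m k) -
      e0 * (rnorm (x m k) * ((L2bound + 1) / 2)))) by ring.
  rewrite ler_wpM2l//.
  have H2 : K%:R * (S ^+ K * taylor_coef (box_ext m j) K * rnorm (x m k) * ((L2bound + 1) / 2)) <=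
      K%:R * (e0 * (rnorm (x m k) * ((L2bound + 1) / 2))).
    rewrite ler_wpM2l ?(ltW KR)// -mulrA ler_wpM2r//.
      by rewrite mulr_ge0 ?rnorm_ge0// divr_ge0// addr_ge0// L2bound_ge0.
    by rewrite box_extE.
  move: H H2; rewrite mulrBr.
  set s1 := \sum_(l < K) _; set s2 := K%:R * (a m k * _).
  by move=> H H2; lra.
have {}main := le_trans (ler_wpM2l (ler0n R 2) lower) main.
rewrite mulrCA ler_pM2l// in main.
have eC : 2 * (e0 * Cst) <= eps.
  rewrite mulrCA /e0 mulrAC ler_pdivrMr// ler_pM2l// lerDl.
  exact: ler01.
rewrite -/A; apply: le_trans (lerD main eC).
by rewrite -mulrDr subrK.
Qed.

Lemma dual_bound (c : box -> X) :
  2 * \sum_(m : box) (\prod_(i < N) weight (kappa i) (m i)) * E (box_ext m) 0 (c m) <=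
  L2bound + \sum_(m : box) (\prod_(i < N) weight (kappa i) (m i)) * rnorm (c m) ^+ 2.
Proof.
have H j : (j <= N)%N -> forall z (c : box -> X), closed_polydisc j z ->
    2 * \sum_(m : box) V j m * E (box_ext m) z (c m) <=
    L2bound + \sum_(m : box) V j m * rnorm (c m) ^+ 2.
  elim: j => [_|j IH jN]; first exact: dual_bound0.
  by apply: (@dual_bound_step (Ordinal jN)); apply: IH; exact: ltnW.
have VN (m : box) : V N m = \prod_(i < N) weight (kappa i) (m i).
  by apply: eq_bigl => i; rewrite ltn_ord.
under eq_bigr do rewrite -VN.
under [in leRHS]eq_bigr do rewrite -VN.
apply: H => // i; rewrite mxE /rnorm normr0; split => //.
by case/andP: (kappa_rho i).
Qed.

End DualInduction.

(** * Multi-indices and boxes *)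

Section Multiindex.
Context {R : realType}.

Lemma esum_le_seq (T : choiceType) (a : T -> R) (B : R) : (forall x, 0 <= a x) ->
  (forall s : seq T, uniq s -> \sum_(x <- s) a x <= B) ->
  (\esum_(x in [set: T]) (a x)%:E <= B%:E)%E.
Proof.
move=> a0 H; rewrite /esum; apply: ge_ereal_sup => _ [A [finA _] <-].
rewrite fsbig_finite//= sumEFin lee_fin; apply: H; exact: fset_uniq.
Qed.

Lemma prod_finsupp (F : nat -> nat -> R) (nu : multiindex) N :
  (forall j, F j 0%N = 1) -> (forall j, (N <= j)%N -> nu j = 0%N) ->
  \prod_(j <- finsupp nu) F j (nu j) = \prod_(i < N) F i (nu i).
Proof.
move=> F0 nuN; rewrite -(big_mkord xpredT (fun i => F i (nu i))) /index_iota subn0.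
rewrite [RHS](bigID (fun i => i \in finsupp nu)) /= [X in _ = _ * X]big1 ?mulr1; last first.
  by move=> i /fsfun_dflt ->.
rewrite -[RHS]big_filter; apply: perm_big; apply: uniq_perm.
- exact: fset_uniq.
- by rewrite filter_uniq// iota_uniq.
- move=> j; rewrite mem_filter mem_iota add0n leq0n /=.
  case: finsuppP => // jnu; apply/esym; rewrite ltnNge; apply/negP => Nj.
  by move: jnu; rewrite mem_finsupp nuN.
Qed.

Section Box.
Variables N D : nat.
Local Notation box := {ffun 'I_N -> 'I_D.+1}.

Definition multi_of_box (m : box) : multiindex :=
  [fsfun j in [fset x in iota 0 N]%fset => box_ext m j].

Lemma multi_of_boxE (m : box) j : multi_of_box m j = box_ext m j.
Proof.
rewrite fsfunE; case: ifPn => //; rewrite !inE mem_iota /= add0n.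
by rewrite /box_ext; case: insubP => //= i ->.
Qed.

Lemma multi_of_box_inj : injective multi_of_box.
Proof.
move=> m m' mm'; apply/ffunP => i; apply: val_inj.
by rewrite /= -!box_extE -!multi_of_boxE mm'.
Qed.

Lemma multi_of_box_out (m : box) j : (N <= j)%N -> multi_of_box m j = 0%N.
Proof.
by move=> Nj; rewrite multi_of_boxE /box_ext insubF// ltnNge Nj.
Qed.

Lemma sum_multi_of_box (s : seq multiindex) (F : multiindex -> R) : uniq s ->
  (forall nu, nu \in s -> forall j, (nu j <= D)%N /\ ((N <= j)%N -> nu j = 0%N)) ->
  \sum_(nu <- s) F nu = \sum_(m : box | multi_of_box m \in s) F (multi_of_box m).
Proof.
move=> us Hs; rewrite -[RHS]big_filter -[RHS](big_map multi_of_box xpredT F).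
apply: perm_big; apply: uniq_perm => //.
  by rewrite map_inj_uniq ?filter_uniq ?index_enum_uniq//; exact: multi_of_box_inj.
move=> nu; apply/idP/mapP => [nus|[m]]; last by rewrite mem_filter => /andP[? _] ->.
have E : multi_of_box [ffun i : 'I_N => inord (nu i)] = nu.
  apply/fsfunP => j; rewrite multi_of_boxE; have [jN|Nj] := ltnP j N.
    rewrite -[j]/(nat_of_ord (Ordinal jN)) box_extE ffunE inordK// ltnS.
    by have [] := Hs _ nus j.
  by rewrite -multi_of_boxE multi_of_box_out//; have [_ ->] := Hs _ nus j.
exists [ffun i : 'I_N => inord (nu i)] => //.
by rewrite mem_filter mem_index_enum andbT E.
Qed.

End Box.

Lemma seq_multi_bounded (s : seq multiindex) : exists K : nat,
  forall nu, nu \in s -> forall j, (nu j <= K)%N /\ ((K <= j)%N -> nu j = 0%N).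
Proof.
elim: s => [|nu s [K HK]]; first by exists 0%N.
pose K1 := (\max_(j <- finsupp nu) maxn (nu j) j.+1)%N.
exists (maxn K K1) => nu'; rewrite inE => /predU1P[->|/HK H] j; last first.
  have [H1 H2] := H j; split; first by rewrite leq_max H1.
  by move=> Kj; apply: H2; apply: leq_trans Kj; exact: leq_maxl.
have HK1 : j \in finsupp nu -> (maxn (nu j) j.+1 <= K1)%N.
  by move=> jnu; rewrite /K1 (big_rem j)//= leq_maxl.
case: finsuppP => // jnu; split.
  by rewrite leq_max (leq_trans _ (HK1 jnu)) ?orbT// leq_maxl.
rewrite geq_max => /andP[_ K1j].
by have := leq_trans (HK1 jnu) K1j; rewrite geq_max ltnn andbF.
Qed.

End Multiindex.

(** * Square integrability and pairing of Bochner integrals *)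

Section L2.
Context d (T : measurableType d) (R : realType).
Variable m : {measure set T -> \bar R}.

Lemma Lnorm2_le (g : T -> R) (e : R) : 0 <= e ->
  ('N[m]_(2%:E) [EFin \o g] <= e%:E)%E ->
  (\int[m]_x (g x ^+ 2)%:E <= (e ^+ 2)%:E)%E.
Proof.
move=> e0 ge.
have -> : (\int[m]_x (g x ^+ 2)%:E = \int[m]_x (`|(EFin \o g) x| `^ 2))%E.
  apply: eq_integral => x _; rewrite /= powR_mulrn//.
  by rewrite real_normK ?num_real.
rewrite -poweR_Lnorm ?pnatr_eq0//.
have -> : ((e ^+ 2)%:E = e%:E `^ 2)%E by rewrite /= powR_mulrn.
by apply: gt0_ler_poweR => //; rewrite in_itv/= ?andbT leey ?Lnorm_ge0 ?lee_fin// e0.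
Qed.

Lemma integrable_sqr (g : T -> R) (e : R) : measurable_fun setT g ->
  (\int[m]_x (g x ^+ 2)%:E <= e%:E)%E ->
  m.-integrable setT (EFin \o (fun x => g x ^+ 2)).
Proof.
move=> mg ge; apply/integrableP; split.
  by apply/measurable_EFinP; exact: measurable_funX.
under eq_integral do rewrite /= ger0_norm ?sqr_ge0//.
exact: le_lt_trans ge (ltry _).
Qed.

Lemma Rintegral_le_fin (g : T -> R) (e : R) : m.-integrable setT (EFin \o g) ->
  (\int[m]_x (g x)%:E <= e%:E)%E -> \int[m]_x g x <= e.
Proof.
move=> ig ge; rewrite /Rintegral -lee_fin fineK//.
exact: integrable_fin_num.
Qed.

(** Cauchy-Schwarz against a factor of norm 1, by Young's inequality balanced with [e]: [|f g|] is
    at most [f^2 / (2 e) + e g^2 / 2]. *)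
Lemma Rintegral_mul_le (f g : T -> R) (e : R) : 0 < e ->
  measurable_fun setT f -> measurable_fun setT g ->
  (\int[m]_x (f x ^+ 2)%:E <= (e ^+ 2)%:E)%E ->
  m.-integrable setT (EFin \o (fun x => g x ^+ 2)) ->
  \int[m]_x (g x ^+ 2) = 1 ->
  \int[m]_x `|f x * g x| <= e.
Proof.
move=> e0 mf mg fe ig g1.
have if2 := integrable_sqr mf fe.
have ifg := integrable_amgm mf mg if2 ig.
have f1 := Rintegral_le_fin if2 fe.
have iN : m.-integrable setT (EFin \o (fun x => `|f x * g x|)).
  rewrite (_ : _ \o _ = abse \o (EFin \o (fun x => f x * g x)))//.
  exact: integrable_abse.
have iS : m.-integrable setT
    (EFin \o (fun x => (2 * e)^-1 * f x ^+ 2 + (e / 2) * g x ^+ 2)).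
  rewrite (_ : _ \o _ = fun x => (((2 * e)^-1)%:E * (f x ^+ 2)%:E +
    (e / 2)%:E * (g x ^+ 2)%:E)%E)//.
  by apply: integrableD => //; exact: integrableZl.
apply: (@le_trans _ _ (\int[m]_x ((2 * e)^-1 * f x ^+ 2 + (e / 2) * g x ^+ 2))).
  apply: le_Rintegral => // x _; rewrite normrM.
  rewrite -[f x ^+ 2]real_normK ?num_real// -[g x ^+ 2]real_normK ?num_real//.
  rewrite -(ler_pM2l (x := 2 * e)) ?mulr_gt0//.
  rewrite [leRHS](_ : _ = `|f x| ^+ 2 + (e * `|g x|) ^+ 2); last first.
    by field; rewrite gt_eqF.
  by have := sqr_ge0 (`|f x| - e * `|g x|); rewrite sqrrB; lra.
rewrite RintegralD//; last 2 first.
- rewrite (_ : _ \o _ = fun x => (((2 * e)^-1)%:E * (f x ^+ 2)%:E)%E)//.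
  exact: integrableZl.
- rewrite (_ : _ \o _ = fun x => ((e / 2)%:E * (g x ^+ 2)%:E)%E)//.
  exact: integrableZl.
rewrite !RintegralZl// g1 mulr1.
rewrite -(ler_pM2l (x := 2 * e)) ?mulr_gt0//.
rewrite [leLHS](_ : _ = \int[m]_x (f x ^+ 2) + e ^+ 2); last first.
  by field; rewrite gt_eqF.
by rewrite -mulrA -expr2 mulr_natl mulr2n lerD2r.
Qed.

End L2.

Section BochnerPairing.
Context {d : measure_display} {T : measurableType d} {R : realType}.
Context {X : completeNormedModType R[i]}.
Variable dot : {dot X for @Num.conj R[i]}.
Hypothesis dot_norm : forall x, dot x x = `|x| ^+ 2.
Local Notation ip := (ip dot).
Variable mu : probability T R.

Lemma ler_dist_rnorm (x y : X) : `|rnorm x - rnorm y| <= rnorm (x - y).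
Proof.
have H1 := ler_rnormD (x - y) y; have H2 := ler_rnormD (y - x) x.
rewrite subrK in H1; rewrite subrK -opprB rnormN in H2.
by apply/ler_normlP; split; lra.
Qed.

Lemma cvg_rnorm_sub (s : nat -> X) (x : X) :
  s n @[n --> \oo] --> x -> rnorm (x - s n) @[n --> \oo] --> 0.
Proof.
move=> /cvgrPdist_lt H; apply/cvgrPdist_lt => e e0.
have e0C : 0 < e%:C by rewrite ltcR.
have := H _ e0C; apply: filterS => n.
by rewrite sub0r normrN ger0_norm ?rnorm_ge0// -ltcR rnormE.
Qed.

Lemma simple_discrete (s : T -> X) : simple_function s -> discrete_fun s.
Proof. by move=> [fs ms]; split => //; exact: finite_set_countable. Qed.

Lemma ip_simple_integral (s : T -> X) (c : X) : simple_function s ->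
  mu.-integrable setT (EFin \o (fun t => ip (s t) c)) /\
  ip (simple_integral mu s) c = \int[mu]_t ip (s t) c.
Proof.
move=> [fs ms]; rewrite /simple_integral fsbig_finite//=.
have mI x : mu.-integrable setT (EFin \o (fun t => ip x c * \1_(s @^-1` [set x]) t)).
  rewrite (_ : _ \o _ = fun t => ((ip x c)%:E * (\1_(s @^-1` [set x]) t)%:E)%E)//.
  by apply: integrableZl => //; exact: integrable_indic.
have sE : (fun t => ip (s t) c) =
    fun t => \sum_(x <- fset_set (range s)) ip x c * \1_(s @^-1` [set x]) t.
  apply/funext => t; rewrite (big_rem (s t)) /=; last first.
    by rewrite in_fset_set// inE; exists t.
  rewrite indicE mem_set// mulr1 big_seq big1 ?addr0// => x.
  rewrite mem_rem_uniq ?fset_uniq// inE => /andP[xs _].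
  rewrite indicE memNset ?mulr0// => /= sx; move: xs.
  by rewrite -sx eqxx.
rewrite sE; split; first exact: integrable_Rsum.
rewrite ip_suml Rintegral_sum//; apply: eq_bigr => x _.
rewrite ipZl RintegralZl//; last exact: integrable_indic.
rewrite mulrC; congr (_ * _); rewrite /Rintegral integral_indic ?setIT//.
Qed.

(** Pairing with [c] commutes with the integral of a simple function. By Cauchy-Schwarz, each side
    is within [e * rnorm c] of that common value for a late enough simple approximation. *)
Lemma bochner_integral_ip (f : T -> X) (x c : X) : is_bochner_integral mu f x ->
  mu.-integrable setT (EFin \o (fun t => ip (f t) c)) ->
  ip x c = \int[mu]_t ip (f t) c.
Proof.
move=> [sf [s [ss fs sx]]] iF.
have mr n : measurable_fun setT (fun t => rnorm (f t - s n t)).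
  move: sf => [r [sr rf]].
  apply: (@measurable_fun_cvg _ _ _ _ (fun k t => rnorm (r k t - s n t))).
    move=> k; exact: (discrete_fun_measurable_comp (fun p => rnorm (p.1 - p.2))
      (discrete_fun_pair (simple_discrete (sr k)) (simple_discrete (ss n)))).
  move=> t _; apply/subr_cvg0/norm_cvg0P.
  apply: (@squeeze_cvgr _ _ _ _ (fun=> 0) (fun k => rnorm (f t - r k t))).
  - apply: nearW => k; rewrite normr_ge0 distrC (le_trans (ler_dist_rnorm _ _))//.
    by rewrite opprB addrA subrK.
  - exact: cvg_cst.
  - exact/cvg_rnorm_sub.
apply/eqP; rewrite -subr_eq0 -normr_le0; apply/ler_addgt0Pr => eps eps0.
rewrite add0r; pose e := eps / (2 * (rnorm c + 1)).
have c0 : 0 < rnorm c + 1 by rewrite ltr_wpDl// rnorm_ge0.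
have e0 : 0 < e by rewrite divr_gt0// mulr_gt0.
have /cvgrPdist_lt/(_ _ e0) near1 := cvg_rnorm_sub sx.
have [near2 /cvgrPdist_lt/(_ _ e0) near3] := (fine_cvgP _ _).1 fs.
have [n [n1 n2 n3]] : exists n, [/\ rnorm (x - simple_integral mu (s n)) < e,
    (\int[mu]_t (rnorm (f t - s n t))%:E)%E \is a fin_num &
    \int[mu]_t rnorm (f t - s n t) < e].
  have [n _ H] := filterI near1 (filterI near2 near3).
  have /= [h1 [h2 h3]] := H n (leqnn n).
  exists n; split => //.
    by move: h1; rewrite sub0r normrN ger0_norm ?rnorm_ge0.
  by move: h3; rewrite sub0r normrN ger0_norm// Rintegral_ge0// => t _; exact: rnorm_ge0.
have ir : mu.-integrable setT (EFin \o (fun t => rnorm (f t - s n t))).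
  apply/integrableP; split; first exact/measurable_EFinP.
  under eq_integral do rewrite /= ger0_norm ?rnorm_ge0//.
  by rewrite ltey_eq n2.
have [is_ sI] := ip_simple_integral c (ss n).
have -> : ip x c - \int[mu]_t ip (f t) c = ip (x - simple_integral mu (s n)) c -
    \int[mu]_t (ip (f t) c - ip (s n t) c).
  by rewrite RintegralB// -sI ipBl; ring.
have H1 : `|ip (x - simple_integral mu (s n)) c| <= e * rnorm c.
  apply: le_trans (ip_CauchySchwarz dot_norm _ _) _.
  by rewrite ler_wpM2r ?rnorm_ge0// ltW.
have H2 : `|\int[mu]_t (ip (f t) c - ip (s n t) c)| <= e * rnorm c.
  have iB : mu.-integrable setT (EFin \o (fun t => ip (f t) c - ip (s n t) c)).
    exact: (integrableB measurableT iF is_).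
  apply: le_trans (le_normr_Rintegral _ iB) _ => //.
  apply: (@le_trans _ _ (\int[mu]_t (rnorm (f t - s n t) * rnorm c))).
    apply: le_Rintegral => //.
    - rewrite (_ : _ \o _ = abse \o (EFin \o (fun t => ip (f t) c - ip (s n t) c)))//.
      exact: integrable_abse.
    - rewrite (_ : _ \o _ = fun t => ((rnorm (f t - s n t))%:E * (rnorm c)%:E)%E)//.
      exact: integrableZr.
    - by move=> t _; rewrite -ipBl; exact: ip_CauchySchwarz.
  by rewrite RintegralZr// ler_wpM2r ?rnorm_ge0// ltW.
have H3 : 2 * (e * rnorm c) <= eps.
  have -> : eps = e * (2 * (rnorm c + 1)) by rewrite divfK ?gt_eqF ?mulr_gt0.
  by move: e0; lra.
apply: le_trans (ler_normB _ _) _; lra.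
Qed.

End BochnerPairing.

(** * The limit of infinite dimension *)

Section Limit.
Context {R : realType} {X : completeNormedModType R[i]}.
Variable dot : {dot X for @Num.conj R[i]}.
Hypothesis dot_norm : forall x, dot x x = `|x| ^+ 2.
Local Notation ip := (ip dot).
Variable gamma : probability (Rinfty R) R.
Hypothesis hgamma : std_gaussian_infty gamma.

Lemma hermite_multiE (nu : multiindex) N (y : nat -> R) :
  (forall j, (N <= j)%N -> nu j = 0%N) -> hermite_multi nu y = hermite_prod N nu y.
Proof.
move=> nuN; apply: (prod_finsupp (F := fun j n => (hermite n).[y j])) => // j.
by rewrite /hermite /= fact0 sqrtr1 invr1 scale1r hornerC.
Qed.

Lemma weight0 (kappa : R) : weight kappa 0 = 1.
Proof. by rewrite /weight big_ord1 expr0 mul1r taylor_coef_sqr bin0 fact0 divr1. Qed.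

Definition multi_weight (kappa : nat -> R) (nu : multiindex) : R :=
  \prod_(j <- finsupp nu) weight (kappa j) (nu j).

Lemma multi_bounded (nu : multiindex) : exists N, forall j, (N <= j)%N -> nu j = 0%N.
Proof.
have [K HK] := seq_multi_bounded [:: nu]; exists K => j.
by have [] := HK nu (mem_head _ _) j.
Qed.

Lemma measurable_hermite_multi nu :
  measurable_fun setT (fun y : Rinfty R => hermite_multi nu y).
Proof.
have [N nuN] := multi_bounded nu.
rewrite (_ : (fun _ => _) = fun y : Rinfty R => hermite_prod N nu y).
  exact: measurable_hermite_prod.
by apply/funext => y; exact: hermite_multiE.
Qed.

Lemma integrable_hermite_multi_sqr nu : gamma.-integrable setT
  (EFin \o (fun y : Rinfty R => hermite_multi nu y ^+ 2)).
Proof.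
have [N nuN] := multi_bounded nu.
rewrite (_ : (fun _ => _) = fun y : Rinfty R => hermite_prod N nu y ^+ 2).
  exact: integrable_hermite_prod_sqr.
by apply/funext => y; rewrite (hermite_multiE _ nuN).
Qed.

Lemma Rintegral_hermite_multi_sqr nu : \int[gamma]_y (hermite_multi nu y ^+ 2) = 1.
Proof.
have [N nuN] := multi_bounded nu.
rewrite -(Rintegral_hermite_prod_sqr hgamma N nu); apply: eq_Rintegral => y _.
by rewrite (hermite_multiE _ nuN).
Qed.

Variable u : Rinfty R -> X.
Hypothesis u2 : in_bochner_L2 gamma u.

Lemma integrable_ip_hermite nu c : gamma.-integrable setT
  (EFin \o (fun y : Rinfty R => ip (u y) c * hermite_multi nu y)).
Proof.
have [mu_ u2_] := u2.
have mr : measurable_fun setT (fun y => rnorm (u y)).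
  rewrite (_ : (fun _ => _) = fun y : Rinfty R => rnorm (u y - 0)).
    by apply: (@measurable_rnorm_sub R X 0 (fun=> 0) u mu_) => y; exact: cst_continuous.
  by apply/funext => y; rewrite subr0.
have L0 : (0 <= bochner_L2norm gamma u)%E by exact: Lnorm_ge0.
have fL : bochner_L2norm gamma u \is a fin_num by rewrite ge0_fin_numE.
have L1 : (\int[gamma]_y (rnorm (u y) ^+ 2)%:E <= (fine (bochner_L2norm gamma u) ^+ 2)%:E)%E.
  by apply: Lnorm2_le; rewrite ?fine_ge0// fineK.
have ir := integrable_sqr mr L1.
have mi := @strongly_measurable_ip R X dot dot_norm _ (Rinfty R) u c mu_.
apply: integrable_amgm => //.
- exact: measurable_hermite_multi.
- apply: (@le_integrable _ _ _ gamma setT measurableT _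
    (fun y => ((rnorm c ^+ 2)%:E * (rnorm (u y) ^+ 2)%:E)%E)).
  + by apply/measurable_EFinP; exact: measurable_funX.
  + move=> y _; rewrite -EFinM !abse_EFin lee_fin; apply: le_trans (ler_norm _).
    rewrite -exprMn normrX ler_pXn2r// ?nnegrE ?mulr_ge0 ?rnorm_ge0//.
    by rewrite mulrC; exact: ip_CauchySchwarz.
  + exact: integrableZl.
- exact: integrable_hermite_multi_sqr.
Qed.

(* This also holds in the junk case, in which the coefficient is 0. *)
Lemma hermite_coef_pairing nu : rnorm (hermite_coef gamma u nu) ^+ 2 =
  \int[gamma]_y (ip (u y) (hermite_coef gamma u nu) * hermite_multi nu y).
Proof.
rewrite /hermite_coef /bochner_integral; case: xgetP => [x _ Hx|_]; last first.
  rewrite rnorm0 expr0n /=; under eq_Rintegral do rewrite ipC ip0l mul0r.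
  by rewrite Rintegral_cst// mul0r.
rewrite -(ip_rnorm dot_norm) (bochner_integral_ip dot_norm Hx).
  by apply: eq_Rintegral => y _; rewrite ipZl mulrC.
rewrite (_ : (fun _ => _) = fun y : Rinfty R => ip (u y) x * hermite_multi nu y).
  exact: integrable_ip_hermite.
by apply/funext => y; rewrite ipZl mulrC.
Qed.

(** [v N] stands for the approximation of [u] by [N] coordinates. The limit relies only on the
    properties assumed here, among them the finite-dimensional dual bound with a constant [B]
    independent of [N]. *)
Variables (v : nat -> Rinfty R -> X) (kappa : nat -> R) (B : R).
Hypothesis mv : forall N, (0 < N)%N ->
  measurable_fun setT (fun y => rnorm (u y - v N y)).
Hypothesis iv : forall N nu c, (0 < N)%N -> gamma.-integrable setT
  (EFin \o (fun y : Rinfty R => ip (v N y) c * hermite_prod N nu y)).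
Hypothesis v_dual : forall N D (c : {ffun 'I_N -> 'I_D.+1} -> X), (0 < N)%N ->
  2 * \sum_(m : {ffun 'I_N -> 'I_D.+1}) (\prod_(i < N) weight (kappa i) (m i)) *
    (\int[gamma]_y (ip (v N y) (c m) * hermite_prod N (box_ext m) y)) <=
  B + \sum_(m : {ffun 'I_N -> 'I_D.+1}) (\prod_(i < N) weight (kappa i) (m i)) * rnorm (c m) ^+ 2.
Hypothesis v_cvg :
  bochner_L2norm gamma (fun y => u y - v N y) @[N --> \oo] --> 0%E.

Lemma cvg_hermite_pairing nu c :
  \int[gamma]_y (ip (v N y) c * hermite_multi nu y) @[N --> \oo] -->
  \int[gamma]_y (ip (u y) c * hermite_multi nu y).
Proof.
have [N0 nuN] := multi_bounded nu.
apply/cvgrPdist_le => eps eps0; pose e := eps / (rnorm c + 1).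
have c0 : 0 < rnorm c + 1 by rewrite ltr_wpDl// rnorm_ge0.
have e0 : 0 < e by rewrite divr_gt0.
pose L N := bochner_L2norm gamma (fun y => u y - v N y).
have [near2 /cvgrPdist_lt/(_ _ e0) near3] := (fine_cvgP _ _).1 v_cvg.
near=> N.
have N_gt0 : (0 < N)%N by near: N; exact: nbhs_infty_gt.
have NN0 : (N0 <= N)%N by near: N; exact: nbhs_infty_ge.
have fN : L N \is a fin_num by near: N.
have lN : (L N <= e%:E)%E.
  rewrite -(fineK fN) lee_fin ltW//.
  have : `|0 - fine (L N)| < e by near: N.
  by rewrite sub0r normrN; apply: le_lt_trans; exact: ler_norm.
have HE (y : nat -> R) : hermite_multi nu y = hermite_prod N nu y.
  by apply: hermite_multiE => j Nj; apply: nuN; exact: leq_trans Nj.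
have iu := integrable_ip_hermite nu c.
have iN : gamma.-integrable setT
    (EFin \o (fun y : Rinfty R => ip (v N y) c * hermite_multi nu y)).
  rewrite (_ : (fun _ => _) = fun y : Rinfty R => ip (v N y) c * hermite_prod N nu y).
    exact: iv.
  by apply/funext => y; rewrite HE.
rewrite -RintegralB//.
have mr := mv N_gt0.
have r2 := Lnorm2_le (ltW e0) lN.
have H := Rintegral_mul_le e0 mr (measurable_hermite_multi nu) r2
  (integrable_hermite_multi_sqr nu) (Rintegral_hermite_multi_sqr nu).
have iB := integrableB measurableT iu iN.
apply: le_trans (le_normr_Rintegral _ iB) _ => //.
apply: (@le_trans _ _ (\int[gamma]_y (rnorm c * `|rnorm (u y - v N y) * hermite_multi nu y|))).
  apply: le_Rintegral => //.
  - exact: (integrable_abse iB).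
  - rewrite (_ : _ \o _ = fun y : Rinfty R => ((rnorm c)%:E *
      (abse \o (EFin \o (fun y : Rinfty R => rnorm (u y - v N y) * hermite_multi nu y)%R)) y)%E)//.
    apply: integrableZl => //; apply: integrable_abse; apply: integrable_amgm => //.
    + exact: measurable_hermite_multi.
    + exact: integrable_sqr r2.
    + exact: integrable_hermite_multi_sqr.
  - move=> y _ /=; rewrite -mulrBl -ipBl !normrM mulrA ler_wpM2r//.
    rewrite [X in _ <= _ * X]ger0_norm ?rnorm_ge0// mulrC.
    exact: ip_CauchySchwarz.
rewrite RintegralZl//; last first.
  rewrite (_ : _ \o _ = abse \o (EFin \o (fun y : Rinfty R => rnorm (u y - v N y) * hermite_multi nu y)))//.
  apply: integrable_abse; apply: integrable_amgm => //.
  + exact: measurable_hermite_multi.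
  + exact: integrable_sqr r2.
  + exact: integrable_hermite_multi_sqr.
apply: le_trans (ler_wpM2l (rnorm_ge0 c) H) _.
have -> : eps = (rnorm c + 1) * e by rewrite mulrC divfK// gt_eqF.
by rewrite ler_wpM2r ?(ltW e0)// lerDl.
Unshelve. all: by end_near. Qed.

(** For [N] large, a finite family [s] fits into the box of side [K] over [N] coordinates; the test
    vectors are extended by 0 to the rest of the box. Both sides then have limits, since [u] enters
    only through finitely many pairings. *)
Lemma dual_bound_limit (s : seq multiindex) (c : multiindex -> X) : uniq s ->
  2 * \sum_(nu <- s) multi_weight kappa nu *
    (\int[gamma]_y (ip (u y) (c nu) * hermite_multi nu y)) <=
  B + \sum_(nu <- s) multi_weight kappa nu * rnorm (c nu) ^+ 2.
Proof.
move=> us; have [K HK] := seq_multi_bounded s.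
have cv : 2 * \sum_(nu <- s) multi_weight kappa nu *
      (\int[gamma]_y (ip (v N y) (c nu) * hermite_multi nu y)) @[N --> \oo] -->
    2 * \sum_(nu <- s) multi_weight kappa nu *
      (\int[gamma]_y (ip (u y) (c nu) * hermite_multi nu y)).
  apply: cvgMr; apply: cvg_big => [|nu _]; first exact: add_continuous.
  by apply: cvgMr; exact: cvg_hermite_pairing.
apply: (cvgr_to_le cv).
near=> N.
have N_gt0 : (0 < N)%N by near: N; exact: nbhs_infty_gt.
have KN : (K <= N)%N by near: N; exact: nbhs_infty_ge.
have HN nu : nu \in s -> forall j, (nu j <= K)%N /\ ((N <= j)%N -> nu j = 0%N).
  move=> nus j; have [h1 h2] := HK nu nus j; split => // Nj.
  by apply: h2; exact: leq_trans Nj.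
pose c' (m : {ffun 'I_N -> 'I_K.+1}) :=
  if multi_of_box m \in s then c (multi_of_box m) else 0.
have wE (m : {ffun 'I_N -> 'I_K.+1}) :
    multi_weight kappa (multi_of_box m) = \prod_(i < N) weight (kappa i) (m i).
  rewrite /multi_weight (prod_finsupp (F := fun j => weight (kappa j)) (N := N)).
  - by apply: eq_bigr => i _; rewrite multi_of_boxE box_extE.
  - by move=> j; exact: weight0.
  - exact: multi_of_box_out.
have := v_dual c' N_gt0.
rewrite !(sum_multi_of_box _ us HN) [X in 2 * X <= _ -> _](bigID (fun m => multi_of_box m \in s)) /=.
rewrite [X in _ <= _ + X -> _](bigID (fun m => multi_of_box m \in s)) /=.
rewrite [X in 2 * (_ + X) <= _ -> _]big1 ?addr0; last first.
  move=> m /negbTE ms; rewrite /c' ms; under eq_Rintegral do rewrite ipC ip0l mul0r.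
  by rewrite Rintegral_cst// mul0r mulr0.
rewrite [X in _ <= _ + (_ + X) -> _]big1 ?addr0; last first.
  by move=> m /negbTE ms; rewrite /c' ms rnorm0 expr0n mulr0.
have -> : \sum_(m : {ffun 'I_N -> 'I_K.+1} | multi_of_box m \in s)
    \prod_(i < N) weight (kappa i) (m i) * rnorm (c' m) ^+ 2 =
    \sum_(m : {ffun 'I_N -> 'I_K.+1} | multi_of_box m \in s)
    multi_weight kappa (multi_of_box m) * rnorm (c (multi_of_box m)) ^+ 2.
  by apply: eq_bigr => m ms; rewrite wE /c' ms.
congr (2 * _ <= _); apply: eq_bigr => m ms; rewrite wE /c' ms; congr (_ * _).
apply: eq_Rintegral => y _; congr (_ * _).
rewrite (hermite_multiE (N := N)); last exact: multi_of_box_out.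
by apply: eq_bigr => i _; rewrite multi_of_boxE.
Unshelve. all: by end_near. Qed.

(** With the coefficients themselves as test vectors, both sums equal the same [S], and the dual
    bound reads [2 S <= B + S]. *)
Lemma sum_hermite_coef_le (s : seq multiindex) : uniq s ->
  \sum_(nu <- s) multi_weight kappa nu * rnorm (hermite_coef gamma u nu) ^+ 2 <= B.
Proof.
move=> us; have := dual_bound_limit (hermite_coef gamma u) us.
under eq_bigr do rewrite -hermite_coef_pairing.
by set S := \sum_(nu <- s) _; lra.
Qed.

End Limit.

Section HolomorphicBound.
Context {R : realType} {X : completeNormedModType R[i]}.
Variable dot : {dot X for @Num.conj R[i]}.
Hypothesis dot_norm : forall x, dot x x = `|x| ^+ 2.
Variables (gammaN : forall N : nat, probability (N.-tuple R) R)
  (gamma : probability (Rinfty R) R).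
Hypotheses (hgammaN : forall N : nat, std_gaussian_fin (gammaN N))
  (hgamma : std_gaussian_infty gamma).
Variables (xi delta : R) (b : nat -> R) (u : Rinfty R -> X).
Hypotheses (delta_ge0 : 0 <= delta) (hu : holomorphic gammaN gamma b xi delta u).
Variable kappa : nat -> R.
Hypothesis kappa_ge0 : forall j, 0 <= kappa j.
Hypothesis kappa_admissible : forall N, exists rho : 'I_N -> R,
  admissible b xi rho /\ forall i : 'I_N, kappa i < rho i.

Lemma holomorphic_hermite_coef_le (s : seq multiindex) : uniq s ->
  \sum_(nu <- s) multi_weight kappa nu * rnorm (hermite_coef gamma u nu) ^+ 2 <=
  delta ^+ 2.
Proof.
move: hu => [u2 [uN [uC [uNC _ uphi u_cvg]]]].
(* The radii and the extension vary with [N], but on real points the extension is [uN N]. The strict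
   inequality [kappa i < rho i] puts the circles used in the averages inside the open polydisc. *)
have key N : (0 < N)%N -> exists (rho : 'I_N -> R) (phi : N.-tuple R -> R),
    [/\ forall j, 0 < rho j, forall i : 'I_N, kappa i < rho i,
        holomorphic_on (strip rho) (uC N rho),
        forall y, uC N rho (embC y) = uN N y &
    [/\ measurable_fun setT phi,
        forall y z, polydisc rho z -> rnorm (uC N rho (embC y + z)) <= phi y,
        gamma.-integrable setT (EFin \o (fun y : Rinfty R => phi (truncate N y) ^+ 2)) &
        \int[gamma]_y phi (truncate N y) ^+ 2 <= delta ^+ 2]].
  move=> N0; have [rho [arho kr]] := kappa_admissible N.
  have [phi [mphi phi0 phid phile]] := uphi N N0.
  have [rholo rhoE] := uNC N rho N0 arho; have [rho0 _] := arho.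
  have L := Lnorm2_le delta_ge0 phid.
  have mphi2 : measurable_fun setT (fun y => (phi y ^+ 2)%:E).
    by apply/measurable_EFinP; exact: measurable_funX.
  have E : (\int[gamma]_y (phi (truncate N y) ^+ 2)%:E <= (delta ^+ 2)%:E)%E.
    rewrite (ge0_integral_truncate hgamma (f := fun y => (phi y ^+ 2)%:E) (@hgammaN N) mphi2)//.
    by move=> y; rewrite lee_fin sqr_ge0.
  have i2 : gamma.-integrable setT
      (EFin \o (fun y : Rinfty R => phi (truncate N y) ^+ 2)).
    by apply: integrable_sqr E; exact: (measurableT_comp mphi (@measurable_truncate R N)).
  exists rho, phi; split => //; split => //.
  - by move=> y z; exact: phile.
  - exact: Rintegral_le_fin i2 E.
apply: (sum_hermite_coef_le dot_norm hgamma u2 (v := fun N y => uN N (truncate N y)) (kappa := kappa)) => //.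
- move=> N N0; have [rho [phi [rho0 kr holo fE [mphi phile i2 i2le]]]] := key N N0.
  rewrite (_ : (fun _ => _) = fun y : Rinfty R => rnorm (u y - uC N rho (embC (truncate N y)))).
    apply: (@measurable_rnorm_sub R X N) => [|y]; first by have [] := u2.
    rewrite -[embC y]addr0; apply: (holo_cts holo) => j.
    by rewrite mxE /rnorm normr0.
  by apply/funext => y; rewrite fE.
- move=> N nu c N0; have [rho [phi [rho0 kr holo fE [mphi phile i2 i2le]]]] := key N N0.
  rewrite (_ : (fun _ => _) = fun y : Rinfty R =>
      ip dot (uC N rho (embC (truncate N y) + 0)) c * hermite_prod N nu y).
    apply: (integrable_hermite_coef_at dot_norm hgamma holo mphi phile i2) => j.
    by rewrite mxE /rnorm normr0.
  by apply/funext => y; rewrite addr0 fE.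
- move=> N D c N0; have [rho [phi [rho0 kr holo fE [mphi phile i2 i2le]]]] := key N N0.
  have kr' (i : 'I_N) : 0 <= kappa i < rho i by rewrite kappa_ge0 kr.
  have := dual_bound dot_norm hgamma rho0 holo mphi phile i2 kr' c.
  move=> H; apply: le_trans (lerD i2le (lexx _)); apply: le_trans H.
  rewrite le_eqVlt; apply/orP; left; apply/eqP; congr (_ * _).
  apply: eq_bigr => m _; congr (_ * _); apply: eq_Rintegral => y _.
  by rewrite addr0 fE.
Qed.

End HolomorphicBound.

(** * Summability of the weights *)

Section BetaSum.
Context {R : realType}.

(** The comparison is term by term: for [1 <= l <= M], [K^l >= K >= M! >= l!]. Terms with [l > n]
    vanish on the left, so that only [l <= minn M n] matters. *)
Lemma beta_factor_le (M n : nat) (rho K : R) : 1 <= K -> M`!%:R <= K ->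
  \sum_(l < M.+1) 'C(n, l)%:R * rho ^+ (2 * l) <= weight (Num.sqrt K * rho) n.
Proof.
move=> K1 MK; have K0 : 0 <= K by exact: le_trans ler01 K1.
pose g l := 'C(n, l)%:R * rho ^+ (2 * l).
pose h k : R := (Num.sqrt K * rho) ^+ (2 * k) * ('C(n, k)%:R / k`!%:R).
have g0 l : 0 <= g l by rewrite mulr_ge0 ?ler0n// exprM exprn_ge0// sqr_ge0.
have h0 k : 0 <= h k.
  by rewrite mulr_ge0 ?divr_ge0 ?ler0n// exprM exprn_ge0// sqr_ge0.
have -> : weight (Num.sqrt K * rho) n = \sum_(k < n.+1) h k.
  apply: eq_bigr => -[k] /=; rewrite ltnS => kn _.
  by rewrite exprMn taylor_coef_sqr subnK// -exprM mulnC.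
have gh l : (l <= M)%N -> g l <= h l.
  move=> lM; rewrite /g /h mulrCA ler_wpM2l ?ler0n// exprMn (exprM (Num.sqrt K)) sqr_sqrtr//.
  rewrite mulrAC ler_peMl//; first by rewrite exprM exprn_ge0// sqr_ge0.
  rewrite ler_pdivlMr ?ltr0n ?fact_gt0// mul1r.
  case: l lM => [|l] lM; first by rewrite expr0 fact0.
  apply: (@le_trans _ _ M`!%:R); first by rewrite ler_nat leq_fact.
  by apply: le_trans MK _; rewrite -[leLHS]expr1 ler_weXn2l.
apply: (@le_trans _ _ (\sum_(l < (minn M n).+1) g l)).
  rewrite [leRHS](big_ord_widen M.+1 g) ?ltnS ?geq_minl// [leRHS]big_mkcond /=.
  apply: ler_sum => -[l] /=; rewrite ltnS => lM _; rewrite ltnS leq_min lM /=.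
  by case: leqP => // nl; rewrite bin_small// mul0r.
apply: (@le_trans _ _ (\sum_(l < (minn M n).+1) h l)).
  apply: ler_sum => -[l] /=; rewrite ltnS leq_min => /andP[lM _] _; exact: gh.
rewrite [leLHS](big_ord_widen n.+1 h) ?ltnS ?geq_minr// [leLHS]big_mkcond /=.
by apply: ler_sum => k _; case: ifP.
Qed.

Lemma beta_le_multi_weight (M : nat) (rho : nat -> R) (K : R) nu :
  1 <= K -> M`!%:R <= K ->
  beta M rho nu <= multi_weight (fun j => Num.sqrt K * rho j) nu.
Proof.
move=> K1 MK; apply: ler_prod => j _; rewrite beta_factor_le// andbT.
by apply: sumr_ge0 => l _; rewrite mulr_ge0 ?ler0n// exprM exprn_ge0// sqr_ge0.
Qed.

(** After division by [x^(-t)] this says [t / x <= (1 - 1/x)^(-t) - 1], which follows from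
    [exp y >= 1 + y] and [ln (1 + y) <= y]. *)
Lemma powR_telescope (x t : R) : 1 < x -> 0 < t ->
  t * x `^ (- (t + 1)) <= (x - 1) `^ (- t) - x `^ (- t).
Proof.
move=> x1 t0; have x0 : 0 < x by exact: lt_trans ltr01 x1.
have y0 : 0 < 1 - x^-1 by rewrite subr_gt0 invf_lt1.
have -> : x - 1 = x * (1 - x^-1) by rewrite mulrBr mulr1 divff ?gt_eqF.
rewrite powRM ?(ltW x0) ?(ltW y0)// opprD powRD; last by rewrite (gt_eqF x0) implybT.
rewrite powR_inv1 ?(ltW x0)// mulrCA -[X in _ <= _ - X]mulr1 -mulrBr.
rewrite ler_wpM2l ?powR_ge0// lerBrDl /powR gt_eqF//.
apply: le_trans (expR_ge1Dx _); rewrite lerD2l mulNr -mulrN ler_pM2l// lerNr.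
by have := @le_ln1Dx R (- x^-1); apply; rewrite ltrN2 invf_lt1.
Qed.

Lemma sum_powRN_le (s : R) D : 1 < s ->
  \sum_(n < D) n.+1%:R `^ (- s) <= s / (s - 1).
Proof.
move=> s1; set t := s - 1; have t0 : 0 < t by rewrite subr_gt0.
have H : \sum_(n < D.+1) n.+1%:R `^ (- s) <= 1 + (1 - D.+1%:R `^ (- t)) / t.
  elim: D => [|D IH]; first by rewrite big_ord1 powR1 subrr mul0r addr0.
  rewrite big_ord_recr /=; apply: le_trans (lerD IH (lexx _)) _.
  rewrite -addrA lerD2l -lerBrDl -mulrBl ler_pdivlMr//.
  have := @powR_telescope D.+2%:R t _ t0; rewrite ltr1n => /(_ isT).
  rewrite -[D.+2%:R - 1](_ : D.+1%:R = _); last by rewrite -[D.+2]addn1 natrD addrK.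
  have -> : t + 1 = s by rewrite subrK.
  by lra.
have E : s / t = 1 + 1 / t by rewrite /t; field; rewrite subr_eq0 gt_eqF.
rewrite E; apply: le_trans (_ : _ <= \sum_(n < D.+1) n.+1%:R `^ (- s)) _.
  by rewrite big_ord_recr /= lerDl powR_ge0.
by apply: le_trans H _; rewrite lerD2l ler_pM2r ?invr_gt0// gerBl powR_ge0.
Qed.

End BetaSum.

(** * Summability of the inverse weights *)

Section BetaSummable.
Context {R : realType}.

(** After multiplication by [M!], both sides are products over [i < M], and
    [n * (M - i) <= (n - i) * M] factor by factor. *)
Lemma expn_le_bin (M n : nat) : (M <= n)%N -> (n ^ M <= 'C(n, M) * M ^ M)%N.
Proof.
move=> Mn; rewrite -(leq_pmul2r (fact_gt0 M)) mulnAC bin_ffact -ffactnn !ffact_prod.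
have pow k : (k ^ M = \prod_(i < M) k)%N by rewrite prod_nat_const card_ord.
rewrite !pow -!big_split /=; apply: leq_prod => i _.
by rewrite mulnBr mulnBl leq_sub2l// mulnC leq_mul.
Qed.

Definition beta_factor (M : nat) (rho : R) (n : nat) : R :=
  \sum_(l < M.+1) 'C(n, l)%:R * rho ^+ (2 * l).

Lemma beta_factor_term_ge0 n l rho : 0 <= 'C(n, l)%:R * rho ^+ (2 * l) :> R.
Proof. by rewrite mulr_ge0 ?ler0n// exprM exprn_ge0// sqr_ge0. Qed.

Lemma beta_factor0 M rho : beta_factor M rho 0 = 1.
Proof.
rewrite /beta_factor big_ord_recl /= bin0 muln0 expr0 mulr1 big1 ?addr0// => i _.
by rewrite bin0n mul0r.
Qed.

Lemma beta_factor_ge0 M rho n : 0 <= beta_factor M rho n.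
Proof. by apply: sumr_ge0 => l _; exact: beta_factor_term_ge0. Qed.

(** The term [l = M.+1] is used for [n >= M.+1], and [l = 1] for smaller [n]. A single power of
    [rho ^+ 2] is kept and the others are bounded below by [r]: one power already yields the
    summable factor [a j]. *)
Lemma beta_factor_ge (M n : nat) (rho r : R) : (0 < n)%N -> 0 < r <= 1 ->
  r <= rho ^+ 2 ->
  r ^+ M / (M.+1 ^ M.+1)%:R * rho ^+ 2 * n%:R ^+ M.+1 <= beta_factor M.+1 rho n.
Proof.
move=> n0 /andP[r0 r1] rrho.
have ge l : (l < M.+2)%N -> 'C(n, l)%:R * rho ^+ (2 * l) <= beta_factor M.+1 rho n.
  move=> lM; rewrite /beta_factor (bigD1 (Ordinal lM))//= lerDl.
  by apply: sumr_ge0 => i _; exact: beta_factor_term_ge0.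
have MM : 0 < (M.+1 ^ M.+1)%:R :> R by rewrite ltr0n expn_gt0.
have -> : r ^+ M / (M.+1 ^ M.+1)%:R * rho ^+ 2 * n%:R ^+ M.+1 =
    r ^+ M * rho ^+ 2 * ((n ^ M.+1)%:R / (M.+1 ^ M.+1)%:R) :> R.
  by rewrite [in RHS]natrX; ring.
have x0 : 0 <= r ^+ M * rho ^+ 2 by rewrite mulr_ge0 ?sqr_ge0 ?exprn_ge0 ?(ltW r0).
have y0 : 0 <= (n ^ M.+1)%:R / (M.+1 ^ M.+1)%:R :> R by rewrite divr_ge0.
have [Mn|nM] := leqP M.+1 n.
  apply: le_trans (ge M.+1 (ltnSn _)); rewrite [leLHS]mulrC.
  apply: ler_pM => //.
    by rewrite ler_pdivrMr// -natrM ler_nat expn_le_bin.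
  rewrite [leRHS]exprM [leRHS]exprSr ler_wpM2r ?sqr_ge0// lerXn2r// nnegrE ?(ltW r0)//.
  exact: sqr_ge0.
apply: le_trans (ge 1%N isT); rewrite bin1 muln1 [leLHS]mulrC.
apply: ler_pM => //.
  apply: (@le_trans _ _ 1); last by rewrite ler1n.
  by rewrite ler_pdivrMr// mul1r ler_nat leq_exp2r// ltnW.
by rewrite ler_piMl ?sqr_ge0// exprn_ile1// (ltW r0).
Qed.

Lemma powR_prod (I : Type) (s : seq I) (P : pred I) (F : I -> R) (q : R) :
  (forall i, 0 <= F i) ->
  (\prod_(i <- s | P i) F i) `^ q = \prod_(i <- s | P i) F i `^ q.
Proof.
move=> F0; elim: s => [|i s IH]; first by rewrite !big_nil powR1.
by rewrite !big_cons; case: ifP => // _; rewrite powRM ?IH// prodr_ge0.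
Qed.

Variables (M : nat) (rho : nat -> R) (q r K : R) (a : nat -> R).
Hypotheses (q_gt0 : 0 < q) (Mq : 1 < M.+1%:R * q) (r01 : 0 < r <= 1).
Hypothesis r_rho : forall j, r <= rho j ^+ 2.
Hypothesis rho_a : forall j, (rho j ^+ 2) `^ (- q) <= K * a j.
Hypothesis a_le1 : forall N, \sum_(j < N) a j <= 1.
Hypothesis K_ge0 : 0 <= K.

(** The term [n = 0] is exactly 1, which makes infinite products possible; the others are summed as
    a zeta series of exponent [M.+1 * q > 1]. *)
Lemma sum_beta_factor_le : exists2 C : R, 0 <= C & forall j D,
  \sum_(n < D.+1) (beta_factor M.+1 (rho j) n)^-1 `^ q <= 1 + C * a j.
Proof.
pose c := r ^+ M / (M.+1 ^ M.+1)%:R.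
have /andP[r0 r1] := r01.
have c0 : 0 < c by rewrite divr_gt0 ?exprn_gt0// ltr0n expn_gt0.
pose Z := M.+1%:R * q / (M.+1%:R * q - 1).
have Z0 : 0 <= Z by rewrite divr_ge0 ?subr_ge0 ?(ltW Mq)// mulr_ge0 ?ler0n ?ltW.
exists (c `^ (- q) * K * Z); first by apply: mulr_ge0 => //; apply: mulr_ge0 => //; exact: powR_ge0.
move=> j D; rewrite big_ord_recl beta_factor0 invr1 powR1 lerD2l.
have rho2 : 0 < rho j ^+ 2 by exact: lt_le_trans r0 (r_rho j).
have Ka : 0 <= K * a j by exact: le_trans (powR_ge0 _ _) (rho_a j).
apply: (@le_trans _ _ (\sum_(n < D) c `^ (- q) * (K * a j) *
    n.+1%:R `^ (- (M.+1%:R * q)))).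
  apply: ler_sum => n _; rewrite lift0.
  have b0 : 0 < c * rho j ^+ 2 * n.+1%:R ^+ M.+1.
    by rewrite mulr_gt0 ?exprn_gt0 ?ltr0n// mulr_gt0.
  apply: (@le_trans _ _ ((c * rho j ^+ 2 * n.+1%:R ^+ M.+1)^-1 `^ q)).
    have bge := @beta_factor_ge M n.+1 (rho j) r isT r01 (r_rho j).
    apply: ge0_ler_powR; rewrite ?nnegrE ?invr_ge0 ?beta_factor_ge0 ?(ltW q_gt0) ?(ltW b0)//.
    by rewrite lef_pV2 ?posrE//; exact: lt_le_trans bge.
  rewrite -powR_inv1 ?(ltW b0)// -powRrM mulN1r powRM ?exprn_ge0 ?ler0n//; last first.
    by rewrite mulr_ge0 ?(ltW c0) ?(ltW rho2).
  rewrite powRM ?(ltW c0) ?(ltW rho2)// -[n.+1%:R ^+ _]powR_mulrn ?ler0n// -powRrM mulrN.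
  by rewrite ler_wpM2r ?powR_ge0// ler_wpM2l ?powR_ge0.
rewrite -mulr_sumr.
have := @sum_powRN_le R (M.+1%:R * q) D Mq.
have cK : 0 <= c `^ (- q) * (K * a j) by rewrite mulr_ge0// powR_ge0.
move=> /(ler_wpM2l cK) /le_trans; apply.
by rewrite le_eqVlt; apply/orP; left; apply/eqP; rewrite -/Z; ring.
Qed.

(** Over a box, the sum of products is a product of sums, and each [1 + C * a i] is at most
    [exp (C * a i)]; as the [a i] sum to at most 1, [exp C] bounds every box. *)
Lemma sum_beta_le : exists C : R, forall s : seq multiindex, uniq s ->
  \sum_(nu <- s) (beta M.+1 rho nu)^-1 `^ q <= C.
Proof.
have [C C0 HC] := sum_beta_factor_le; exists (expR C) => s us.
have [N HN] := seq_multi_bounded s.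
pose F j n := (beta_factor M.+1 (rho j) n)^-1 `^ q.
have F0 j n : 0 <= F j n by exact: powR_ge0.
rewrite (sum_multi_of_box _ us HN).
apply: (@le_trans _ _ (\sum_(m : {ffun 'I_N -> 'I_N.+1}) \prod_(i < N) F i (m i))).
  rewrite big_mkcond /=; apply: ler_sum => m _; case: ifP => _; last exact: prodr_ge0.
  rewrite /beta -[X in X^-1](_ : \prod_(j <- finsupp (multi_of_box m))
    beta_factor M.+1 (rho j) (multi_of_box m j) = _)//.
  rewrite (prod_finsupp (F := fun j => beta_factor M.+1 (rho j)) (N := N)).
  - rewrite -prodfV powR_prod => [|i]; last by rewrite invr_ge0 beta_factor_ge0.
    rewrite le_eqVlt; apply/orP; left; apply/eqP; apply: eq_bigr => i _.
    by rewrite multi_of_boxE box_extE.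
  - by move=> j; exact: beta_factor0.
  - exact: multi_of_box_out.
rewrite -(bigA_distr_bigA (fun (i : 'I_N) (n : 'I_N.+1) => F i n)).
apply: (@le_trans _ _ (\prod_(i < N) expR (C * a i))).
  apply: ler_prod => i _; rewrite sumr_ge0//=.
  by apply: le_trans (HC i N) (expR_ge1Dx _).
by rewrite -expR_sum ler_expR -mulr_sumr ler_piMr.
Qed.

End BetaSummable.

Section LpTools.
Context {R : realType}.

Lemma in_lp_seq (T : choiceType) (p C : R) (a : T -> R) :
  (forall s : seq T, uniq s -> \sum_(x <- s) `|a x| `^ p <= C) -> in_lp p a.
Proof.
move=> H; apply: poweR_lty.
apply: (@le_lt_trans _ _ C%:E); last exact: ltry.
by apply: esum_le_seq => // x; exact: powR_ge0.
Qed.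

Lemma beta_gt0 (M : nat) (rho : nat -> R) nu : 0 < beta M rho nu.
Proof.
apply: prodr_gt0 => j _; rewrite big_ord_recl /= bin0 muln0 expr0 mulr1.
by rewrite ltr_pwDl// sumr_ge0// => i _; exact: beta_factor_term_ge0.
Qed.

(** If [x^(p - 2) <= B], the first term suffices. Otherwise [x^(2 - p) < 1/B], and raising this to
    the power [p / (2 - p)] gives the second one. *)
Lemma powR_le_interpolate (p x B : R) : 0 < p < 2 -> 0 <= x -> 0 < B ->
  x `^ p <= B * x ^+ 2 + B^-1 `^ (p / (2 - p)).
Proof.
move=> /andP[p0 p2] x0 B0.
have Bx : 0 <= B * x ^+ 2 by rewrite mulr_ge0 ?sqr_ge0 ?ltW.
have [->|xn0] := eqVneq x 0.
  by rewrite powR0 ?gt_eqF// expr0n mulr0 add0r powR_ge0.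
have {xn0}x0 : 0 < x by rewrite lt_neqAle eq_sym xn0.
have p2' : 0 < 2 - p by rewrite subr_gt0.
have [H|H] := leP (x `^ (p - 2)) B.
  apply: (@le_trans _ _ (B * x ^+ 2)); last by rewrite lerDl powR_ge0.
  rewrite -[x ^+ 2]powR_mulrn ?(ltW x0)// -{1}[p](subrK 2).
  rewrite powRD; last by rewrite (gt_eqF x0) implybT.
  by rewrite ler_wpM2r ?powR_ge0.
apply: (@le_trans _ _ (B^-1 `^ (p / (2 - p)))); last by rewrite lerDr.
have qE : (2 - p) * (p / (2 - p)) = p by rewrite mulrC divfK// gt_eqF.
rewrite -[X in x `^ X]qE (powRrM x).
apply: ge0_ler_powR; rewrite ?nnegrE ?powR_ge0 ?invr_ge0 ?(ltW B0)//.
  by rewrite divr_ge0 ?(ltW p0) ?(ltW p2').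
by rewrite -[2 - p]opprB powRN lef_pV2 ?posrE ?powR_gt0// ltW.
Qed.

Variables (p : R) (b : nat -> R).
Hypotheses (p_gt0 : 0 < p) (b_gt0 : forall j, 0 < b j) (bp : in_lp p b).

Lemma lp_norm_bounds : 0 < fine (lp_norm p b) /\
  forall N, \sum_(j < N) (b j / fine (lp_norm p b)) `^ p <= 1.
Proof.
pose E := (\esum_(i in [set: nat]) (`|b i| `^ p)%:E)%E.
have pn0 : p != 0 by rewrite gt_eqF.
have E0 : (0 <= E)%E by apply: esum_ge0 => j _; rewrite lee_fin powR_ge0.
have Efin : E \is a fin_num.
  by rewrite ge0_fin_numE//; apply: lty_poweRy bp; rewrite invr_eq0.
have sumE N : \sum_(j < N) b j `^ p <= fine E.
  rewrite -lee_fin fineK//; apply: esum_ge; exists `I_N; first by split.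
  rewrite -fsbig_ord sumEFin lee_fin.
  by apply: ler_sum => j _; rewrite gtr0_norm.
have S0 : 0 < fine E.
  by apply: lt_le_trans (sumE 1%N); rewrite big_ord1 powR_gt0.
set L := fine _; have LE : L = fine E `^ p^-1 by rewrite /L /lp_norm fine_poweR.
have L0 : 0 < L by rewrite LE powR_gt0.
have Lp : L `^ p = fine E by rewrite LE -powRrM mulVf// powRr1 ?ltW.
split => // N; rewrite -(ler_pM2r S0) mul1r mulr_suml.
apply: le_trans (sumE N); apply: ler_sum => j _.
rewrite -Lp -powRM ?divr_ge0 ?(ltW (b_gt0 j)) ?(ltW L0)//.
by rewrite divfK ?gt_eqF.
Qed.

End LpTools.

Theorem theorem3p1 (R : realType)
  (gammaN : forall N : nat, probability (N.-tuple R) R)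
  (gamma : probability (Rinfty R) R)
  (hgammaN : forall N : nat, std_gaussian_fin (gammaN N))
  (hgamma : std_gaussian_infty gamma)
  (X : completeNormedModType R[i])
  (hX : is_hilbert X) (sepX : separable X)
  (xi delta p : R) (hxi : 0 < xi) (hdelta : 0 < delta)
  (hp0 : 0 < p) (hp2 : p < 2)
  (b : nat -> R) (hb : forall j, 0 < b j) (hbp : in_lp p b)
  (u : Rinfty R -> X) (hu : holomorphic gammaN gamma b xi delta u)
  (M : nat) (hM : 2 / p <= M%:R)
  (rho : nat -> R) (hrho0 : forall j, 0 < rho j)
  (hrho : forall j, rho j ^+ 2 * b j ^+ 2 =
     (b j / fine (lp_norm p b)) `^ p * (xi ^+ 2 / (8 * expR 1 * M`!%:R))) :
  [/\ (\esum_(nu in [set: multiindex])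
         (beta M rho nu * rnorm (hermite_coef gamma u nu) ^+ 2)%:E
       <= (2 * delta ^+ 2)%:E)%E,
      in_lp (p / (2 - p)) (fun nu : multiindex => (beta M rho nu)^-1) &
      in_lp p (fun nu : multiindex => rnorm (hermite_coef gamma u nu))].
Proof.
have [dot dot_norm] := hX.
have [L0 a_le1] := lp_norm_bounds hp0 hb hbp.
set L := fine (lp_norm p b) in L0 a_le1 hrho.
set e8 := 8 * expR 1 * M`!%:R in hrho.
have fM : 1 <= M`!%:R :> R by rewrite ler1n fact_gt0.
have e1 : 1 <= expR 1 :> R by apply: le_trans (expR_ge1Dx _); rewrite lerDl ler01.
have e80 : 0 < e8 by rewrite !mulr_gt0 ?expR_gt0// (lt_le_trans ltr01 fM).
(* The radii [sqrt e8 * rho j] are admissible because the [(b j / L) ^ p] sum to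
   at most 1; [K = e8 / 2] keeps [kappa] strictly smaller, and [K >= M!] makes
   the weights [K^l / l!] at least 1 for [l <= M]. *)
pose K : R := 4 * expR 1 * M`!%:R.
have MK : M`!%:R <= K.
  rewrite /K ler_peMl ?ler0n//.
  by apply: le_trans (_ : 1 <= 4 * 1) _; [rewrite mulr1 ler1n|rewrite ler_pM2l].
have K1 : 1 <= K by exact: le_trans MK.
have K0 : 0 < K by exact: lt_le_trans K1.
pose kappa j := Num.sqrt K * rho j.
have kappa0 j : 0 <= kappa j by rewrite mulr_ge0 ?sqrtr_ge0// ltW.
have kappa_adm N : exists r : 'I_N -> R,
    admissible b xi r /\ forall i : 'I_N, kappa i < r i.
  exists (fun j => Num.sqrt e8 * rho j); split; last first.
    move=> j; rewrite /kappa ltr_pM2r// ltr_sqrt// /K /e8 -!mulrA.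
    by rewrite ltr_pM2r ?ltr_nat// mulr_gt0 ?expR_gt0// (lt_le_trans ltr01 fM).
  split => [j|]; first by rewrite mulr_gt0 ?sqrtr_gt0.
  rewrite (eq_bigr (fun j : 'I_N => (b j / L) `^ p * xi ^+ 2)).
    by rewrite -mulr_suml ler_piMl ?sqr_ge0 ?a_le1.
  move=> j _; rewrite exprMn sqr_sqrtr ?(ltW e80)// mulrC -mulrA hrho.
  by field; rewrite gt_eqF.
have coef_le s (us : uniq s) := holomorphic_hermite_coef_le dot_norm hgammaN hgamma
  (ltW hdelta) hu kappa0 kappa_adm us.
have part1 s : uniq s -> \sum_(nu <- s)
    beta M rho nu * rnorm (hermite_coef gamma u nu) ^+ 2 <= delta ^+ 2.
  move=> us; apply: le_trans (coef_le s us); apply: ler_sum => nu _.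
  by rewrite ler_wpM2r ?sqr_ge0// beta_le_multi_weight.
have p2 : 0 < 2 - p by rewrite subr_gt0.
pose q := p / (2 - p).
have q0 : 0 < q by rewrite divr_gt0.
(* The constant left when the defining relation of [rho] is divided by [b j ^+ 2] and written in
   terms of [b j / L]. *)
pose g := xi ^+ 2 / e8 / L ^+ 2.
have g0 : 0 < g by rewrite !divr_gt0 ?exprn_gt0.
have bL0 j : 0 < b j / L by rewrite divr_gt0.
have rhoE j : rho j ^+ 2 = (b j / L) `^ (p - 2) * g.
  have b2 : b j ^+ 2 != 0 by rewrite expf_neq0// gt_eqF.
  apply: (mulIf b2); rewrite hrho powRD; last by rewrite (gt_eqF (bL0 j)) implybT.
  rewrite powR_invn ?(ltW (bL0 j))// /g; field.
  by rewrite !gt_eqF.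
(* As [p - 2 < 0], this gives [rho j ^+ 2 >= g], a lower bound uniform in [j]. *)
have bL1 j : b j / L <= 1.
  rewrite leNgt; apply/negP => bL.
  have : (b j / L) `^ p <= 1.
    apply: le_trans (a_le1 j.+1); rewrite big_ord_recr /= lerDr.
    by apply: sumr_ge0 => i _; exact: powR_ge0.
  have := @gt0_ltr_powR R p hp0 1 (b j / L); rewrite !nnegrE ler01 (ltW (bL0 j)) powR1.
  by move=> /(_ isT isT bL); rewrite ltNge => /negP.
have [C HC] : exists C : R, forall s : seq multiindex, uniq s ->
    \sum_(nu <- s) (beta M rho nu)^-1 `^ q <= C.
  have M0 : (0 < M)%N by rewrite -(ltr_nat R); apply: lt_le_trans hM; rewrite divr_gt0.
  (* From [M >= 2 / p] one gets [M * q >= 2 / (2 - p) > 1]: the zeta series in [nu_j] converges. *)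
  have Mq : 1 < M.-1.+1%:R * q.
    rewrite prednK//; apply: (@lt_le_trans _ _ (2 / p * q)); last by rewrite ler_pM2r.
    rewrite /q mulrA divfK ?gt_eqF// ltr_pdivlMr// mul1r ltrBlDr ltrDl.
    exact: hp0.
  pose r := Num.min 1 g.
  have r01 : 0 < r <= 1 by rewrite lt_min ltr01 g0 ge_min lexx.
  rewrite -(prednK M0).
  apply: (sum_beta_le q0 Mq r01 (K := g `^ (- q)) (a := fun j => (b j / L) `^ p)) => //.
  - move=> j; rewrite rhoE ge_min; apply/orP; right; rewrite ler_peMl ?(ltW g0)//.
    rewrite -[leLHS](powRr0 (b j / L)) ger_powR ?bL0 ?bL1// subr_le0.
    exact: ltW.
  (* The exponent [q] satisfies [(p - 2) * (- q) = p]: the power [- q] of [rho j ^+ 2] is a multiple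
     of [(b j / L)^p], which is summable. *)
  - move=> j; rewrite rhoE powRM ?powR_ge0 ?(ltW g0)// -powRrM mulrC.
    rewrite ler_wpM2l ?powR_ge0// le_eqVlt; apply/orP; left; apply/eqP; congr (_ `^ _).
    by rewrite /q; field; rewrite gt_eqF.
  - exact: powR_ge0.
split.
- apply: esum_le_seq => [nu|s us].
    by rewrite mulr_ge0 ?sqr_ge0// ltW// beta_gt0.
  by apply: le_trans (part1 s us) _; rewrite mulr_natl mulr2n lerDl sqr_ge0.
- apply: (in_lp_seq (C := C)) => s us; apply: le_trans (HC s us).
  by apply: ler_sum => nu _; rewrite ger0_norm ?invr_ge0// ltW// beta_gt0.
- apply: (in_lp_seq (C := delta ^+ 2 + C)) => s us.
  apply: le_trans (lerD (part1 s us) (HC s us)); rewrite -big_split /=.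
  apply: ler_sum => nu _; rewrite ger0_norm ?rnorm_ge0//.
  by apply: powR_le_interpolate; rewrite ?hp0 ?hp2 ?rnorm_ge0 ?beta_gt0.
Qed.
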